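(* Let $\lambda\in\mathbb C\setminus\{0\}$, let $a$ be a positive integer and let $R\in x^{a}\mathbb C\{x,y\}$. Consider $X_R=\lambda x\frac{\partial}{\partial x}+(1+R)y\frac{\partial}{\partial y}$ on a polydisc $\mathcal U=\rho\mathbb D\times r\mathbb D$ on which $R$ is holomorphic, bounded, and satisfies $\sup_{\mathcal U}|R|<1$. Let $\mathcal E:(z,w)\mapsto(e^{z},e^{w})$ be the universal covering of $\hat{\mathcal U}=\mathcal U\setminus\{xy=0\}$ by $\tilde{\mathcal U}=\{\operatorname{Re} z<\ln\rho,\ \operatorname{Re} w<\ln r\}$. Then the pulled-back foliation $\mathcal E^{*}\mathcal F_R$ on $\tilde{\mathcal U}$ is regular (nonsingular), and each of its leaves is simply connected.
   Context: $\mathcal F_R$ denotes the holomorphic foliation of $\mathcal U$ whose leaves are the integral curves of $X_R$. The foliation $\mathcal E^{*}\mathcal F_R$ on $\tilde{\mathcal U}$ is the foliation by integral curves of $\mathcal E^{*}X_R=\lambda\frac{\partial}{\partial z}+(1+R\circ\mathcal E)\frac{\partial}{\partial w}$. *)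

(* Defs.v *)
From Stdlib Require Import Reals.
From Coquelicot Require Import Coquelicot.

Local Open Scope R_scope.

Definition Cexp (z : C) : C :=
  (exp (Re z) * cos (Im z), exp (Re z) * sin (Im z)).

Definition C2 : Type := (C * C)%type.

Definition holo2_at (F : C -> C -> C) (x y : C) : Prop :=
  exists a b : C, forall eps : R, 0 < eps -> exists delta : R, 0 < delta /\
    forall h k : C, Cmod h < delta -> Cmod k < delta ->
      Cmod (F (x + h)%C (y + k)%C - F x y - a * h - b * k)%C
        <= eps * (Cmod h + Cmod k).

Definition polydisc (rho r : R) (p : C2) : Prop :=
  Cmod (fst p) < rho /\ Cmod (snd p) < r.

Definition holo2_on (U : C2 -> Prop) (F : C -> C -> C) : Prop :=
  forall p, U p -> holo2_at F (fst p) (snd p).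

Definition in_xa_germs (a : nat) (F : C -> C -> C) : Prop :=
  exists eps : R, 0 < eps /\ exists S : C -> C -> C,
    holo2_on (polydisc eps eps) S /\
    forall x y : C, polydisc eps eps (x, y) -> F x y = (x ^ a * S x y)%C.

Definition Utilde (rho r : R) (p : C2) : Prop :=
  Re (fst p) < ln rho /\ Re (snd p) < ln r.

Definition Ecov (p : C2) : C2 := (Cexp (fst p), Cexp (snd p)).

Definition pullback_field (lam : C) (F : C -> C -> C) (p : C2) : C2 :=
  (lam, (1 + F (fst (Ecov p)) (snd (Ecov p)))%C).

Definition integral_curve (lam : C) (F : C -> C -> C) (rho r : R)
    (phi : C -> C2) (c : C) (eps : R) : Prop :=
  forall T : C, Cmod (T - c)%C < eps ->
    Utilde rho r (phi T) /\
    @is_derive C_AbsRing C_NormedModule (fun S => fst (phi S)) T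
      (fst (pullback_field lam F (phi T))) /\
    @is_derive C_AbsRing C_NormedModule (fun S => snd (phi S)) T
      (snd (pullback_field lam F (phi T))).

(** same_leaf p q : q lies on the leaf through p of the foliation of U~ by
    integral curves of E^* X_R, i.e. p and q are joined by a finite chain of
    integral curves (each defined on a disc, hence connected). *)
Inductive same_leaf (lam : C) (F : C -> C -> C) (rho r : R) (p : C2)
  : C2 -> Prop :=
| same_leaf_refl : Utilde rho r p -> same_leaf lam F rho r p p
| same_leaf_step : forall (q : C2) (phi : C -> C2) (c : C) (eps : R) (T1 T2 : C),
    same_leaf lam F rho r p q ->
    0 < eps -> integral_curve lam F rho r phi c eps ->
    Cmod (T1 - c)%C < eps -> Cmod (T2 - c)%C < eps ->
    phi T1 = q -> same_leaf lam F rho r p (phi T2).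

(** Leaf topology: the final topology for all integral curves, i.e. O is
    open iff its preimage under every integral curve is open. *)
Definition leaf_open (lam : C) (F : C -> C -> C) (rho r : R)
    (O : C2 -> Prop) : Prop :=
  forall (phi : C -> C2) (c : C) (eps : R),
    integral_curve lam F rho r phi c eps ->
    forall T : C, Cmod (T - c)%C < eps -> O (phi T) ->
      exists delta : R, 0 < delta /\
        forall T' : C, Cmod (T' - T)%C < delta -> Cmod (T' - c)%C < eps ->
          O (phi T').

Definition leaf_cont1 (lam : C) (F : C -> C -> C) (rho r : R)
    (g : R -> C2) : Prop :=
  forall t : R, 0 <= t <= 1 ->
    forall O : C2 -> Prop, leaf_open lam F rho r O -> O (g t) ->
      exists delta : R, 0 < delta /\
        forall t' : R, 0 <= t' <= 1 -> Rabs (t' - t) < delta -> O (g t').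

Definition leaf_cont2 (lam : C) (F : C -> C -> C) (rho r : R)
    (H : R -> R -> C2) : Prop :=
  forall s t : R, 0 <= s <= 1 -> 0 <= t <= 1 ->
    forall O : C2 -> Prop, leaf_open lam F rho r O -> O (H s t) ->
      exists delta : R, 0 < delta /\
        forall s' t' : R, 0 <= s' <= 1 -> 0 <= t' <= 1 ->
          Rabs (s' - s) < delta -> Rabs (t' - t) < delta -> O (H s' t').

Definition leaf_simply_connected (lam : C) (F : C -> C -> C) (rho r : R)
    (p : C2) : Prop :=
  let L := same_leaf lam F rho r p in
  (forall q : C2, L q ->
     exists g : R -> C2, leaf_cont1 lam F rho r g /\
       (forall t, 0 <= t <= 1 -> L (g t)) /\ g 0 = p /\ g 1 = q) /\
  (forall g : R -> C2, leaf_cont1 lam F rho r g ->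
     (forall t, 0 <= t <= 1 -> L (g t)) -> g 0 = g 1 ->
     exists H : R -> R -> C2, leaf_cont2 lam F rho r H /\
       (forall s t, 0 <= s <= 1 -> 0 <= t <= 1 -> L (H s t)) /\
       (forall t, 0 <= t <= 1 -> H 0 t = g t /\ H 1 t = g 0) /\
       (forall s, 0 <= s <= 1 -> H s 0 = g 0 /\ H s 1 = g 0)).

(* Main.v *)
Require Import Defs.
From Stdlib Require Import Reals Lra Classical ClassicalEpsilon.
From Coquelicot Require Import Coquelicot.

(** In the time coordinate T = z / lam every leaf is locally the graph of a
    holomorphic solution of w' = 1 + F(e^(lam T), e^w), whose slope lies in the
    disc of radius M < 1 around 1. Along a path of time displacement v with
    Re (k v) <= 0 for every slope k, Re w does not increase, so lifting such a
    path to the leaf can fail only by leaving {Re z < ln rho}.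

    If Re lam >= 0, a loop is contracted by joining each of its points by a
    straight time segment to T0 - S with S large: these segments point almost in
    the direction -1, along which neither Re z nor Re w increases. If Re lam < 0,
    each point of the loop is first pushed in the direction -1 until
    Re z = ln rho - m; the resulting loop lies over a real line, hence lives in
    a one-dimensional solution curve and is contracted along this curve.

    Uniform local existence and uniqueness of the solutions rest on a Lipschitz
    bound for the slope, which comes from Goursat's theorem; primitives in the
    Picard iteration come from it as well. *)

Local Open Scope R_scope.

(** * Complex derivatives *)

(** The time coordinate maps a leaf to the plane as a local homeomorphism, but nothing shows
    beforehand that this map is injective or that its image is convex, so a loop cannot simply be
    contracted in the plane and carried back. A homotopy of times is therefore lifted segment by
    segment; the danger is that a lift runs into [Re w = ln r] or [Re z = ln rho] on the way. The
    strict bound [M < 1] is what removes the first danger: every slope has real part at least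
    [1 - M > 0], hence one direction of time, -1, lowers [Re w] on all leaves at once. Moving in
    this direction changes [Re z] at the rate [- Re lam], which is why the sign of [Re lam] decides
    how far a loop can be pushed. The domain is unbounded and segments may be long, so the step size
    of local solutions must depend only on the margin to the boundary. Finally, these contractions
    move the base point of the loop, whereas simple connectedness is stated with a fixed one; a
    deformation of the parameter square repairs this. *)

Lemma Cmod_sub_sym (x y : C) : Cmod (x - y) = Cmod (y - x).
Proof. rewrite <- Cmod_opp. f_equal. ring. Qed.

Lemma Cmod_sub_triangle (x y z : C) : Cmod (x - z) <= Cmod (x - y) + Cmod (y - z).
Proof.
  replace (x - z)%C with ((x - y) + (y - z))%C by ring. apply Cmod_triangle.
Qed.

Lemma im_le_Cmod (c : C) : Rabs (Im c) <= Cmod c.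
Proof.
  eapply Rle_trans; [|apply Rmax_Cmod]. apply Rmax_r.
Qed.

Lemma Cmod_le_Re_Im (c : C) : Cmod c <= Rabs (Re c) + Rabs (Im c).
Proof.
  replace c with (RtoC (Re c) + Ci * RtoC (Im c))%C at 1.
  - eapply Rle_trans; [apply Cmod_triangle|].
    rewrite Cmod_mult, Cmod_Ci, !Cmod_R. lra.
  - destruct c as [a b]; unfold Ci, RtoC, Cplus, Cmult; simpl; f_equal; ring.
Qed.

(** The quotient-free form has the same shape as [holo2_at], so the two combine in a chain rule;
    [cder_is_derive] ties it to the derivative in the definition of integral curves. *)
Definition cder (f : C -> C) (z l : C) : Prop :=
  forall eps : R, 0 < eps -> exists delta : R, 0 < delta /\
    forall h : C, Cmod h < delta ->
      Cmod (f (z + h) - f z - l * h)%C <= eps * Cmod h.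

Definition ccont (f : C -> C) (z : C) : Prop :=
  forall eps : R, 0 < eps -> exists delta : R, 0 < delta /\
    forall h : C, Cmod h < delta -> Cmod (f (z + h) - f z)%C < eps.

Lemma cder_is_derive (f : C -> C) (z l : C) :
  @is_derive C_AbsRing C_NormedModule f z l <-> cder f z l.
Proof.
  split.
  - intros [_ H] eps Heps.
    specialize (H z (fun P HP => HP) (mkposreal eps Heps)).
    destruct H as [d Hd].
    exists d. split; [apply cond_pos|]. intros h Hh.
    assert (Hb : @ball (AbsRing_UniformSpace C_AbsRing) z d (z + h)%C).
    { change (Cmod ((z + h) - z)%C < d).
      replace ((z + h) - z)%C with h by ring. exact Hh. }
    specialize (Hd _ Hb). 
    change (Cmod ((f (z + h) - f z) - ((z + h) - z) * l)%C <= eps * Cmod ((z + h) - z)%C) in Hd.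
    replace ((z + h) - z)%C with h in Hd by ring.
    rewrite (Cmult_comm l h). exact Hd.
  - intros H. split.
    + apply is_linear_scal_l.
    + intros x Hx eps.
      assert (Ex : x = z).
      { symmetry. apply (is_filter_lim_locally_unique (K:=C_AbsRing) (V:=AbsRing_NormedModule C_AbsRing)). exact Hx. }
      subst x.
      destruct (H eps (cond_pos eps)) as [d [Hd H']].
      exists (mkposreal d Hd).
      assert (A : forall y : C, Cmod (y - z)%C < d ->
        Cmod ((f y - f z) - (y - z) * l)%C <= eps * Cmod (y - z)%C).
      { intros y Hy. specialize (H' _ Hy).
        replace (z + (y - z))%C with y in H' by ring.
        rewrite (Cmult_comm (y - z)%C l). exact H'. }
      intros y Hy. exact (A y Hy).
Qed.

Lemma cder_ccont (f : C -> C) (z l : C) : cder f z l -> ccont f z.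
Proof.
  intros H eps Heps.
  destruct (H 1 Rlt_0_1) as [d [Hd Hf]].
  pose proof (Cmod_ge_0 l) as Hl.
  assert (Hq : 0 < eps / (Cmod l + 2)) by (apply Rdiv_lt_0_compat; lra).
  exists (Rmin d (eps / (Cmod l + 2))). split; [apply Rmin_glb_lt; lra|].
  intros h Hh.
  assert (Hh1 := Rlt_le_trans _ _ _ Hh (Rmin_l _ _)).
  assert (Hh2 := Rlt_le_trans _ _ _ Hh (Rmin_r _ _)).
  specialize (Hf h Hh1).
  replace (f (z + h) - f z)%C with ((f (z + h) - f z - l * h) + l * h)%C by ring.
  eapply Rle_lt_trans; [apply Cmod_triangle|]. rewrite Cmod_mult.
  apply (Rmult_lt_compat_r (Cmod l + 2)) in Hh2; [|lra].
  unfold Rdiv in Hh2. rewrite Rmult_assoc, Rinv_l in Hh2 by lra.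
  pose proof (Cmod_ge_0 h). nra.
Qed.

Lemma cder_ext_loc (f g : C -> C) (z l : C) (d : R) :
  0 < d -> (forall h, Cmod h < d -> f (z + h)%C = g (z + h)%C) -> cder f z l -> cder g z l.
Proof.
  intros Hd E H eps Heps. destruct (H eps Heps) as [d' [Hd' H']].
  exists (Rmin d d'). split; [apply Rmin_glb_lt; lra|]. intros h Hh.
  rewrite <- (E h), <- (Cplus_0_r z) at 1.
  2: { eapply Rlt_le_trans; [exact Hh | apply Rmin_l]. }
  assert (E0 : g z = f z).
  { replace z with (z + 0)%C by ring. symmetry. apply E. rewrite Cmod_0; lra. }
  rewrite E0, Cplus_0_r. apply H'. eapply Rlt_le_trans; [exact Hh | apply Rmin_r].
Qed.

Lemma cder_ext (f g : C -> C) (z l : C) : (forall x, f x = g x) -> cder f z l -> cder g z l.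
Proof. intros E. apply (cder_ext_loc f g z l 1 Rlt_0_1). intros; apply E. Qed.

Lemma cder_const (c z : C) : cder (fun _ => c) z 0.
Proof.
  intros eps He. exists 1. split; [lra|]. intros h _.
  replace (c - c - 0 * h)%C with (RtoC 0) by ring. rewrite Cmod_0.
  apply Rmult_le_pos; [lra | apply Cmod_ge_0].
Qed.

Lemma cder_affine (a b z : C) : cder (fun x => a * x + b)%C z a.
Proof.
  intros eps He. exists 1. split; [lra|]. intros h _.
  replace (a * (z + h) + b - (a * z + b) - a * h)%C with (RtoC 0) by ring. rewrite Cmod_0.
  apply Rmult_le_pos; [lra | apply Cmod_ge_0].
Qed.

Lemma cder_plus (f g : C -> C) (z l m : C) :
  cder f z l -> cder g z m -> cder (fun x => f x + g x)%C z (l + m)%C.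
Proof.
  intros Hf Hg eps He.
  destruct (Hf (eps / 2)) as [d1 [Hd1 H1]]; [lra|].
  destruct (Hg (eps / 2)) as [d2 [Hd2 H2]]; [lra|].
  exists (Rmin d1 d2). split; [apply Rmin_glb_lt; lra|]. intros h Hh.
  specialize (H1 h (Rlt_le_trans _ _ _ Hh (Rmin_l _ _))).
  specialize (H2 h (Rlt_le_trans _ _ _ Hh (Rmin_r _ _))).
  replace (f (z + h) + g (z + h) - (f z + g z) - (l + m) * h)%C
    with ((f (z + h) - f z - l * h) + (g (z + h) - g z - m * h))%C by ring.
  eapply Rle_trans; [apply Cmod_triangle|]. lra.
Qed.

Lemma cder_scal (f : C -> C) (c z l : C) :
  cder f z l -> cder (fun x => c * f x)%C z (c * l)%C.
Proof.
  intros Hf eps He. pose proof (Cmod_ge_0 c) as Hc.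
  destruct (Hf (eps / (Cmod c + 1))) as [d [Hd H]]; [apply Rdiv_lt_0_compat; lra|].
  exists d. split; [lra|]. intros h Hh. specialize (H h Hh).
  replace (c * f (z + h) - c * f z - c * l * h)%C
    with (c * (f (z + h) - f z - l * h))%C by ring.
  rewrite Cmod_mult. pose proof (Cmod_ge_0 h) as Hh0.
  pose proof (Cmod_ge_0 (f (z + h) - f z - l * h)%C).
  apply Rle_trans with ((Cmod c + 1) * (eps / (Cmod c + 1) * Cmod h)); [nra|].
  right. field. lra.
Qed.

Lemma cder_minus (f g : C -> C) (z l m : C) :
  cder f z l -> cder g z m -> cder (fun x => f x - g x)%C z (l - m)%C.
Proof.
  intros Hf Hg.
  apply (cder_ext (fun x => f x + (- (1)) * g x)%C); [intros; ring|].
  replace (l - m)%C with (l + (- (1)) * m)%C by ring.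
  apply cder_plus; [exact Hf | apply cder_scal, Hg].
Qed.

(** The chain rule through a function of two variables; it also yields the product rule and the
    one-variable chain rule. The derivative is left existential, since Goursat's theorem asks for no
    more. *)
Lemma holo2_comp (G : C -> C -> C) (f g : C -> C) (z l m : C) :
  holo2_at G (f z) (g z) -> cder f z l -> cder g z m ->
  exists k, cder (fun x => G (f x) (g x)) z k.
Proof.
  intros [a [b HG]] Hf Hg. exists (a * l + b * m)%C. intros eps He.
  pose proof (Cmod_ge_0 l) as Hl. pose proof (Cmod_ge_0 m) as Hm.
  pose proof (Cmod_ge_0 a) as Ha. pose proof (Cmod_ge_0 b) as Hb.
  set (e1 := eps / (2 * (Cmod l + Cmod m + 2))).
  assert (He1 : 0 < e1) by (apply Rdiv_lt_0_compat; lra).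
  (* The cap 1 gives the crude bounds [(Cmod l + 1) * Cmod h] and [(Cmod m + 1) * Cmod h] on the two
     increments, against which [e1] is scaled. *)
  set (e2 := Rmin 1 (eps / (2 * (Cmod a + Cmod b + 1)))).
  assert (He2 : 0 < e2) by (apply Rmin_glb_lt; [lra | apply Rdiv_lt_0_compat; lra]).
  assert (He2' : e2 <= 1) by apply Rmin_l.
  assert (E1 : e1 * (Cmod l + Cmod m + 2) = eps / 2) by (unfold e1; field; lra).
  assert (E2 : e2 * (Cmod a + Cmod b + 1) <= eps / 2).
  { apply Rle_trans with (eps / (2 * (Cmod a + Cmod b + 1)) * (Cmod a + Cmod b + 1)).
    - apply Rmult_le_compat_r; [lra | apply Rmin_r].
    - right. field. lra. }
  clearbody e1 e2.
  destruct (HG e1 He1) as [d [Hd H]].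
  destruct (Hf e2 He2) as [d1 [Hd1 H1]].
  destruct (Hg e2 He2) as [d2 [Hd2 H2]].
  destruct (cder_ccont _ _ _ Hf d Hd) as [d3 [Hd3 H3]].
  destruct (cder_ccont _ _ _ Hg d Hd) as [d4 [Hd4 H4]].
  exists (Rmin (Rmin d1 d2) (Rmin d3 d4)).
  split; [repeat apply Rmin_glb_lt; lra|]. intros h Hh.
  assert (Cmod h < d1 /\ Cmod h < d2 /\ Cmod h < d3 /\ Cmod h < d4) as (B1 & B2 & B3 & B4).
  { pose proof (Rmin_l (Rmin d1 d2) (Rmin d3 d4)). pose proof (Rmin_r (Rmin d1 d2) (Rmin d3 d4)).
    pose proof (Rmin_l d1 d2). pose proof (Rmin_r d1 d2).
    pose proof (Rmin_l d3 d4). pose proof (Rmin_r d3 d4). lra. }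
  specialize (H1 h B1). specialize (H2 h B2). specialize (H3 h B3). specialize (H4 h B4).
  specialize (H _ _ H3 H4).
  replace (f z + (f (z + h) - f z))%C with (f (z + h)%C) in H by ring.
  replace (g z + (g (z + h) - g z))%C with (g (z + h)%C) in H by ring.
  set (df := (f (z + h) - f z)%C) in *. set (dg := (g (z + h) - g z)%C) in *.
  set (dG := (G (f (z + h)%C) (g (z + h)%C) - G (f z) (g z))%C) in *.
  replace (dG - (a * l + b * m) * h)%C
    with ((dG - a * df - b * dg) + (a * (df - l * h) + b * (dg - m * h)))%C by ring.
  pose proof (Cmod_ge_0 h) as Hh0.
  assert (Mf : Cmod df <= (Cmod l + 1) * Cmod h).
  { replace df with ((df - l * h) + l * h)%C by ring.
    eapply Rle_trans; [apply Cmod_triangle|]. rewrite Cmod_mult. nra. }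
  assert (Mg : Cmod dg <= (Cmod m + 1) * Cmod h).
  { replace dg with ((dg - m * h) + m * h)%C by ring.
    eapply Rle_trans; [apply Cmod_triangle|]. rewrite Cmod_mult. nra. }
  eapply Rle_trans; [apply Cmod_triangle|].
  assert (T1 : Cmod (dG - a * df - b * dg)%C <= eps / 2 * Cmod h) by nra.
  assert (T2 : Cmod (a * (df - l * h) + b * (dg - m * h))%C <= eps / 2 * Cmod h).
  { eapply Rle_trans; [apply Cmod_triangle|]. rewrite !Cmod_mult.
    pose proof (Cmod_ge_0 (df - l * h)%C). pose proof (Cmod_ge_0 (dg - m * h)%C).
    apply Rle_trans with (e2 * (Cmod a + Cmod b + 1) * Cmod h); nra. }
  lra.
Qed.

Lemma holo2_mult (x y : C) : holo2_at Cmult x y.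
Proof.
  exists y, x. intros eps He. exists eps. split; [lra|]. intros h k Hh Hk.
  replace ((x + h) * (y + k) - x * y - y * h - x * k)%C with (h * k)%C by ring.
  rewrite Cmod_mult. pose proof (Cmod_ge_0 h). pose proof (Cmod_ge_0 k). nra.
Qed.

Lemma holo2_fst (f : C -> C) (x y l : C) : cder f x l -> holo2_at (fun u _ => f u) x y.
Proof.
  intros H. exists l, (RtoC 0). intros eps He. destruct (H eps He) as [d [Hd H']].
  exists d. split; [lra|]. intros h k Hh Hk. specialize (H' h Hh).
  replace (f (x + h) - f x - l * h - 0 * k)%C with (f (x + h) - f x - l * h)%C by ring.
  pose proof (Cmod_ge_0 k). nra.
Qed.

Lemma cder_comp (f g : C -> C) (z l m : C) :
  cder f (g z) l -> cder g z m -> exists k, cder (fun x => f (g x)) z k.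
Proof.
  intros Hf Hg. apply (holo2_comp (fun u _ => f u) g g z m m); auto.
  eapply holo2_fst; eauto.
Qed.

Lemma cder_mult_ex (f g : C -> C) (z l m : C) :
  cder f z l -> cder g z m -> exists k, cder (fun x => f x * g x)%C z k.
Proof. apply holo2_comp, holo2_mult. Qed.

(** * The complex exponential *)

Lemma Cexp_plus (x y : C) : Cexp (x + y) = (Cexp x * Cexp y)%C.
Proof.
  destruct x as [a b], y as [c d]. unfold Cexp, Cplus, Cmult. simpl.
  rewrite exp_plus, cos_plus, sin_plus. f_equal; ring.
Qed.

Lemma Cmod_Cexp (z : C) : Cmod (Cexp z) = exp (Re z).
Proof.
  unfold Cmod, Cexp. simpl.
  replace (exp (Re z) * cos (Im z) * (exp (Re z) * cos (Im z) * 1) +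
    exp (Re z) * sin (Im z) * (exp (Re z) * sin (Im z) * 1))
    with ((exp (Re z))² * ((sin (Im z))² + (cos (Im z))²)) by (unfold Rsqr; ring).
  rewrite sin2_cos2, Rmult_1_r. apply sqrt_Rsqr. left. apply exp_pos.
Qed.

Lemma real_small_o (f : R -> R) (l : R) :
  is_derive f 0 l -> forall eps, 0 < eps -> exists d, 0 < d /\
    forall x, Rabs x < d -> Rabs (f x - f 0 - x * l) <= eps * Rabs x.
Proof.
  intros [_ H] eps He. specialize (H 0 (fun P HP => HP) (mkposreal eps He)).
  destruct H as [d Hd]. exists d. split; [apply cond_pos|]. intros x Hx.
  assert (Hb : ball 0 d x).
  { change (Rabs (x - 0) < d). now rewrite Rminus_0_r. }
  specialize (Hd x Hb).
  change (Rabs ((f x - f 0) - (x - 0) * l) <= eps * Rabs (x - 0)) in Hd.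
  now rewrite Rminus_0_r in Hd.
Qed.

Lemma cder_Cexp_0 : cder Cexp 0 1.
Proof.
  (* The two components err by at most [3 * e * n] and [5 * e * n], with [n] the modulus of the
     increment; hence the 8. The cap 1 keeps the increment below 1. *)
  intros eps He. set (e := Rmin 1 (eps / 8)).
  assert (He0 : 0 < e) by (apply Rmin_glb_lt; lra).
  assert (He1 : e <= 1) by apply Rmin_l. assert (He8 : e <= eps / 8) by apply Rmin_r.
  destruct (real_small_o exp 1) with (eps := e) as [d1 [Hd1 H1]]; auto.
  { auto_derive; auto. rewrite exp_0. ring. }
  destruct (real_small_o cos 0) with (eps := e) as [d2 [Hd2 H2]]; auto.
  { auto_derive; auto. rewrite sin_0. ring. }
  destruct (real_small_o sin 1) with (eps := e) as [d3 [Hd3 H3]]; auto.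
  { auto_derive; auto. rewrite cos_0. ring. }
  exists (Rmin e (Rmin d1 (Rmin d2 d3))). split; [repeat apply Rmin_glb_lt; lra|].
  intros [a b] Hh.
  pose proof (re_le_Cmod (a, b)) as Ha. pose proof (im_le_Cmod (a, b)) as Hb. simpl in Ha, Hb.
  assert (Cmod (a, b) < e /\ Cmod (a, b) < d1 /\ Cmod (a, b) < d2 /\ Cmod (a, b) < d3) as (B0 & B1 & B2 & B3).
  { pose proof (Rmin_l e (Rmin d1 (Rmin d2 d3))). pose proof (Rmin_r e (Rmin d1 (Rmin d2 d3))).
    pose proof (Rmin_l d1 (Rmin d2 d3)). pose proof (Rmin_r d1 (Rmin d2 d3)).
    pose proof (Rmin_l d2 d3). pose proof (Rmin_r d2 d3). lra. }
  specialize (H1 a ltac:(lra)). specialize (H2 b ltac:(lra)). specialize (H3 b ltac:(lra)).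
  rewrite exp_0 in H1. rewrite cos_0 in H2. rewrite sin_0 in H3.
  set (n := Cmod (a, b)) in *. set (X := exp a) in *. set (Y := cos b) in *. set (Z := sin b) in *.
  assert (HY : Rabs Y <= 1) by (apply Rabs_le; pose proof (COS_bound b); unfold Y; lra).
  assert (P1 : Rabs (X * Y - 1 - a) <= e * Rabs a + 2 * (e * Rabs b)).
  { replace (X * Y - 1 - a) with ((X - 1 - a * 1) * Y + (1 + a) * (Y - 1 - b * 0)) by ring.
    eapply Rle_trans; [apply Rabs_triang|]. rewrite !Rabs_mult.
    assert (Rabs (1 + a) <= 2) by (eapply Rle_trans; [apply Rabs_triang|]; rewrite Rabs_R1; lra).
    pose proof (Rabs_pos (X - 1 - a * 1)). pose proof (Rabs_pos (Y - 1 - b * 0)). nra. }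
  assert (P2 : Rabs (X * Z - b) <= 4 * (e * Rabs b) + e * Rabs b).
  { replace (X * Z - b) with ((X - 1) * Z + (Z - 0 - b * 1)) by ring.
    eapply Rle_trans; [apply Rabs_triang|]. rewrite Rabs_mult.
    assert (Rabs (X - 1) <= 2 * Rabs a).
    { replace (X - 1) with ((X - 1 - a * 1) + a) by ring.
      eapply Rle_trans; [apply Rabs_triang|]. pose proof (Rabs_pos a). nra. }
    assert (Rabs Z <= 2 * Rabs b).
    { replace Z with ((Z - 0 - b * 1) + b) by ring.
      eapply Rle_trans; [apply Rabs_triang|]. pose proof (Rabs_pos b). nra. }
    pose proof (Rabs_pos a). pose proof (Rabs_pos b). pose proof (Rabs_pos (X - 1)).
    pose proof (Rabs_pos Z).
    apply Rplus_le_compat; [|lra]. apply Rle_trans with ((2 * e) * (2 * Rabs b)); [|lra].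
    apply Rmult_le_compat; lra. }
  eapply Rle_trans; [apply Cmod_le_Re_Im|].
  unfold Cexp, Cplus, Cminus, Cmult, Copp, RtoC. simpl.
  rewrite !Rplus_0_l, exp_0, cos_0, sin_0. fold X Y Z.
  replace (X * Y + - (1 * 1) + - (1 * a - 0 * b)) with (X * Y - 1 - a) by ring.
  replace (X * Z + - (1 * 0) + - (1 * b + 0 * a)) with (X * Z - b) by ring.
  assert (Hn0 : 0 <= n) by apply Cmod_ge_0. fold n.
  pose proof (Rabs_pos a). pose proof (Rabs_pos b). nra.
Qed.

Lemma cder_Cexp (z : C) : cder Cexp z (Cexp z).
Proof.
  intros eps He. pose proof (Cmod_ge_0 (Cexp z)) as Hz.
  destruct (cder_Cexp_0 (eps / (Cmod (Cexp z) + 1))) as [d [Hd H]]; [apply Rdiv_lt_0_compat; lra|].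
  exists d. split; [lra|]. intros h Hh. specialize (H h Hh).
  rewrite Cplus_0_l in H. rewrite Cexp_plus.
  assert (E : Cexp 0 = 1) by (unfold Cexp, RtoC; simpl; rewrite exp_0, cos_0, sin_0; f_equal; ring).
  rewrite E in H.
  replace (Cexp z * Cexp h - Cexp z - Cexp z * h)%C
    with (Cexp z * (Cexp h - 1 - 1 * h))%C by ring.
  rewrite Cmod_mult. pose proof (Cmod_ge_0 h). pose proof (Cmod_ge_0 (Cexp h - 1 - 1 * h)%C).
  apply Rle_trans with ((Cmod (Cexp z) + 1) * (eps / (Cmod (Cexp z) + 1) * Cmod h)); [nra|].
  right. field. lra.
Qed.

(** * Mean value bounds along segments *)

Lemma cder_line (f : C -> C) (a d l k : C) (x : R) :
  cder f (a + RtoC x * d)%C l ->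
  is_derive (fun t : R => Re (k * f (a + RtoC t * d))%C) x (Re (k * (l * d))%C).
Proof.
  intros H. split; [apply is_linear_scal_l|].
  intros y Hy. assert (Ey : y = x) by (symmetry; apply (is_filter_lim_locally_unique (K:=R_AbsRing) (V:=R_NormedModule)); exact Hy).
  subst y. clear Hy. intros eps.
  pose proof (Cmod_ge_0 k) as Hk. pose proof (Cmod_ge_0 d) as Hd.
  set (q := (Cmod k + 1) * (Cmod d + 1)).
  assert (Hq : 0 < q) by (apply Rmult_lt_0_compat; lra).
  destruct (H (eps / q)) as [r [Hr H']].
  { apply Rdiv_lt_0_compat; [apply cond_pos | exact Hq]. }
  assert (Hp : 0 < r / (Cmod d + 1)) by (apply Rdiv_lt_0_compat; lra).
  exists (mkposreal _ Hp). intros y Hy.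
  change (Rabs (y - x) < r / (Cmod d + 1)) in Hy.
  change (Rabs ((Re (k * f (a + RtoC y * d))%C - Re (k * f (a + RtoC x * d))%C)
     - (y - x) * Re (k * (l * d))%C) <= eps * Rabs (y - x)).
  specialize (H' (RtoC (y - x) * d)%C).
  rewrite Cmod_mult, Cmod_R in H'.
  assert (B : Rabs (y - x) * Cmod d < r).
  { apply (Rmult_lt_compat_r (Cmod d + 1)) in Hy; [|lra].
    unfold Rdiv in Hy. rewrite Rmult_assoc, Rinv_l in Hy by lra.
    pose proof (Rabs_pos (y - x)). nra. }
  specialize (H' B).
  replace (a + RtoC x * d + RtoC (y - x) * d)%C with (a + RtoC y * d)%C in H'
    by (rewrite RtoC_minus; ring).
  set (w := (f (a + RtoC y * d) - f (a + RtoC x * d) - l * (RtoC (y - x) * d))%C) in *.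
  replace (Re (k * f (a + RtoC y * d))%C - Re (k * f (a + RtoC x * d))%C - (y - x) * Re (k * (l * d))%C)
    with (Re (k * w)%C).
  2: { unfold w, RtoC, Re, Cmult, Cminus, Cplus, Copp. simpl. ring. }
  eapply Rle_trans; [apply re_le_Cmod|]. rewrite Cmod_mult.
  pose proof (Rabs_pos (y - x)). pose proof (Cmod_ge_0 w).
  apply Rle_trans with ((Cmod k + 1) * (eps / q * (Rabs (y - x) * (Cmod d + 1)))).
  - assert (0 <= eps / q) by (left; apply Rdiv_lt_0_compat; [apply cond_pos | exact Hq]).
    apply Rmult_le_compat; try lra. eapply Rle_trans; [exact H'|]. nra.
  - right. unfold q. field. split; lra.
Qed.

Lemma choice_fun {A B : Type} (P : A -> B -> Prop) :
  (forall x, exists y, P x y) -> exists f : A -> B, forall x, P x (f x).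
Proof.
  intros H.
  exists (fun x => proj1_sig (constructive_indefinite_description _ (H x))).
  intros x. apply proj2_sig.
Qed.

(** The mean value theorem fails for complex values but holds for each real functional [Re (k * _)].
    The factor [k] is the conjugate of the increment when a modulus is bounded and 1 when [Re w] is
    followed along a lift; [Q] carries what is known of the derivative to the intermediate point. *)
Lemma cder_MVT_Re (f : C -> C) (a b k : C) (Q : C -> Prop) :
  (forall x : R, 0 <= x <= 1 -> exists l, cder f (a + RtoC x * (b - a))%C l /\ Q l) ->
  exists l : C, Q l /\ Re (k * (f b - f a))%C = Re (k * (l * (b - a)))%C.
Proof.
  intros H.
  destruct (choice_fun (fun (x : R) (l : C) => 0 <= x <= 1 -> cder f (a + RtoC x * (b - a))%C l /\ Q l)) as [df Hdf].
  { intros x. destruct (classic (0 <= x <= 1)) as [Hx|Hx].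
    - destruct (H x Hx) as [l Hl]. exists l; auto.
    - exists (RtoC 0). tauto. }
  assert (D : forall x, 0 <= x <= 1 ->
    is_derive (fun t : R => Re (k * f (a + RtoC t * (b - a)))%C) x (Re (k * (df x * (b - a)))%C)).
  { intros x Hx. apply cder_line, Hdf, Hx. }
  destruct (MVT_gen (fun t : R => Re (k * f (a + RtoC t * (b - a)))%C) 0 1
    (fun x => Re (k * (df x * (b - a)))%C)) as [c [Hc E]].
  - rewrite Rmin_left, Rmax_right by lra. intros x Hx. apply D. lra.
  - rewrite Rmin_left, Rmax_right by lra. intros x Hx.
    apply continuity_pt_filterlim. apply (ex_derive_continuous (K := R_AbsRing) (V := R_NormedModule)). eexists. apply D, Hx.
  - rewrite Rmin_left, Rmax_right in Hc by lra.
    exists (df c). split; [apply Hdf, Hc|].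
    replace (a + RtoC 1 * (b - a))%C with b in E by ring.
    replace (a + RtoC 0 * (b - a))%C with a in E by ring.
    rewrite Rminus_0_r, Rmult_1_r in E. rewrite <- E.
    unfold Re, Cmult, Cminus, Cplus, Copp. simpl. ring.
Qed.

Lemma Re_conj_mult (c : C) : Re (Cconj c * c)%C = Cmod c * Cmod c.
Proof.
  transitivity (Cmod c ^ 2); [|ring]. rewrite Cmod2_alt.
  destruct c as [x y]. unfold Cconj, Cmult, Re, Im. simpl. ring.
Qed.

(** With [k] the conjugate of the increment, the functional returns its squared modulus, and one
    factor cancels. *)
Lemma cder_mean_value (f : C -> C) (a b : C) (D : R) :
  (forall x : R, 0 <= x <= 1 -> exists l, cder f (a + RtoC x * (b - a))%C l /\ Cmod l <= D) ->
  Cmod (f b - f a)%C <= D * Cmod (b - a)%C.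
Proof.
  intros H.
  destruct (cder_MVT_Re f a b (Cconj (f b - f a)%C) (fun l => Cmod l <= D) H) as [l [Hl E]].
  rewrite Re_conj_mult in E. remember (Cmod (f b - f a)%C) as n eqn:En.
  pose proof (re_le_Cmod (Cconj (f b - f a) * (l * (b - a)))%C) as B.
  rewrite <- E, !Cmod_mult, Cmod_conj, <- En in B.
  assert (0 <= n) by (rewrite En; apply Cmod_ge_0). pose proof (Cmod_ge_0 (b - a)%C).
  rewrite Rabs_right in B by nra.
  destruct (Req_dec n 0) as [E0|Hn]; [rewrite E0; pose proof (Cmod_ge_0 l); nra|].
  apply Rle_trans with (Cmod l * Cmod (b - a)%C); [|nra].
  apply Rmult_le_reg_l with n; [lra|]. lra.
Qed.

(** * Goursat's theorem *)

Definition CRInt (f : R -> C) (a b : R) : C := @RInt C_R_CompleteNormedModule f a b.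

Definition rcont (f : R -> C) (x : R) : Prop :=
  forall eps : R, 0 < eps -> exists delta : R, 0 < delta /\
    forall y : R, Rabs (y - x) < delta -> Cmod (f y - f x)%C < eps.

Lemma rcont_continuous (f : R -> C) (x : R) :
  rcont f x -> @continuous R_UniformSpace C_R_CompleteNormedModule f x.
Proof.
  intros H P [e He]. destruct (H e (cond_pos e)) as [d [Hd H']].
  exists (mkposreal d Hd). intros y Hy. apply He.
  apply C_NormedModule_mixin_compat1. exact (H' y Hy).
Qed.

Lemma ex_CRInt (f : R -> C) (a b : R) :
  (forall x, Rmin a b <= x <= Rmax a b -> rcont f x) ->
  @ex_RInt C_R_NormedModule f a b.
Proof.
  intros H. apply (@ex_RInt_continuous C_R_CompleteNormedModule).
  intros z Hz. apply rcont_continuous, H, Hz.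
Qed.

Lemma CRInt_chasles (f : R -> C) (a b c : R) :
  (forall x, Rmin a b <= x <= Rmax a b -> rcont f x) ->
  (forall x, Rmin b c <= x <= Rmax b c -> rcont f x) ->
  CRInt f a c = (CRInt f a b + CRInt f b c)%C.
Proof.
  intros H1 H2. symmetry.
  apply (@RInt_Chasles C_R_CompleteNormedModule); apply ex_CRInt; assumption.
Qed.

Lemma CRInt_swap (f : R -> C) (a b : R) :
  (forall x, Rmin a b <= x <= Rmax a b -> rcont f x) ->
  CRInt f b a = (- CRInt f a b)%C.
Proof.
  intros H. symmetry. apply (@opp_RInt_swap C_R_CompleteNormedModule), ex_CRInt, H.
Qed.

Lemma C_R_norm (z : C) : @norm R_AbsRing C_R_NormedModule z = Cmod z.
Proof.
  destruct z as [x y]. unfold Cmod. simpl. unfold norm. simpl. unfold prod_norm.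
  unfold norm. simpl. unfold abs. simpl.
  rewrite !Rmult_1_r, <- !Rabs_mult, !Rabs_right; auto; apply Rle_ge, Rle_0_sqr.
Qed.

Lemma CRInt_bound (f : R -> C) (a b D : R) :
  (forall x, Rmin a b <= x <= Rmax a b -> rcont f x) ->
  (forall x, Rmin a b <= x <= Rmax a b -> Cmod (f x) <= D) ->
  Cmod (CRInt f a b) <= D * Rabs (b - a).
Proof.
  assert (A : forall a b, a <= b -> (forall x, Rmin a b <= x <= Rmax a b -> rcont f x) ->
    (forall x, Rmin a b <= x <= Rmax a b -> Cmod (f x) <= D) ->
    Cmod (CRInt f a b) <= D * Rabs (b - a)).
  { clear a b. intros a b Hab H1 H2.
    rewrite Rabs_right by lra. rewrite Rmult_comm, <- C_R_norm.
    apply (@norm_RInt_le_const C_R_NormedModule f); [exact Hab | |].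
    - intros x Hx. rewrite C_R_norm. apply H2. rewrite Rmin_left, Rmax_right; lra.
    - apply (@RInt_correct C_R_CompleteNormedModule), ex_CRInt, H1. }
  intros H1 H2. destruct (Rle_dec a b) as [Hab|Hab]; [apply A; auto|].
  rewrite CRInt_swap.
  - rewrite Cmod_opp, Rabs_minus_sym. apply A; [lra | |];
    rewrite Rmin_comm, Rmax_comm; auto.
  - rewrite Rmin_comm, Rmax_comm; auto.
Qed.

Lemma CRInt_minus (f g : R -> C) (a b : R) :
  (forall x, Rmin a b <= x <= Rmax a b -> rcont f x) ->
  (forall x, Rmin a b <= x <= Rmax a b -> rcont g x) ->
  CRInt (fun x => f x - g x)%C a b = (CRInt f a b - CRInt g a b)%C.
Proof.
  intros H1 H2. apply (@RInt_minus C_R_CompleteNormedModule); apply ex_CRInt; assumption.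
Qed.

Lemma CRInt_ext (f g : R -> C) (a b : R) :
  (forall x, Rmin a b < x < Rmax a b -> f x = g x) -> CRInt f a b = CRInt g a b.
Proof. apply (@RInt_ext C_R_CompleteNormedModule). Qed.

Lemma CRInt_const (a b : R) (c : C) : CRInt (fun _ => c) a b = (RtoC (b - a) * c)%C.
Proof.
  unfold CRInt. rewrite (@RInt_const C_R_CompleteNormedModule).
  destruct c as [x y]. unfold Cmult, RtoC. simpl.
  unfold scal; simpl. unfold prod_scal; simpl. unfold scal; simpl. unfold mult; simpl.
  f_equal; ring.
Qed.

Definition line_int (f : C -> C) (a d : C) (x y : R) : C :=
  CRInt (fun t => f (a + RtoC t * d) * d)%C x y.

Lemma rcont_line (f : C -> C) (a d : C) (x : R) :
  ccont f (a + RtoC x * d)%C -> rcont (fun t => f (a + RtoC t * d) * d)%C x.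
Proof.
  intros H eps He. pose proof (Cmod_ge_0 d) as Hd.
  destruct (H (eps / (Cmod d + 1))) as [r [Hr H']]; [apply Rdiv_lt_0_compat; lra|].
  exists (r / (Cmod d + 1)). split; [apply Rdiv_lt_0_compat; lra|]. intros y Hy.
  specialize (H' (RtoC (y - x) * d)%C). rewrite Cmod_mult, Cmod_R in H'.
  apply (Rmult_lt_compat_r (Cmod d + 1)) in Hy; [|lra].
  unfold Rdiv in Hy. rewrite Rmult_assoc, Rinv_l in Hy by lra.
  pose proof (Rabs_pos (y - x)). specialize (H' ltac:(nra)).
  replace (a + RtoC x * d + RtoC (y - x) * d)%C with (a + RtoC y * d)%C in H'
    by (rewrite RtoC_minus; ring).
  replace (f (a + y * d) * d - f (a + x * d) * d)%C with ((f (a + y * d) - f (a + x * d)) * d)%C by ring.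
  rewrite Cmod_mult.
  apply (Rmult_lt_compat_r (Cmod d + 1)) in H'; [|lra].
  unfold Rdiv in H'. rewrite Rmult_assoc, Rinv_l in H' by lra.
  pose proof (Cmod_ge_0 (f (a + y * d) - f (a + x * d))%C). nra.
Qed.

Lemma C_R_is_derive_line (P : C -> C) (a d l : C) (x : R) :
  cder P (a + RtoC x * d)%C l ->
  @is_derive R_AbsRing C_R_NormedModule (fun t => P (a + RtoC t * d)%C) x (l * d)%C.
Proof.
  intros H. split; [apply is_linear_scal_l|].
  intros y Hy. assert (Ey : y = x) by (symmetry; apply (is_filter_lim_locally_unique (K:=R_AbsRing) (V:=R_NormedModule)); exact Hy).
  subst y. clear Hy. intros eps. pose proof (Cmod_ge_0 d) as Hd.
  destruct (H (eps / (Cmod d + 1))) as [r [Hr H']].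
  { apply Rdiv_lt_0_compat; [apply cond_pos | lra]. }
  assert (Hp : 0 < r / (Cmod d + 1)) by (apply Rdiv_lt_0_compat; lra).
  exists (mkposreal _ Hp).
  assert (A : forall y : R, Rabs (y - x) < r / (Cmod d + 1) ->
    Cmod (P (a + RtoC y * d) - P (a + RtoC x * d) - RtoC (y - x) * (l * d))%C <= eps * Rabs (y - x)).
  { intros y Hy.
    apply (Rmult_lt_compat_r (Cmod d + 1)) in Hy; [|lra].
    unfold Rdiv in Hy. rewrite Rmult_assoc, Rinv_l in Hy by lra.
    pose proof (Rabs_pos (y - x)).
    specialize (H' (RtoC (y - x) * d)%C). rewrite Cmod_mult, Cmod_R in H'.
    specialize (H' ltac:(nra)).
    replace (a + RtoC x * d + RtoC (y - x) * d)%C with (a + RtoC y * d)%C in H'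
      by (rewrite RtoC_minus; ring).
    replace (l * (RtoC (y - x) * d))%C with (RtoC (y - x) * (l * d))%C in H' by ring.
    eapply Rle_trans; [exact H'|].
    apply Rle_trans with (eps / (Cmod d + 1) * (Rabs (y - x) * (Cmod d + 1))).
    - assert (0 <= eps / (Cmod d + 1)) by (left; apply Rdiv_lt_0_compat; [apply cond_pos | lra]).
      apply Rmult_le_compat_l; nra.
    - right. field. lra. }
  intros y Hy. specialize (A y Hy). rewrite C_R_norm.
  replace (RtoC (y - x) * (l * d))%C with (@scal R_AbsRing C_R_NormedModule (y - x)%R (l * d)%C) in A.
  2: { unfold scal; simpl. unfold prod_scal; simpl. unfold scal; simpl. unfold mult; simpl.
       unfold Cmult, RtoC; simpl. f_equal; ring. }
  exact A.
Qed.

Lemma line_int_FTC (P f : C -> C) (a d : C) (x y : R) :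
  (forall t, Rmin x y <= t <= Rmax x y -> cder P (a + RtoC t * d)%C (f (a + RtoC t * d)%C)) ->
  (forall t, Rmin x y <= t <= Rmax x y -> ccont f (a + RtoC t * d)%C) ->
  line_int f a d x y = (P (a + RtoC y * d) - P (a + RtoC x * d))%C.
Proof.
  intros HP Hf.
  apply (@is_RInt_unique C_R_CompleteNormedModule).
  apply (@is_RInt_derive C_R_CompleteNormedModule (fun t => P (a + RtoC t * d)%C)).
  - intros t Ht. apply C_R_is_derive_line, HP, Ht.
  - intros t Ht. apply rcont_continuous, rcont_line, Hf, Ht.
Qed.

(** * Contour integrals over rectangles *)

Definition hor_int (f : C -> C) (y x1 x2 : R) : C := line_int f (Ci * RtoC y)%C 1 x1 x2.
Definition ver_int (f : C -> C) (x y1 y2 : R) : C := line_int f (RtoC x) Ci y1 y2.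

Lemma hor_point (y t : R) : (Ci * RtoC y + RtoC t * 1)%C = (t, y).
Proof. unfold Ci, RtoC, Cplus, Cmult. simpl. f_equal; ring. Qed.
Lemma ver_point (x t : R) : (RtoC x + RtoC t * Ci)%C = (x, t).
Proof. unfold Ci, RtoC, Cplus, Cmult. simpl. f_equal; ring. Qed.

Definition contour (f : C -> C) (x1 x2 y1 y2 : R) : C :=
  (hor_int f y1 x1 x2 + ver_int f x2 y1 y2 - hor_int f y2 x1 x2 - ver_int f x1 y1 y2)%C.

Definition on_rect (Q : C -> Prop) (x1 x2 y1 y2 : R) : Prop :=
  forall x y, x1 <= x <= x2 -> y1 <= y <= y2 -> Q (x, y).

Lemma hor_rcont f y t : ccont f (t, y) -> rcont (fun t => f (Ci * RtoC y + RtoC t * 1) * 1)%C t.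
Proof. intros H. apply rcont_line. now rewrite hor_point. Qed.
Lemma ver_rcont f x t : ccont f (x, t) -> rcont (fun t => f (RtoC x + RtoC t * Ci) * Ci)%C t.
Proof. intros H. apply rcont_line. now rewrite ver_point. Qed.

Lemma hor_int_chasles f y a b c :
  (forall t, Rmin a b <= t <= Rmax a b -> ccont f (t, y)) ->
  (forall t, Rmin b c <= t <= Rmax b c -> ccont f (t, y)) ->
  hor_int f y a c = (hor_int f y a b + hor_int f y b c)%C.
Proof.
  intros H1 H2. apply CRInt_chasles; intros t Ht; apply hor_rcont; auto.
Qed.
Lemma ver_int_chasles f x a b c :
  (forall t, Rmin a b <= t <= Rmax a b -> ccont f (x, t)) ->
  (forall t, Rmin b c <= t <= Rmax b c -> ccont f (x, t)) ->
  ver_int f x a c = (ver_int f x a b + ver_int f x b c)%C.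
Proof.
  intros H1 H2. apply CRInt_chasles; intros t Ht; apply ver_rcont; auto.
Qed.
Lemma hor_int_bound f y a b D :
  (forall t, Rmin a b <= t <= Rmax a b -> ccont f (t, y)) ->
  (forall t, Rmin a b <= t <= Rmax a b -> Cmod (f (t, y)) <= D) ->
  Cmod (hor_int f y a b) <= D * Rabs (b - a).
Proof.
  intros H1 H2. apply CRInt_bound; intros t Ht; [apply hor_rcont; auto|].
  rewrite Cmod_mult, Cmod_1, hor_point, Rmult_1_r. auto.
Qed.
Lemma ver_int_bound f x a b D :
  (forall t, Rmin a b <= t <= Rmax a b -> ccont f (x, t)) ->
  (forall t, Rmin a b <= t <= Rmax a b -> Cmod (f (x, t)) <= D) ->
  Cmod (ver_int f x a b) <= D * Rabs (b - a).
Proof.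
  intros H1 H2. apply CRInt_bound; intros t Ht; [apply ver_rcont; auto|].
  rewrite Cmod_mult, Cmod_Ci, ver_point, Rmult_1_r. auto.
Qed.

Lemma line_int_minus f g a d x y :
  (forall t, Rmin x y <= t <= Rmax x y -> ccont f (a + RtoC t * d)%C) ->
  (forall t, Rmin x y <= t <= Rmax x y -> ccont g (a + RtoC t * d)%C) ->
  line_int (fun z => f z - g z)%C a d x y = (line_int f a d x y - line_int g a d x y)%C.
Proof.
  intros H1 H2. unfold line_int.
  rewrite <- (CRInt_minus (fun t => f (a + RtoC t * d) * d)%C (fun t => g (a + RtoC t * d) * d)%C)
    by (intros t Ht; apply rcont_line; auto).
  apply CRInt_ext. intros t _. ring.
Qed.

Lemma contour_minus f g x1 x2 y1 y2 :
  x1 <= x2 -> y1 <= y2 ->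
  on_rect (ccont f) x1 x2 y1 y2 -> on_rect (ccont g) x1 x2 y1 y2 ->
  contour (fun z => f z - g z)%C x1 x2 y1 y2 = (contour f x1 x2 y1 y2 - contour g x1 x2 y1 y2)%C.
Proof.
  intros Hx Hy Hf Hg. unfold contour, hor_int, ver_int.
  rewrite !line_int_minus; [ring|..]; rewrite Rmin_left, Rmax_right by lra; intros t Ht;
    rewrite ?hor_point, ?ver_point; first [apply Hf | apply Hg]; lra.
Qed.

Lemma contour_exact (P f : C -> C) x1 x2 y1 y2 :
  x1 <= x2 -> y1 <= y2 ->
  on_rect (fun z => cder P z (f z)) x1 x2 y1 y2 -> on_rect (ccont f) x1 x2 y1 y2 ->
  contour f x1 x2 y1 y2 = RtoC 0.
Proof.
  intros Hx Hy HP Hf. unfold contour, hor_int, ver_int.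
  rewrite !(line_int_FTC P f); [rewrite !hor_point, !ver_point; ring|..];
    rewrite Rmin_left, Rmax_right by lra; intros t Ht;
    rewrite ?hor_point, ?ver_point; first [apply Hf | apply HP]; lra.
Qed.

Lemma contour_split_x f x1 x2 x3 y1 y2 :
  x1 <= x2 -> x2 <= x3 -> y1 <= y2 -> on_rect (ccont f) x1 x3 y1 y2 ->
  contour f x1 x3 y1 y2 = (contour f x1 x2 y1 y2 + contour f x2 x3 y1 y2)%C.
Proof.
  intros H1 H2 Hy Hf. unfold contour.
  rewrite (hor_int_chasles f y1 x1 x2 x3), (hor_int_chasles f y2 x1 x2 x3); [ring|..];
    rewrite Rmin_left, Rmax_right by lra; intros t Ht; apply Hf; lra.
Qed.

Lemma contour_split_y f x1 x2 y1 y2 y3 :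
  y1 <= y2 -> y2 <= y3 -> x1 <= x2 -> on_rect (ccont f) x1 x2 y1 y3 ->
  contour f x1 x2 y1 y3 = (contour f x1 x2 y1 y2 + contour f x1 x2 y2 y3)%C.
Proof.
  intros H1 H2 Hy Hf. unfold contour.
  rewrite (ver_int_chasles f x1 y1 y2 y3), (ver_int_chasles f x2 y1 y2 y3); [ring|..];
    rewrite Rmin_left, Rmax_right by lra; intros t Ht; apply Hf; lra.
Qed.

Lemma contour_bound f x1 x2 y1 y2 D :
  x1 <= x2 -> y1 <= y2 -> on_rect (ccont f) x1 x2 y1 y2 ->
  on_rect (fun z => Cmod (f z) <= D) x1 x2 y1 y2 ->
  Cmod (contour f x1 x2 y1 y2) <= 2 * D * ((x2 - x1) + (y2 - y1)).
Proof.
  intros Hx Hy Hf HD. unfold contour.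
  assert (B1 : Cmod (hor_int f y1 x1 x2) <= D * Rabs (x2 - x1)).
  { apply hor_int_bound; rewrite Rmin_left, Rmax_right by lra; intros t Ht; [apply Hf | apply HD]; lra. }
  assert (B2 : Cmod (hor_int f y2 x1 x2) <= D * Rabs (x2 - x1)).
  { apply hor_int_bound; rewrite Rmin_left, Rmax_right by lra; intros t Ht; [apply Hf | apply HD]; lra. }
  assert (B3 : Cmod (ver_int f x1 y1 y2) <= D * Rabs (y2 - y1)).
  { apply ver_int_bound; rewrite Rmin_left, Rmax_right by lra; intros t Ht; [apply Hf | apply HD]; lra. }
  assert (B4 : Cmod (ver_int f x2 y1 y2) <= D * Rabs (y2 - y1)).
  { apply ver_int_bound; rewrite Rmin_left, Rmax_right by lra; intros t Ht; [apply Hf | apply HD]; lra. }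
  rewrite Rabs_right in B1, B2, B3, B4 by lra.
  unfold Cminus.
  eapply Rle_trans; [apply Cmod_triangle|]. rewrite Cmod_opp.
  eapply Rle_trans; [apply Rplus_le_compat_r, Cmod_triangle|]. rewrite Cmod_opp.
  eapply Rle_trans; [do 2 apply Rplus_le_compat_r; apply Cmod_triangle|].
  lra.
Qed.

Lemma Cplus_sub_cancel (a b : C) : (a + (b - a))%C = b.
Proof. ring. Qed.

Lemma nested_intervals (a b : nat -> R) :
  (forall n, a n <= a (S n)) -> (forall n, b (S n) <= b n) -> (forall n, a n <= b n) ->
  exists x, forall n, a n <= x <= b n.
Proof.
  intros Ha Hb Hab.
  assert (Ha' : forall n k, a n <= a (n + k)%nat).
  { intros n k. induction k; [rewrite Nat.add_0_r; lra|].
    rewrite Nat.add_succ_r. specialize (Ha (n + k)%nat). lra. }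
  assert (Hb' : forall n k, b (n + k)%nat <= b n).
  { intros n k. induction k; [rewrite Nat.add_0_r; lra|].
    rewrite Nat.add_succ_r. specialize (Hb (n + k)%nat). lra. }
  assert (Hc : forall m n, a m <= b n).
  { intros m n. specialize (Ha' m n). specialize (Hb' n m). specialize (Hab (m + n)%nat).
    rewrite Nat.add_comm in Hb'. lra. }
  destruct (completeness (fun x => exists n, x = a n)) as [x [Hx1 Hx2]].
  - exists (b 0%nat). intros y [n ->]. apply Hc.
  - exists (a 0%nat), 0%nat. reflexivity.
  - exists x. intros n. split.
    + apply Hx1. exists n; reflexivity.
    + apply Hx2. intros y [m ->]. apply Hc.
Qed.

(** Bisection, with [e] times the square of the half perimeter as threshold: halving both sides
    divides it by four, so one quarter of a bad rectangle is bad. Near the limit point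
    differentiability puts the contour integral of a small rectangle below the threshold. *)
Lemma goursat (f : C -> C) (x1 x2 y1 y2 : R) :
  x1 <= x2 -> y1 <= y2 ->
  on_rect (fun z => exists l, cder f z l) x1 x2 y1 y2 ->
  contour f x1 x2 y1 y2 = RtoC 0.
Proof.
  intros Hx Hy Hf.
  apply Cmod_eq_0. apply Rle_antisym; [|apply Cmod_ge_0].
  apply le_epsilon. intros e' He'. rewrite Rplus_0_l.
  (* The added 1 covers a degenerate rectangle of zero perimeter. *)
  set (e := e' / ((x2 - x1 + (y2 - y1)) ^ 2 + 1)).
  assert (He : 0 < e) by (apply Rdiv_lt_0_compat; [lra | nra]).
  assert (Ee : e * (x2 - x1 + (y2 - y1)) ^ 2 <= e').
  { apply Rle_trans with (e * ((x2 - x1 + (y2 - y1)) ^ 2 + 1)); [nra|].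
    right. unfold e. field. nra. }
  eapply Rle_trans; [|exact Ee]. clearbody e. clear e' He' Ee.
  apply Rnot_lt_le. intros Hbad.
  set (bad := fun q : (R * R) * (R * R) => let '((a, b), (c, d)) := q in
    x1 <= a /\ a <= b /\ b <= x2 /\ y1 <= c /\ c <= d /\ d <= y2 /\
    e * (b - a + (d - c)) ^ 2 < Cmod (contour f a b c d)).
  set (sub := fun q q' : (R * R) * (R * R) => let '((a, b), (c, d)) := q in
    let '((a', b'), (c', d')) := q' in
    a <= a' /\ b' <= b /\ c <= c' /\ d' <= d /\
    b' - a' = (b - a) / 2 /\ d' - c' = (d - c) / 2).
  assert (Hcont : on_rect (ccont f) x1 x2 y1 y2).
  { intros x y H1 H2. destruct (Hf x y H1 H2) as [l Hl]. eapply cder_ccont; eauto. }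
  destruct (choice_fun (fun q q' => bad q -> bad q' /\ sub q q')) as [next Hnext].
  { intros [[a b] [c d]].
    destruct (classic (bad ((a, b), (c, d)))) as [Hq|Hq]; [|exists ((a, b), (c, d)); tauto].
    destruct Hq as (A1 & A2 & A3 & A4 & A5 & A6 & A7).
    set (m := (a + b) / 2). set (n := (c + d) / 2).
    assert (Hm : a <= m <= b) by (unfold m; lra).
    assert (Hn : c <= n <= d) by (unfold n; lra).
    assert (S : contour f a b c d =
      (contour f a m c n + contour f a m n d + (contour f m b c n + contour f m b n d))%C).
    { rewrite (contour_split_x f a m b c d), (contour_split_y f a m c n d),
        (contour_split_y f m b c n d); try lra; try reflexivity;
      intros x y H1 H2; apply Hcont; lra. }
    set (s := e * ((b - a + (d - c)) / 2) ^ 2).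
    assert (Hs : e * (b - a + (d - c)) ^ 2 = 4 * s) by (unfold s; field).
    destruct (classic (s < Cmod (contour f a m c n))) as [C1|C1];
      [exists ((a, m), (c, n))|
    destruct (classic (s < Cmod (contour f a m n d))) as [C2|C2];
      [exists ((a, m), (n, d))|
    destruct (classic (s < Cmod (contour f m b c n))) as [C3|C3];
      [exists ((m, b), (c, n))|
    destruct (classic (s < Cmod (contour f m b n d))) as [C4|C4];
      [exists ((m, b), (n, d))|]]]].
    5: { exfalso. rewrite S in A7.
         pose proof (Cmod_triangle (contour f a m c n + contour f a m n d) (contour f m b c n + contour f m b n d)).
         pose proof (Cmod_triangle (contour f a m c n) (contour f a m n d)).
         pose proof (Cmod_triangle (contour f m b c n) (contour f m b n d)). lra. }
    all: intros _; unfold bad, sub; repeat split; try lra; try (unfold m, n; lra).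
    all: replace ((_ - _) + (_ - _)) with ((b - a + (d - c)) / 2) by (unfold m, n; field); assumption. }
  set (q := fun n => Nat.iter n next ((x1, x2), (y1, y2))).
  assert (Hq : forall n, bad (q n)).
  { induction n as [|n IH]; [unfold q, bad; simpl; repeat split; lra|].
    apply (Hnext (q n) IH). }
  assert (Hsub : forall n, sub (q n) (q (S n))) by (intros n; apply (Hnext (q n) (Hq n))).
  set (a := fun n => fst (fst (q n))). set (b := fun n => snd (fst (q n))).
  set (c := fun n => fst (snd (q n))). set (d := fun n => snd (snd (q n))).
  assert (Eq : forall n, q n = ((a n, b n), (c n, d n))).
  { intros n. unfold a, b, c, d. destruct (q n) as [[? ?] [? ?]]. reflexivity. }
  assert (Hbn : forall n, bad ((a n, b n), (c n, d n))) by (intros n; rewrite <- Eq; apply Hq).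
  assert (Hsn : forall n, sub ((a n, b n), (c n, d n)) ((a (S n), b (S n)), (c (S n), d (S n))))
    by (intros n; rewrite <- !Eq; apply Hsub).
  unfold bad in Hbn. unfold sub in Hsn. clearbody a b c d. clear q Hq Hsub Eq next Hnext bad sub.
  destruct (nested_intervals a b) as [x0 Hx0]; try (intros n; specialize (Hsn n); specialize (Hbn n); lra).
  destruct (nested_intervals c d) as [y0 Hy0]; try (intros n; specialize (Hsn n); specialize (Hbn n); lra).
  assert (Hw : forall n, (b n - a n + (d n - c n)) = (b 0%nat - a 0%nat + (d 0%nat - c 0%nat)) * (/ 2) ^ n).
  { induction n as [|n IH]; [simpl; ring|]. specialize (Hsn n). simpl. nra. }
  assert (Hz : exists l, cder f (x0, y0) l).
  { specialize (Hx0 0%nat). specialize (Hy0 0%nat). specialize (Hbn 0%nat). apply Hf; lra. }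
  (* With [w] the half perimeter, the remainder is at most [e / 3 * w] on a path of length [2 * w];
     this gives [2 / 3 * e * w ^ 2], which is below the threshold. *)
  destruct Hz as [l Hl]. destruct (Hl (e / 3)) as [r [Hr Hl']]; [lra|].
  set (w0 := b 0%nat - a 0%nat + (d 0%nat - c 0%nat)) in *.
  assert (Hw0 : 0 <= w0) by (unfold w0; specialize (Hbn 0%nat); lra).
  destruct (pow_lt_1_zero (/ 2)) with (y := r / (w0 + 1)) as [N HN].
  { rewrite Rabs_right; lra. } { apply Rdiv_lt_0_compat; lra. }
  specialize (HN N (Nat.le_refl N)). specialize (Hw N). specialize (Hbn N). specialize (Hx0 N). specialize (Hy0 N).
  rewrite Rabs_right in HN by (apply Rle_ge, pow_le; lra).
  assert (Hsmall : b N - a N + (d N - c N) < r).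
  { rewrite Hw. apply (Rmult_lt_compat_r (w0 + 1)) in HN; [|lra].
    unfold Rdiv in HN. rewrite Rmult_assoc, Rinv_l in HN by lra.
    assert (0 < (/ 2) ^ N) by (apply pow_lt; lra). nra. }
  clear Hw HN Hsn. destruct Hbn as (A1 & A2 & A3 & A4 & A5 & A6 & A7).
  set (w := b N - a N + (d N - c N)) in *.
  (* The affine part of [f] at the limit point has the primitive [P], so it contributes nothing to
     the contour integral. *)
  set (g := fun z : C => (l * z + (f (x0, y0) - l * (x0, y0)))%C).
  assert (Hg : forall z, cder g z l) by (intros z; apply cder_affine).
  set (P := fun z : C => (l * (/ 2 * (z * z)) + (f (x0, y0) - l * (x0, y0)) * z)%C).
  assert (HP : forall z, cder P z (g z)).
  { intros z eps Heps. exists (eps / (Cmod l + 1)). pose proof (Cmod_ge_0 l).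
    split; [apply Rdiv_lt_0_compat; lra|]. intros h Hh. unfold P, g.
    replace (_ - _ - _)%C with (l * / 2 * (h * h))%C.
    2: field.
    rewrite !Cmod_mult.
    assert (E2 : Cmod (/ 2)%C = / 2).
    { rewrite Cmod_inv. - rewrite Cmod_R, Rabs_right; lra.
      - intros E. apply (f_equal fst) in E. simpl in E. lra. }
    rewrite E2. pose proof (Cmod_ge_0 h).
    apply (Rmult_lt_compat_r (Cmod l + 1)) in Hh; [|lra].
    unfold Rdiv in Hh. rewrite Rmult_assoc, Rinv_l in Hh by lra. nra. }
  assert (Gc : forall z, ccont g z) by (intros z; eapply cder_ccont; apply Hg).
  assert (E0 : contour g (a N) (b N) (c N) (d N) = RtoC 0).
  { apply (contour_exact P); try lra; intros x y _ _; [apply HP | apply Gc]. }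
  assert (Hc' : on_rect (ccont f) (a N) (b N) (c N) (d N)) by (intros x y H1 H2; apply Hcont; lra).
  assert (B : Cmod (contour (fun z => f z - g z)%C (a N) (b N) (c N) (d N)) <= 2 * (e / 3 * w) * w).
  { apply contour_bound; try lra.
    - intros x y H1 H2. 
      destruct (Hf x y) as [m Hm]; try lra.
      eapply cder_ccont, cder_minus; [exact Hm | apply Hg].
    - intros x y H1 H2.
      assert (Hd : Cmod ((x, y) - (x0, y0))%C <= w).
      { eapply Rle_trans; [apply Cmod_le_Re_Im|]. simpl.
        unfold w. assert (Rabs (x + - x0) <= b N - a N) by (apply Rabs_le; lra).
        assert (Rabs (y + - y0) <= d N - c N) by (apply Rabs_le; lra). lra. }
      specialize (Hl' ((x, y) - (x0, y0))%C ltac:(lra)).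
      rewrite Cplus_sub_cancel in Hl'.
      unfold g. replace (f (x, y) - (l * (x, y) + (f (x0, y0) - l * (x0, y0))))%C
        with (f (x, y) - f (x0, y0) - l * ((x, y) - (x0, y0)))%C by ring.
      eapply Rle_trans; [exact Hl'|]. apply Rmult_le_compat_l; lra. }
  rewrite contour_minus, E0 in B; try lra; auto; [|intros x y _ _; apply Gc].
  replace (contour f (a N) (b N) (c N) (d N) - 0)%C with (contour f (a N) (b N) (c N) (d N)) in B by ring.
  assert (0 <= w) by (unfold w; lra). nra.
Qed.

(** * Cauchy's estimate and primitives *)

Lemma cder_opp_arg (f : C -> C) (z l : C) :
  cder f (- z)%C l -> cder (fun x => f (- x))%C z (- l)%C.
Proof.
  intros H eps He. destruct (H eps He) as [d [Hd H']]. exists d. split; [exact Hd|].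
  intros h Hh. specialize (H' (- h)%C). rewrite Cmod_opp in H'. specialize (H' Hh).
  replace (- (z + h))%C with (- z + - h)%C by ring.
  replace (f (- z + - h) - f (- z) - - l * h)%C with (f (- z + - h) - f (- z) - l * - h)%C by ring.
  exact H'.
Qed.

Lemma Cexp_2PI (x y : R) : Cexp (x, y + 2 * PI) = Cexp (x, y).
Proof.
  unfold Cexp. simpl. rewrite cos_plus, sin_plus, cos_2PI, sin_2PI. f_equal; ring.
Qed.

Lemma Cexp_neg_mult (z : C) : (Cexp z * Cexp (- z))%C = RtoC 1.
Proof.
  rewrite <- Cexp_plus. replace (z + - z)%C with (RtoC 0) by ring.
  unfold Cexp, RtoC; simpl. rewrite exp_0, cos_0, sin_0. f_equal; ring.
Qed.

(* Goursat for f(u + e^z) e^(-z) on [s, ln r] x [0, 2 PI]: the horizontal sides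
   cancel by periodicity, and the left side tends to 2 PI i f'(u) as s -> -oo. *)
Lemma cauchy_estimate (f : C -> C) (u m : C) (r B : R) :
  0 < r -> (forall z, Cmod (z - u)%C <= r -> (exists l, cder f z l) /\ Cmod (f z) <= B) ->
  cder f u m -> Cmod m <= B / r.
Proof.
  intros Hr Hf Hm. apply le_epsilon. intros eps He.
  destruct (Hm eps He) as [d [Hd Hm']].
  (* The left side is placed where [Cmod (Cexp z) < d], so that [f (u + Cexp z)] is there within
     [eps * Cmod (Cexp z)] of its first-order expansion. *)
  set (s1 := ln r). set (s := Rmin s1 (ln (d / 2))).
  assert (Hs1 : exp s1 = r) by (apply exp_ln, Hr).
  assert (Hs : s <= s1) by apply Rmin_l.
  assert (Hsd : exp s < d).
  { apply Rle_lt_trans with (d / 2); [|lra]. rewrite <- (exp_ln (d / 2)) by lra.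
    destruct (Rle_lt_or_eq_dec _ _ (Rmin_r s1 (ln (d / 2)))) as [H|H].
    - left. apply exp_increasing, H.
    - right. unfold s. rewrite H. reflexivity. }
  pose proof PI_RGT_0 as Hpi.
  set (Y := fun z : C => (f (u + Cexp z) * Cexp (- z))%C).
  assert (HE : forall z, cder (fun z => Cexp (- z))%C z (- Cexp (- z))%C).
  { intros z. apply cder_opp_arg, cder_Cexp. }
  assert (HY : forall z, Re z <= s1 -> exists l, cder Y z l).
  { intros z Hz.
    assert (Hz' : Cmod (u + Cexp z - u)%C <= r).
    { replace (u + Cexp z - u)%C with (Cexp z) by ring. rewrite Cmod_Cexp, <- Hs1.
      destruct Hz as [Hz|Hz]; [left; apply exp_increasing, Hz | right; now rewrite Hz]. }
    destruct (Hf _ Hz') as [[l Hl] _].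
    destruct (cder_comp f (fun z => u + Cexp z)%C z l (0 + Cexp z)%C) as [k Hk]; [exact Hl| |].
    { apply cder_plus; [apply cder_const | apply cder_Cexp]. }
    apply (cder_mult_ex (fun z => f (u + Cexp z)%C) _ z k (- Cexp (- z))%C); [exact Hk | apply HE]. }
  assert (HYc : forall z, Re z <= s1 -> ccont Y z).
  { intros z Hz. destruct (HY z Hz) as [l Hl]. eapply cder_ccont, Hl. }
  assert (E : contour Y s s1 0 (2 * PI) = RtoC 0).
  { apply goursat; try lra. intros x y Hx Hy. apply HY. simpl. lra. }
  assert (Eper : hor_int Y (2 * PI) s s1 = hor_int Y 0 s s1).
  { apply CRInt_ext. intros t _. rewrite !hor_point. unfold Y.
    replace (2 * PI) with (0 + 2 * PI) by ring.
    rewrite Cexp_2PI. do 2 f_equal.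
    replace (- (t, 0))%C with ((- t, - (0 + 2 * PI) + 2 * PI) : C)
      by (unfold Copp; simpl; f_equal; ring).
    rewrite Cexp_2PI. reflexivity. }
  unfold contour in E. rewrite Eper in E.
  assert (EV : ver_int Y s1 0 (2 * PI) = ver_int Y s 0 (2 * PI)).
  { replace (ver_int Y s1 0 (2 * PI)) with
      (hor_int Y 0 s s1 + ver_int Y s1 0 (2 * PI) - hor_int Y 0 s s1 - ver_int Y s 0 (2 * PI) + ver_int Y s 0 (2 * PI))%C by ring.
    rewrite E. ring. }
  assert (B1 : Cmod (ver_int Y s1 0 (2 * PI)) <= B / r * (2 * PI)).
  { replace (2 * PI) with (Rabs (2 * PI - 0)) at 2 by (rewrite Rminus_0_r, Rabs_right; lra).
    apply ver_int_bound; intros t _; [apply HYc; simpl; lra|].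
    unfold Y. rewrite Cmod_mult, Cmod_Cexp. simpl. rewrite exp_Ropp, Hs1.
    apply Rmult_le_compat_r; [left; apply Rinv_0_lt_compat, Hr|].
    apply Hf. replace (u + Cexp (s1, t) - u)%C with (Cexp (s1, t)) by ring.
    rewrite Cmod_Cexp. simpl. lra. }
  (* [g] is [Y] with [f] replaced by its first-order expansion at [u]. Its primitive [G] consists of
     a periodic term and [m * z], so only [m] survives over a full period. *)
  set (g := fun z : C => (f u * Cexp (- z) + m)%C).
  set (G := fun z : C => (- f u * Cexp (- z) + (m * z + 0))%C).
  assert (HG : forall z, cder G z (g z)).
  { intros z. unfold g. replace (f u * Cexp (- z) + m)%C with (- f u * (- Cexp (- z)) + m)%C by ring.
    apply cder_plus; [apply cder_scal, HE | apply cder_affine]. }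
  assert (Hg : forall z, ccont g z).
  { intros z. apply (cder_ccont g z (f u * (- Cexp (- z)) + 0)%C).
    apply cder_plus; [apply cder_scal, HE | apply cder_const]. }
  assert (Eg : ver_int g s 0 (2 * PI) = (m * (Ci * RtoC (2 * PI)))%C).
  { unfold ver_int. rewrite (line_int_FTC G g) by (intros; [apply HG || apply Hg]).
    rewrite !ver_point. unfold G.
    replace (Cexp (- (s, 2 * PI))) with (Cexp (- (s, 0))).
    2: { replace (- (s, 0))%C with ((- s, - (2 * PI) + 2 * PI) : C)
           by (unfold Copp; simpl; f_equal; ring).
         rewrite Cexp_2PI. reflexivity. }
    assert (Ep : ((s, 2 * PI) : C) = ((s, 0) + Ci * RtoC (2 * PI))%C).
    { unfold Ci, RtoC, Cplus, Cmult; simpl; f_equal; ring. }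
    rewrite Ep. ring. }
  assert (B2 : Cmod (ver_int (fun z => Y z - g z)%C s 0 (2 * PI)) <= eps * (2 * PI)).
  { replace (2 * PI) with (Rabs (2 * PI - 0)) at 2 by (rewrite Rminus_0_r, Rabs_right; lra).
    apply ver_int_bound; intros t _.
    - destruct (HY (s, t)) as [l Hl]; [simpl; lra|].
      eapply cder_ccont, cder_minus; [exact Hl|].
      apply cder_plus; [apply cder_scal, HE | apply cder_const].
    - unfold Y, g.
      replace (f (u + Cexp (s, t)) * Cexp (- (s, t)) - (f u * Cexp (- (s, t)) + m))%C
        with ((f (u + Cexp (s, t)) - f u - m * Cexp (s, t)) * Cexp (- (s, t)))%C.
      2: { transitivity (f (u + Cexp (s, t)) * Cexp (- (s, t)) - f u * Cexp (- (s, t))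
             - m * (Cexp (s, t) * Cexp (- (s, t))))%C; [ring|].
           rewrite Cexp_neg_mult. ring. }
      rewrite Cmod_mult, (Cmod_Cexp (- (s, t))%C). specialize (Hm' (Cexp (s, t))).
      rewrite Cmod_Cexp in Hm'. change (Re (s, t)) with s in Hm'.
      change (Re (- (s, t))%C) with (- s). rewrite exp_Ropp. specialize (Hm' Hsd).
      pose proof (exp_pos s) as Hes.
      apply Rle_trans with (eps * exp s * / exp s); [|right; field; lra].
      apply Rmult_le_compat_r; [left; apply Rinv_0_lt_compat, Hes | exact Hm']. }
  assert (EM : ver_int (fun z => Y z - g z)%C s 0 (2 * PI) = (ver_int Y s 0 (2 * PI) - ver_int g s 0 (2 * PI))%C).
  { unfold ver_int. rewrite (line_int_minus Y g); [reflexivity | |]; intros t _; rewrite ver_point;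
      [apply HYc; exact Hs | apply Hg]. }
  rewrite EM, <- EV, Eg in B2.
  assert (B3 : Cmod (m * (Ci * RtoC (2 * PI)))%C = Cmod m * (2 * PI)).
  { rewrite !Cmod_mult, Cmod_Ci, Cmod_R, Rabs_right by lra. ring. }
  pose proof (Cmod_sub_triangle (m * (Ci * RtoC (2 * PI)))%C (ver_int Y s1 0 (2 * PI)) 0%C) as T.
  rewrite Cmod_sub_sym in B2.
  replace (m * (Ci * RtoC (2 * PI)) - 0)%C with (m * (Ci * RtoC (2 * PI)))%C in T by ring.
  replace (ver_int Y s1 0 (2 * PI) - 0)%C with (ver_int Y s1 0 (2 * PI)) in T by ring.
  rewrite B3 in T. nra.
Qed.

Lemma hor_int_swap f y a b :
  (forall t, Rmin a b <= t <= Rmax a b -> ccont f (t, y)) -> hor_int f y b a = (- hor_int f y a b)%C.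
Proof. intros H. apply CRInt_swap. intros t Ht. apply hor_rcont; auto. Qed.
Lemma ver_int_swap f x a b :
  (forall t, Rmin a b <= t <= Rmax a b -> ccont f (x, t)) -> ver_int f x b a = (- ver_int f x a b)%C.
Proof. intros H. apply CRInt_swap. intros t Ht. apply ver_rcont; auto. Qed.

(** Increments of [primitive] may have either sign, so the rectangles met there have unordered
    corners. *)
Lemma goursat_unordered (f : C -> C) (x1 x2 y1 y2 : R) :
  on_rect (fun z => exists l, cder f z l) (Rmin x1 x2) (Rmax x1 x2) (Rmin y1 y2) (Rmax y1 y2) ->
  contour f x1 x2 y1 y2 = RtoC 0.
Proof.
  assert (A : forall x1 x2 y1 y2, x1 <= x2 ->
    on_rect (fun z => exists l, cder f z l) (Rmin x1 x2) (Rmax x1 x2) (Rmin y1 y2) (Rmax y1 y2) ->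
    contour f x1 x2 y1 y2 = RtoC 0).
  { clear. intros x1 x2 y1 y2 Hx H.
    assert (Hc : on_rect (ccont f) (Rmin x1 x2) (Rmax x1 x2) (Rmin y1 y2) (Rmax y1 y2)).
    { intros x y H1 H2. destruct (H x y H1 H2) as [l Hl]. eapply cder_ccont, Hl. }
    rewrite (Rmin_left x1 x2), (Rmax_right x1 x2) in * by lra.
    destruct (Rle_dec y1 y2) as [Hy|Hy].
    - rewrite Rmin_left, Rmax_right in H by lra. apply goursat; auto.
    - rewrite Rmin_right, Rmax_left in H by lra.
      rewrite <- (goursat f x1 x2 y2 y1) by (auto; lra). 
      assert (Hc1 : forall t x, x1 <= x <= x2 -> Rmin y2 y1 <= t <= Rmax y2 y1 -> ccont f (x, t)).
      { intros t x Hx' Ht. apply Hc; [lra|]. rewrite Rmin_comm, Rmax_comm. exact Ht. }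
      assert (E0 : contour f x1 x2 y1 y2 = (- contour f x1 x2 y2 y1)%C).
      { unfold contour. rewrite (ver_int_swap f x1 y2 y1), (ver_int_swap f x2 y2 y1);
          [ring | |]; intros t Ht; apply Hc1; lra. }
      rewrite E0. rewrite (goursat f x1 x2 y2 y1) by (auto; lra). ring. }
  intros H. destruct (Rle_dec x1 x2) as [Hx|Hx]; [apply A; auto|].
  assert (Hc : on_rect (ccont f) (Rmin x1 x2) (Rmax x1 x2) (Rmin y1 y2) (Rmax y1 y2)).
  { intros x y H1 H2. destruct (H x y H1 H2) as [l Hl]. eapply cder_ccont, Hl. }
  assert (E0 : contour f x1 x2 y1 y2 = (- contour f x2 x1 y1 y2)%C).
  { assert (Y1 : Rmin y1 y2 <= y1 <= Rmax y1 y2) by (split; [apply Rmin_l | apply Rmax_l]).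
    assert (Y2 : Rmin y1 y2 <= y2 <= Rmax y1 y2) by (split; [apply Rmin_r | apply Rmax_r]).
    unfold contour. rewrite (hor_int_swap f y1 x2 x1), (hor_int_swap f y2 x2 x1); [ring | |];
      intros t Ht; rewrite Rmin_comm, Rmax_comm in Ht; apply Hc; lra. }
  rewrite E0, A; [ring | lra |].
  rewrite (Rmin_comm x2 x1), (Rmax_comm x2 x1). exact H.
Qed.

(** A square contains every axis-parallel rectangle with two opposite corners in it, as Goursat's
    theorem requires; a disc does not. *)
Definition box (s : R) (z : C) : Prop := Rabs (Re z) < s /\ Rabs (Im z) < s.

Definition primitive (f : C -> C) (z : C) : C := (hor_int f 0 0 (Re z) + ver_int f (Re z) 0 (Im z))%C.

Lemma between_Rabs (a b t s : R) :
  Rabs a < s -> Rabs b < s -> Rmin a b <= t <= Rmax a b -> Rabs t < s.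
Proof.
  intros Ha Hb Ht. apply Rabs_def2 in Ha. apply Rabs_def2 in Hb. apply Rabs_def1.
  - eapply Rle_lt_trans; [apply Ht|]. apply Rmax_lub_lt; lra.
  - eapply Rlt_le_trans; [|apply Ht]. apply Rmin_glb_lt; lra.
Qed.

Lemma hor_int_const c y a b : hor_int (fun _ => c) y a b = (RtoC (b - a) * c)%C.
Proof. unfold hor_int, line_int. rewrite CRInt_const. ring. Qed.
Lemma ver_int_const c x a b : ver_int (fun _ => c) x a b = (RtoC (b - a) * c * Ci)%C.
Proof. unfold ver_int, line_int. rewrite CRInt_const. ring. Qed.

Lemma ccont_const c z : ccont (fun _ => c) z.
Proof. eapply cder_ccont, cder_const. Qed.

Lemma between_dist (a b t : R) : Rmin a b <= t <= Rmax a b -> Rabs (t - a) <= Rabs (b - a).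
Proof.
  intros [H1 H2]. revert H1 H2. unfold Rmin, Rmax, Rabs.
  destruct (Rle_dec a b); repeat destruct Rcase_abs; lra.
Qed.

Lemma cder_primitive (f : C -> C) (s : R) (z : C) :
  (forall z, box s z -> exists l, cder f z l) -> box s z -> cder (primitive f) z (f z).
Proof.
  intros Hf Hz. destruct z as [x y]. destruct Hz as [Hx Hy]. simpl in Hx, Hy.
  assert (Hs : 0 < s) by (pose proof (Rabs_pos x); lra).
  assert (Hc : forall z, box s z -> ccont f z).
  { intros w Hw. destruct (Hf w Hw) as [l Hl]. eapply cder_ccont, Hl. }
  intros eps He.
  destruct (Hc (x, y) (conj Hx Hy) (eps / 2)) as [d [Hd Hcd]]; [lra|].
  exists (Rmin (d / 2) (Rmin (s - Rabs x) (s - Rabs y))).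
  split; [repeat apply Rmin_glb_lt; lra|].
  intros [a b] Hh.
  assert (Hab : Rabs a <= Cmod (a, b) /\ Rabs b <= Cmod (a, b)).
  { split; [apply (re_le_Cmod (a, b)) | apply (im_le_Cmod (a, b))]. }
  assert (B : Cmod (a, b) < d / 2 /\ Cmod (a, b) < s - Rabs x /\ Cmod (a, b) < s - Rabs y).
  { pose proof (Rmin_l (d / 2) (Rmin (s - Rabs x) (s - Rabs y))).
    pose proof (Rmin_r (d / 2) (Rmin (s - Rabs x) (s - Rabs y))).
    pose proof (Rmin_l (s - Rabs x) (s - Rabs y)). pose proof (Rmin_r (s - Rabs x) (s - Rabs y)). lra. }
  assert (Hxa : Rabs (x + a) < s) by (eapply Rle_lt_trans; [apply Rabs_triang|]; lra).
  assert (Hyb : Rabs (y + b) < s) by (eapply Rle_lt_trans; [apply Rabs_triang|]; lra).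
  assert (H0 : Rabs 0 < s) by (rewrite Rabs_R0; lra).
  assert (Hbox : forall x1 x2 y1 y2, Rabs x1 < s -> Rabs x2 < s -> Rabs y1 < s -> Rabs y2 < s ->
    forall t r, Rmin x1 x2 <= t <= Rmax x1 x2 -> Rmin y1 y2 <= r <= Rmax y1 y2 -> box s (t, r)).
  { intros x1 x2 y1 y2 K1 K2 K3 K4 t r Kt Kr.
    split; simpl; [apply (between_Rabs x1 x2) | apply (between_Rabs y1 y2)]; assumption. }
  assert (Hpt : forall p q : R, Rmin p p <= q <= Rmax p p -> q = p).
  { intros p q. unfold Rmin, Rmax. destruct Rle_dec; lra. }
  assert (Hrefl : forall p, Rmin p p <= p <= Rmax p p).
  { intros p. unfold Rmin, Rmax. destruct Rle_dec; lra. }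
  unfold primitive. simpl.
  rewrite (hor_int_chasles f 0 0 x (x + a)), (ver_int_chasles f (x + a) 0 y (y + b)).
  2-5: intros t Ht; apply Hc; first
    [ solve [apply (Hbox 0 x 0 0); auto] | solve [apply (Hbox x (x + a) 0 0); auto] |
      solve [apply (Hbox (x + a) (x + a) 0 y); auto] | apply (Hbox (x + a) (x + a) y (y + b)); auto ].
  (* This contour trades the side on the real axis for the side at height [y]: the increment of the
     primitive becomes two short integrals along a path from [(x, y)] to [(x + a, y + b)], each
     compared with the integral of the constant [f (x, y)]. *)
  assert (E : contour f x (x + a) 0 y = RtoC 0).
  { apply goursat_unordered. intros t r Ht Hr. apply Hf. eapply (Hbox x (x + a) 0 y); eauto. }
  unfold contour in E.
  replace (hor_int f 0 0 x + hor_int f 0 x (x + a) + (ver_int f (x + a) 0 y + ver_int f (x + a) y (y + b))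
     - (hor_int f 0 0 x + ver_int f x 0 y) - f (x, y) * (a, b))%C with
   ((hor_int f y x (x + a) - RtoC (x + a - x) * f (x, y))
     + (ver_int f (x + a) y (y + b) - RtoC (y + b - y) * f (x, y) * Ci)
     + (hor_int f 0 x (x + a) + ver_int f (x + a) 0 y - hor_int f y x (x + a) - ver_int f x 0 y))%C.
  2: { replace ((a, b) : C) with (RtoC a + RtoC b * Ci)%C
         by (unfold Ci, RtoC, Cplus, Cmult; simpl; f_equal; ring).
       replace (x + a - x) with a by ring. replace (y + b - y) with b by ring. ring. }
  rewrite E, Cplus_0_r, <- (hor_int_const (f (x, y)) y), <- (ver_int_const (f (x, y)) (x + a)).
  assert (C1 : forall t, Rmin x (x + a) <= t <= Rmax x (x + a) -> box s (t, y)).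
  { intros t Ht. eapply (Hbox x (x + a) y y); eauto. }
  assert (C2 : forall t, Rmin y (y + b) <= t <= Rmax y (y + b) -> box s (x + a, t)).
  { intros t Ht. eapply (Hbox (x + a) (x + a) y (y + b)); eauto. }
  assert (D : forall t r, box s (t, r) -> Rabs (t - x) <= Rabs a -> Rabs (r - y) <= Rabs b ->
    Cmod (f (t, r) - f (x, y))%C <= eps / 2).
  { intros t r _ Ht Hr. left. specialize (Hcd ((t - x)%R, (r - y)%R)).
    assert (El : ((x, y) + ((t - x)%R, (r - y)%R))%C = (t, r)) by (unfold Cplus; simpl; f_equal; ring).
    rewrite El in Hcd. apply Hcd.
    eapply Rle_lt_trans; [apply Cmod_le_Re_Im|]. simpl. lra. }
  unfold hor_int, ver_int. rewrite <- !line_int_minus.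
  2-5: intros t Ht; rewrite ?hor_point, ?ver_point; first [apply ccont_const | apply Hc; auto].
  assert (G1 : Cmod (hor_int (fun z => f z - f (x, y))%C y x (x + a)) <= eps / 2 * Rabs (x + a - x)).
  { apply hor_int_bound; intros t Ht.
    - destruct (Hf _ (C1 t Ht)) as [l Hl]. eapply cder_ccont, cder_minus; [exact Hl | apply cder_const].
    - apply D; auto.
      + replace a with (x + a - x) by ring. apply between_dist, Ht.
      + rewrite Rminus_diag, Rabs_R0. apply Rabs_pos. }
  assert (G2 : Cmod (ver_int (fun z => f z - f (x, y))%C (x + a) y (y + b)) <= eps / 2 * Rabs (y + b - y)).
  { apply ver_int_bound; intros t Ht.
    - destruct (Hf _ (C2 t Ht)) as [l Hl]. eapply cder_ccont, cder_minus; [exact Hl | apply cder_const].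
    - apply D; auto.
      + replace (x + a - x) with a by ring. lra.
      + replace b with (y + b - y) by ring. apply between_dist, Ht. }
  replace (x + a - x) with a in G1 by ring. replace (y + b - y) with b in G2 by ring.
  eapply Rle_trans; [apply Cmod_triangle|]. unfold hor_int, ver_int in G1, G2. nra.
Qed.

(** * Local solutions *)

Lemma Cmod_minus_le (a b : C) : Cmod (a - b) <= Cmod a + Cmod b.
Proof. rewrite <- (Cmod_opp b). apply Cmod_triangle. Qed.

Lemma le_geometric_limit (x y q : R) : (forall n : nat, x <= y + q * (/ 2) ^ n) -> x <= y.
Proof.
  intros H. apply le_epsilon. intros eps He.
  destruct (pow_lt_1_zero (/ 2)) with (y := eps / (Rabs q + 1)) as [N HN].
  { rewrite Rabs_right; lra. } { apply Rdiv_lt_0_compat; [lra|]. pose proof (Rabs_pos q). lra. }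
  specialize (HN N (Nat.le_refl N)). specialize (H N).
  assert (Hp : 0 < (/ 2) ^ N) by (apply pow_lt; lra).
  rewrite Rabs_right in HN by lra. pose proof (Rabs_pos q). pose proof (Rle_abs q).
  apply (Rmult_lt_compat_r (Rabs q + 1)) in HN; [|lra].
  unfold Rdiv in HN. rewrite Rmult_assoc, Rinv_l in HN by lra. nra.
Qed.

(** The radius [2 * c * (/ 2) ^ n] is the whole tail of the geometric series, so the intervals of
    this radius around [a n] are nested and share a point. *)
Lemma R_geometric_cauchy (a : nat -> R) (c : R) :
  (forall n, Rabs (a (S n) - a n) <= c * (/ 2) ^ n) ->
  exists l, forall n, Rabs (a n - l) <= 2 * c * (/ 2) ^ n.
Proof.
  intros H.
  assert (Hc : 0 <= c).
  { specialize (H 0%nat). simpl in H. pose proof (Rabs_pos (a 1%nat - a 0%nat)). lra. }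
  destruct (nested_intervals (fun n => a n - 2 * c * (/ 2) ^ n) (fun n => a n + 2 * c * (/ 2) ^ n)) as [l Hl].
  - intros n. specialize (H n). apply Rabs_le_between in H. simpl. lra.
  - intros n. specialize (H n). apply Rabs_le_between in H. simpl. lra.
  - intros n. assert (0 <= (/ 2) ^ n) by (apply pow_le; lra). nra.
  - exists l. intros n. specialize (Hl n). apply Rabs_le. lra.
Qed.

Lemma C_geometric_cauchy (a : nat -> C) (c : R) :
  (forall n, Cmod (a (S n) - a n)%C <= c * (/ 2) ^ n) ->
  exists l, forall n, Cmod (a n - l)%C <= 4 * c * (/ 2) ^ n.
Proof.
  intros H.
  destruct (R_geometric_cauchy (fun n => Re (a n)) c) as [x Hx].
  { intros n. eapply Rle_trans; [|apply H]. apply (re_le_Cmod (a (S n) - a n)%C). }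
  destruct (R_geometric_cauchy (fun n => Im (a n)) c) as [y Hy].
  { intros n. eapply Rle_trans; [|apply H]. apply (im_le_Cmod (a (S n) - a n)%C). }
  exists (x, y). intros n. eapply Rle_trans; [apply Cmod_le_Re_Im|].
  specialize (Hx n). specialize (Hy n).
  change (Re (a n - (x, y))%C) with (Re (a n) - x). change (Im (a n - (x, y))%C) with (Im (a n) - y). lra.
Qed.

Lemma primitive_0 f : primitive f 0 = RtoC 0.
Proof.
  assert (H : forall g a, CRInt g a a = RtoC 0).
  { intros g a. apply (@RInt_point C_R_CompleteNormedModule). }
  unfold primitive, hor_int, ver_int, line_int. change (Re 0) with 0. change (Im 0) with 0. rewrite !H. ring.
Qed.

Lemma Re_segment (a b : C) (x : R) : Re (a + RtoC x * (b - a))%C = Re a + x * (Re b - Re a).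
Proof. destruct a, b. simpl. ring. Qed.
Lemma Im_segment (a b : C) (x : R) : Im (a + RtoC x * (b - a))%C = Im a + x * (Im b - Im a).
Proof. destruct a, b. simpl. ring. Qed.

Lemma Rabs_segment_lt (s a b x : R) :
  Rabs a < s -> Rabs b < s -> 0 <= x <= 1 -> Rabs (a + x * (b - a)) < s.
Proof.
  intros A B Hx. apply Rabs_def2 in A, B.
  apply Rabs_def1; destruct (Rle_dec a b); nra.
Qed.

Lemma box_convex (s : R) (a b : C) (x : R) :
  box s a -> box s b -> 0 <= x <= 1 -> box s (a + RtoC x * (b - a))%C.
Proof.
  intros [A1 A2] [B1 B2] Hx. split; rewrite ?Re_segment, ?Im_segment; apply Rabs_segment_lt; assumption.
Qed.

Lemma box_Cmod (s : R) (z : C) : box s z -> Cmod z < 2 * s.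
Proof. intros [H1 H2]. pose proof (Cmod_le_Re_Im z). lra. Qed.

Lemma disc_box (s : R) (z : C) : Cmod z < s -> box s z.
Proof. intros H. pose proof (re_le_Cmod z). pose proof (im_le_Cmod z). split; lra. Qed.

Lemma box_open (s : R) (z : C) : box s z -> exists d, 0 < d /\ forall h, Cmod h < d -> box s (z + h)%C.
Proof.
  intros [H1 H2]. exists (Rmin (s - Rabs (Re z)) (s - Rabs (Im z))).
  split; [apply Rmin_glb_lt; lra|]. intros h Hh.
  pose proof (Rmin_l (s - Rabs (Re z)) (s - Rabs (Im z))). pose proof (Rmin_r (s - Rabs (Re z)) (s - Rabs (Im z))).
  pose proof (re_le_Cmod h). pose proof (im_le_Cmod h).
  split; destruct z as [x y], h as [a b]; simpl in *;
    (eapply Rle_lt_trans; [apply Rabs_triang|]; lra).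
Qed.

Lemma Re_le_add (a b : C) : Re b <= Re a + Cmod (b - a)%C.
Proof.
  pose proof (re_le_Cmod (b - a)%C) as H. apply Rabs_le_between in H.
  destruct a, b. simpl in *. lra.
Qed.

Definition disc (c : C) (e : R) (T : C) : Prop := Cmod (T - c)%C < e.

Lemma disc_center c e : 0 < e -> disc c e c.
Proof. intros H. unfold disc. replace (c - c)%C with (RtoC 0) by ring. rewrite Cmod_0. exact H. Qed.

Lemma convex_ball_segment (c a b : C) (e x : R) :
  Cmod (a - c)%C <= e -> Cmod (b - c)%C <= e -> 0 <= x <= 1 -> Cmod (a + RtoC x * (b - a) - c)%C <= e.
Proof.
  intros Ha Hb Hx.
  replace (a + RtoC x * (b - a) - c)%C with (RtoC (1 - x) * (a - c) + RtoC x * (b - c))%C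
    by (rewrite RtoC_minus; ring).
  eapply Rle_trans; [apply Cmod_triangle|]. rewrite !Cmod_mult, !Cmod_R, !Rabs_right by lra. nra.
Qed.

Section ODE.

Variables (lam : C) (F : C -> C -> C) (rho r M : R).
Hypothesis rho_pos : 0 < rho.
Hypothesis r_pos : 0 < r.
Hypothesis F_holo : holo2_on (polydisc rho r) F.
Hypothesis M_lt_1 : M < 1.
Hypothesis F_bound : forall p : C2, polydisc rho r p -> Cmod (F (fst p) (snd p)) <= M.

Definition slope (z w : C) : C := (1 + F (Cexp z) (Cexp w))%C.

Lemma Cmod_Cexp_lt (z : C) (s : R) : 0 < s -> Re z < ln s -> Cmod (Cexp z) < s.
Proof.
  intros Hs Hz. rewrite Cmod_Cexp, <- (exp_ln s Hs) at 1. apply exp_increasing, Hz.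
Qed.

Lemma polydisc_Cexp (z w : C) : Re z < ln rho -> Re w < ln r -> polydisc rho r (Cexp z, Cexp w).
Proof. intros Hz Hw. split; simpl; apply Cmod_Cexp_lt; assumption. Qed.

Lemma slope_near_1 (z w : C) : Re z < ln rho -> Re w < ln r -> Cmod (slope z w - 1)%C <= M.
Proof.
  intros Hz Hw. unfold slope.
  replace (1 + F (Cexp z) (Cexp w) - 1)%C with (F (Cexp z) (Cexp w)) by ring.
  apply (F_bound (Cexp z, Cexp w)), polydisc_Cexp; assumption.
Qed.

Lemma slope_le_2 (z w : C) : Re z < ln rho -> Re w < ln r -> Cmod (slope z w) <= 2.
Proof.
  intros Hz Hw. pose proof (slope_near_1 z w Hz Hw).
  replace (slope z w) with ((slope z w - 1) + 1)%C by ring.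
  eapply Rle_trans; [apply Cmod_triangle|]. rewrite Cmod_1. lra.
Qed.

Lemma cder_slope (f g : C -> C) (T l m : C) :
  cder f T l -> cder g T m -> Re (f T) < ln rho -> Re (g T) < ln r ->
  exists k, cder (fun x => slope (f x) (g x)) T k.
Proof.
  intros Hf Hg Hz Hw.
  destruct (cder_comp Cexp f T _ l (cder_Cexp _) Hf) as [lf Hlf].
  destruct (cder_comp Cexp g T _ m (cder_Cexp _) Hg) as [lg Hlg].
  destruct (holo2_comp F (fun x => Cexp (f x)) (fun x => Cexp (g x)) T lf lg) as [k Hk]; auto.
  { apply (F_holo (Cexp (f T), Cexp (g T))), polydisc_Cexp; assumption. }
  exists (0 + k)%C. apply cder_plus; [apply cder_const | exact Hk].
Qed.

Lemma cder_id (z : C) : cder (fun x => x) z 1.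
Proof. apply (cder_ext (fun x => 1 * x + 0)%C); [intros; ring | apply cder_affine]. Qed.

Lemma Re_convex_le (a b : C) (x s : R) :
  0 <= x <= 1 -> Re a <= s -> Re b <= s -> Re (a + RtoC x * (b - a))%C <= s.
Proof. intros Hx Ha Hb. rewrite Re_segment. destruct (Rle_dec (Re a) (Re b)); nra. Qed.

(** Cauchy's estimate in each variable separately: the slope is bounded by 2, and a disc of radius
    [d / 2] around a point with margin [d] stays inside, whence [2 / (d / 2)]. *)
Lemma slope_lip (d : R) (z z' w w' : C) : 0 < d ->
  Re z <= ln rho - d -> Re z' <= ln rho - d -> Re w <= ln r - d -> Re w' <= ln r - d ->
  Cmod (slope z w - slope z' w')%C <= 4 / d * (Cmod (z - z')%C + Cmod (w - w')%C).
Proof.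
  intros Hd Hz Hz' Hw Hw'.
  assert (E : 2 / (d / 2) = 4 / d) by (field; lra).
  assert (B : forall (a c : C), Cmod (a - c)%C <= d / 2 -> Re a <= Re c + d / 2).
  { intros a c H. pose proof (Re_le_add c a). lra. }
  eapply Rle_trans; [apply (Cmod_sub_triangle _ (slope z' w))|].
  rewrite Rmult_plus_distr_l. apply Rplus_le_compat.
  - apply (cder_mean_value (fun x => slope x w)). intros x Hx.
    assert (Hp := Re_convex_le z' z x _ Hx Hz' Hz). set (p := (z' + x * (z - z'))%C) in *.
    destruct (cder_slope (fun x => x) (fun _ => w) p 1 0) as [k Hk];
      [apply cder_id | apply cder_const | lra | lra |].
    exists k. split; [exact Hk|]. rewrite <- E.
    apply (cauchy_estimate (fun x => slope x w) p); [lra | | exact Hk].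
    intros q Hq. specialize (B q p Hq). split.
    + apply (cder_slope (fun x => x) (fun _ => w) q 1 0);
        [apply cder_id | apply cder_const | lra | lra].
    + apply slope_le_2; lra.
  - apply (cder_mean_value (fun x => slope z' x)). intros x Hx.
    assert (Hp := Re_convex_le w' w x _ Hx Hw' Hw). set (p := (w' + x * (w - w'))%C) in *.
    destruct (cder_slope (fun _ => z') (fun x => x) p 0 1) as [k Hk];
      [apply cder_const | apply cder_id | lra | lra |].
    exists k. split; [exact Hk|]. rewrite <- E.
    apply (cauchy_estimate (fun x => slope z' x) p); [lra | | exact Hk].
    intros q Hq. specialize (B q p Hq). split.
    + apply (cder_slope (fun _ => z') (fun x => x) q 0 1);
        [apply cder_const | apply cder_id | lra | lra].
    + apply slope_le_2; lra.
Qed.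

(** Imposing [z = lam * T] makes the time a function on the leaf, so that a loop in a leaf projects
    to a loop of times. *)
Definition solution (u : C -> C) (D : C -> Prop) : Prop :=
  forall T, D T -> Re (lam * T)%C < ln rho /\ Re (u T) < ln r /\ cder u T (slope (lam * T) (u T)).

Lemma cder_shift (f : C -> C) (T0 T l : C) :
  cder f (T - T0)%C l -> cder (fun x => f (x - T0))%C T l.
Proof.
  intros H eps He. destruct (H eps He) as [d [Hd H']]. exists d. split; [exact Hd|].
  intros h Hh. replace (T + h - T0)%C with (T - T0 + h)%C by ring. apply H', Hh.
Qed.

(** The radius [s] is chosen before [T0] and [w0], because the bound on the slope and its Lipschitz
    constant depend on the margin [d] alone. This uniformity is what allows lifts to be continued
    along a whole segment. *)
Lemma solution_exists (d : R) : 0 < d -> exists s, 0 < s /\ forall T0 w0 : C,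
  Re (lam * T0)%C <= ln rho - d -> Re w0 <= ln r - d ->
  exists u, u T0 = w0 /\ solution u (disc T0 s).
Proof.
  intros Hd. pose proof (Cmod_ge_0 lam) as Hl.
  set (L := 8 / d). assert (HL : 0 < L) by (apply Rdiv_lt_0_compat; lra).
  (* Points of the box have modulus below [2 * s]. The three terms keep [Re z] and [Re w] within
     [d / 2] of their initial values and make the Picard map halve distances; [L] is the Lipschitz
     constant for the remaining margin [d / 2]. *)
  set (s := Rmin (d / (4 * (Cmod lam + 1))) (Rmin (d / 8) (/ (4 * L)))).
  assert (Hs : 0 < s).
  { repeat apply Rmin_glb_lt; [apply Rdiv_lt_0_compat; lra | lra |].
    apply Rinv_0_lt_compat; lra. }
  assert (S1 : Cmod lam * (2 * s) <= d / 2).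
  { apply Rle_trans with ((Cmod lam + 1) * (2 * (d / (4 * (Cmod lam + 1))))).
    - assert (s <= d / (4 * (Cmod lam + 1))) by apply Rmin_l. nra.
    - right. field. lra. }
  assert (S2 : 4 * s <= d / 2).
  { assert (s <= d / 8) by (eapply Rle_trans; [apply Rmin_r | apply Rmin_l]). lra. }
  assert (S3 : L * (2 * s) <= / 2).
  { assert (s <= / (4 * L)) by (eapply Rle_trans; [apply Rmin_r | apply Rmin_r]).
    apply Rle_trans with (L * (2 * / (4 * L))); [nra|]. right. field. lra. }
  clearbody s. exists s. split; [exact Hs|]. intros T0 w0 HT Hw.
  set (k := fun (w : C -> C) (h : C) => slope (lam * (T0 + h)) (w h)).
  (* Picard iterates, written in the displacement [h] from [T0] because [primitive] integrates from
     0. *)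
  set (w := fun n => Nat.iter n (fun v (h : C) => (w0 + primitive (k v) h)%C) (fun _ => w0)).
  assert (Hz : forall h, box s h -> Re (lam * (T0 + h))%C <= ln rho - d / 2).
  { intros h Hh. pose proof (Re_le_add (lam * T0)%C (lam * (T0 + h))%C) as H.
    replace (lam * (T0 + h) - lam * T0)%C with (lam * h)%C in H by ring.
    rewrite Cmod_mult in H. pose proof (box_Cmod s h Hh). nra. }
  assert (H0 : box s 0) by (apply disc_box; rewrite Cmod_0; exact Hs).
  assert (Hsmall : forall v : C -> C, (forall h, box s h -> Cmod (v h - w0)%C <= 2 * Cmod h) ->
    forall h, box s h -> Re (v h) <= ln r - d / 2).
  { intros v Hv h Hh. specialize (Hv h Hh). pose proof (Re_le_add w0 (v h)).
    pose proof (box_Cmod s h Hh). lra. }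
  assert (Hlin : forall h, cder (fun h => lam * (T0 + h))%C h lam).
  { intros h. apply (cder_ext (fun h => lam * h + lam * T0)%C); [intros; ring | apply cder_affine]. }
  assert (Hw2 : forall n, (forall h, box s h -> exists l, cder (w n) h l /\ Cmod l <= 2) /\
    (forall h, box s h -> Cmod (w n h - w0)%C <= 2 * Cmod h) /\
    (forall h, box s h -> cder (w (S n)) h (k (w n) h))).
  { assert (Step : forall n, (forall h, box s h -> exists l, cder (w n) h l /\ Cmod l <= 2) ->
      (forall h, box s h -> Cmod (w n h - w0)%C <= 2 * Cmod h) ->
      (forall h, box s h -> cder (w (S n)) h (k (w n) h))).
    { intros n I1 I2 h Hh. replace (k (w n) h) with (0 + k (w n) h)%C by ring.
      apply (cder_plus (fun _ => w0)); [apply cder_const|].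
      apply (cder_primitive _ s); [|exact Hh]. intros z Hz'.
      destruct (I1 z Hz') as [l [Hl' _]].
      apply (cder_slope _ (w n) z lam l); [apply Hlin | exact Hl' | |].
      - specialize (Hz z Hz'). lra.
      - pose proof (Hsmall _ I2 z Hz'). lra. }
    induction n as [|n IH].
    - assert (I1 : forall h, box s h -> exists l, cder (w 0%nat) h l /\ Cmod l <= 2).
      { intros h _. exists (RtoC 0). split; [apply (cder_const w0) | rewrite Cmod_0; lra]. }
      assert (I2 : forall h, box s h -> Cmod (w 0%nat h - w0)%C <= 2 * Cmod h).
      { intros h _. simpl. replace (w0 - w0)%C with (RtoC 0) by ring. rewrite Cmod_0.
        pose proof (Cmod_ge_0 h). lra. }
      auto.
    - destruct IH as (I1 & I2 & I3).
      assert (J1 : forall h, box s h -> exists l, cder (w (S n)) h l /\ Cmod l <= 2).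
      { intros h Hh. exists (k (w n) h). split; [apply I3, Hh|]. apply slope_le_2.
        - specialize (Hz h Hh). lra.
        - pose proof (Hsmall _ I2 h Hh). lra. }
      assert (J2 : forall h, box s h -> Cmod (w (S n) h - w0)%C <= 2 * Cmod h).
      { intros h Hh.
        assert (E0 : w (S n) 0 = w0) by (simpl; rewrite primitive_0; ring).
        rewrite <- E0 at 1. replace h with (h - 0)%C at 2 by ring.
        apply cder_mean_value. intros x Hx. apply J1, box_convex; assumption. }
      auto. }
  assert (E0 : forall n, w n 0 = w0).
  { intros n. destruct n; [reflexivity|]. simpl. rewrite primitive_0. ring. }
  assert (Hlip : forall n h h', box s h -> box s h' -> Cmod (w n h' - w n h)%C <= 2 * Cmod (h' - h)%C).
  { intros n h h' Hh Hh'. apply cder_mean_value. intros x Hx. apply (Hw2 n), box_convex; assumption. }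
  assert (Ek : forall d' : R, 4 / (d / 2) = L) by (intros; unfold L; field; lra).
  (* The first difference is at most [2 * Cmod h], hence below [4 * s]; each iteration gains the
     factor [L * (2 * s) <= / 2]. *)
  assert (Hconv : forall n h, box s h -> Cmod (w (S n) h - w n h)%C <= 4 * s * (/ 2) ^ n).
  { induction n as [|n IH]; intros h Hh.
    - simpl (w 0%nat h). destruct (Hw2 1%nat) as (_ & I2 & _). specialize (I2 h Hh).
      pose proof (box_Cmod s h Hh). simpl pow. lra.
    - assert (B : Cmod ((w (S (S n)) h - w (S n) h) - (w (S (S n)) 0 - w (S n) 0))%C
        <= L * (4 * s * (/ 2) ^ n) * Cmod (h - 0)%C).
      { apply (cder_mean_value (fun h => w (S (S n)) h - w (S n) h)%C). intros x Hx.
        assert (Hp := box_convex s 0 h x H0 Hh Hx). set (p := (0 + x * (h - 0))%C) in *.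
        exists (k (w (S n)) p - k (w n) p)%C. split.
        - apply cder_minus; [apply (Hw2 (S n)), Hp | apply (Hw2 n), Hp].
        - unfold k. specialize (Hz p Hp).
          destruct (Hw2 n) as (_ & I2 & _). destruct (Hw2 (S n)) as (_ & J2 & _).
          pose proof (Hsmall _ I2 p Hp). pose proof (Hsmall _ J2 p Hp).
          eapply Rle_trans; [apply (slope_lip (d / 2)); lra|]. rewrite (Ek 0).
          replace (lam * (T0 + p) - lam * (T0 + p))%C with (RtoC 0) by ring.
          rewrite Cmod_0, Rplus_0_l. apply Rmult_le_compat_l; [lra|]. apply IH, Hp. }
      rewrite !E0 in B.
      replace (w (S (S n)) h - w (S n) h - (w0 - w0))%C with (w (S (S n)) h - w (S n) h)%C in B by ring.
      replace (h - 0)%C with h in B by ring. pose proof (box_Cmod s h Hh). pose proof (Cmod_ge_0 h).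
      assert (0 < (/ 2) ^ n) by (apply pow_lt; lra).
      eapply Rle_trans; [exact B|]. change ((/ 2) ^ S n) with (/ 2 * (/ 2) ^ n).
      apply Rle_trans with (L * (2 * s) * (4 * s * (/ 2) ^ n)).
      + assert (0 <= 4 * s * (/ 2) ^ n) by (apply Rmult_le_pos; lra).
        assert (0 <= L * (4 * s * (/ 2) ^ n)) by (apply Rmult_le_pos; lra). nra.
      + assert (0 <= 4 * s * (/ 2) ^ n) by (apply Rmult_le_pos; lra). nra. }
  destruct (choice_fun (fun (h l : C) => box s h -> forall n, Cmod (w n h - l)%C <= 16 * s * (/ 2) ^ n)) as [u Hu].
  { intros h. destruct (classic (box s h)) as [Hh|Hh]; [|exists (RtoC 0); tauto].
    destruct (C_geometric_cauchy (fun n => w n h) (4 * s)) as [l Hl']; [intros n; apply Hconv, Hh|].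
    exists l. intros _ n. replace (16 * s) with (4 * (4 * s)) by ring. apply Hl'. }
  assert (Hu2 : forall h, box s h -> Cmod (u h - w0)%C <= 2 * Cmod h).
  { intros h Hh. apply (le_geometric_limit _ _ (16 * s)). intros n.
    eapply Rle_trans; [apply (Cmod_sub_triangle _ (w n h))|].
    rewrite (Cmod_sub_sym (u h)). specialize (Hu h Hh n).
    destruct (Hw2 n) as (_ & I2 & _). specialize (I2 h Hh). lra. }
  (* The iterates are compared with the affine map of slope [k u h]. By the mean value bound the
     deviation is quadratic in the increment up to a geometric error, which vanishes in the limit.
     In [q], the summand [Cmod lam] accounts for the motion of [z] and 2 for that of [w]. *)
  assert (Hud : forall h, box s h -> cder u h (k u h)).
  { intros h Hh eps Heps. set (q := L * (Cmod lam + 2)).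
    assert (Hq : 0 <= q) by (apply Rmult_le_pos; lra).
    destruct (box_open s h Hh) as [d1 [Hd1 Hb1]].
    exists (Rmin d1 (eps / (q + 1))). split; [apply Rmin_glb_lt; [lra | apply Rdiv_lt_0_compat; lra]|].
    intros x Hx. assert (Hx1 := Rlt_le_trans _ _ _ Hx (Rmin_l _ _)).
    assert (Hx2 := Rlt_le_trans _ _ _ Hx (Rmin_r _ _)).
    assert (Hhx := Hb1 x Hx1). pose proof (Cmod_ge_0 x) as Hx0.
    assert (B : Cmod (u (h + x) - u h - k u h * x)%C <= q * Cmod x * Cmod x).
    { apply (le_geometric_limit _ _ (L * (16 * s) * Cmod x + 16 * s)). intros n.
      assert (Bn : Cmod ((w (S n) (h + x) - (k u h * (h + x) + 0)) - (w (S n) h - (k u h * h + 0)))%C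
        <= (q * Cmod x + L * (16 * s * (/ 2) ^ n)) * Cmod (h + x - h)%C).
      { apply (cder_mean_value (fun y => w (S n) y - (k u h * y + 0))%C). intros t Ht.
        assert (Hp := box_convex s h (h + x)%C t Hh Hhx Ht). set (p := (h + t * (h + x - h))%C) in *.
        exists (k (w n) p - k u h)%C. split.
        - apply cder_minus; [apply (Hw2 n), Hp | apply cder_affine].
        - unfold k. pose proof (Hz p Hp). pose proof (Hz h Hh).
          destruct (Hw2 n) as (_ & I2 & _).
          pose proof (Hsmall _ I2 p Hp). pose proof (Hsmall _ Hu2 h Hh).
          assert (Epx : Cmod (p - h)%C <= Cmod x).
          { unfold p. replace (h + t * (h + x - h) - h)%C with (RtoC t * x)%C by ring.
            rewrite Cmod_mult, Cmod_R, Rabs_right by lra. nra. }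
          eapply Rle_trans; [apply (slope_lip (d / 2)); lra|]. rewrite (Ek 0).
          unfold q. rewrite Rmult_assoc, <- Rmult_plus_distr_l.
          apply Rmult_le_compat_l; [lra|].
          replace (lam * (T0 + p) - lam * (T0 + h))%C with (lam * (p - h))%C by ring.
          rewrite Cmod_mult.
          pose proof (Cmod_sub_triangle (w n p) (w n h) (u h)). pose proof (Hlip n h p Hh Hp).
          specialize (Hu h Hh n). nra. }
      replace (h + x - h)%C with x in Bn by ring.
      set (W := (w (S n) (h + x) - (k u h * (h + x) + 0) - (w (S n) h - (k u h * h + 0)))%C) in *.
      replace (u (h + x) - u h - k u h * x)%C
        with (W + ((w (S n) h - u h) - (w (S n) (h + x) - u (h + x))))%C by (unfold W; ring).
      eapply Rle_trans; [apply Cmod_triangle|].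
      pose proof (Cmod_minus_le (w (S n) h - u h)%C (w (S n) (h + x) - u (h + x))%C) as T.
      pose proof (Hu h Hh (S n)) as U1. pose proof (Hu _ Hhx (S n)) as U2.
      change ((/ 2) ^ S n) with (/ 2 * (/ 2) ^ n) in U1, U2.
      lra. }
    eapply Rle_trans; [exact B|]. apply Rmult_le_compat_r; [exact Hx0|].
    apply (Rmult_lt_compat_r (q + 1)) in Hx2; [|lra].
    unfold Rdiv in Hx2. rewrite Rmult_assoc, Rinv_l in Hx2 by lra. nra. }
  exists (fun T => u (T - T0)%C). split.
  - replace (T0 - T0)%C with (RtoC 0) by ring. specialize (Hu2 0 H0). rewrite Cmod_0 in Hu2.
    assert (Ez : Cmod (u 0 - w0)%C = 0) by (pose proof (Cmod_ge_0 (u 0 - w0)%C); lra).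
    apply Cmod_eq_0 in Ez. replace (u 0) with (u 0 - w0 + w0)%C by ring. rewrite Ez. ring.
  - intros T HTs. assert (Hb := disc_box s (T - T0)%C HTs).
    pose proof (Hz _ Hb) as Z. rewrite Cplus_sub_cancel in Z.
    pose proof (Hsmall _ Hu2 _ Hb). pose proof (Hud _ Hb) as D. unfold k in D.
    rewrite Cplus_sub_cancel in D. repeat split; [lra | lra |].
    apply cder_shift, D.
Qed.

Lemma solution_sub u (D D' : C -> Prop) : (forall T, D' T -> D T) -> solution u D -> solution u D'.
Proof. intros H S T HT. apply S, H, HT. Qed.

(** Picard's contraction applied to two given solutions: on a disc with [L * e' <= / 2], any uniform
    bound on their difference can be halved. *)
Lemma solution_unique_small (u v : C -> C) (c : C) (e : R) : 0 < e ->
  solution u (disc c e) -> solution v (disc c e) -> u c = v c ->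
  exists e', 0 < e' /\ e' <= e /\ forall T, disc c e' T -> u T = v T.
Proof.
  intros He Hu Hv E. pose proof (Cmod_ge_0 lam) as Hl.
  destruct (Hu c (disc_center c e He)) as (A1 & A2 & A3).
  destruct (Hv c (disc_center c e He)) as (_ & B2 & B3).
  set (d := Rmin (ln rho - Re (lam * c)%C) (ln r - Re (u c)) / 2).
  assert (Hd : 0 < d) by (apply Rdiv_lt_0_compat; [apply Rmin_glb_lt; lra | lra]).
  assert (Hd1 : Re (lam * c)%C <= ln rho - 2 * d).
  { unfold d. pose proof (Rmin_l (ln rho - Re (lam * c)%C) (ln r - Re (u c))). lra. }
  assert (Hd2 : Re (u c) <= ln r - 2 * d).
  { unfold d. pose proof (Rmin_r (ln rho - Re (lam * c)%C) (ln r - Re (u c))). lra. }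
  clearbody d.
  (* [d] keeps both solutions in the region of the Lipschitz bound; 1 supplies the initial bound 2
     for the halving. *)
  destruct (cder_ccont _ _ _ A3 (Rmin d 1)) as [d1 [Hd1' C1]]; [apply Rmin_glb_lt; lra|].
  destruct (cder_ccont _ _ _ B3 (Rmin d 1)) as [d2 [Hd2' C2]]; [apply Rmin_glb_lt; lra|].
  set (L := 4 / d). assert (HL : 0 < L) by (apply Rdiv_lt_0_compat; lra).
  set (e' := Rmin (Rmin e (d / (Cmod lam + 1))) (Rmin (Rmin d1 d2) (/ (2 * L)))).
  assert (He' : 0 < e').
  { repeat apply Rmin_glb_lt; try lra; [apply Rdiv_lt_0_compat; lra | apply Rinv_0_lt_compat; lra]. }
  assert (e' <= e /\ e' <= d / (Cmod lam + 1) /\ e' <= d1 /\ e' <= d2 /\ e' <= / (2 * L)) as (Q1 & Q2 & Q3 & Q4 & Q5).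
  { unfold e'. repeat split.
    - eapply Rle_trans; [apply Rmin_l | apply Rmin_l].
    - eapply Rle_trans; [apply Rmin_l | apply Rmin_r].
    - eapply Rle_trans; [apply Rmin_r | eapply Rle_trans; [apply Rmin_l | apply Rmin_l]].
    - eapply Rle_trans; [apply Rmin_r | eapply Rle_trans; [apply Rmin_l | apply Rmin_r]].
    - eapply Rle_trans; [apply Rmin_r | apply Rmin_r]. }
  clearbody e'. exists e'. split; [exact He'|]. split; [exact Q1|].
  assert (Z : forall T, disc c e' T -> Re (lam * T)%C <= ln rho - d).
  { intros T HT. pose proof (Re_le_add (lam * c)%C (lam * T)%C) as H.
    replace (lam * T - lam * c)%C with (lam * (T - c))%C in H by ring.
    rewrite Cmod_mult in H. unfold disc in HT.
    assert (Cmod lam * Cmod (T - c)%C <= d).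
    { apply Rle_trans with ((Cmod lam + 1) * (d / (Cmod lam + 1))).
      - pose proof (Cmod_ge_0 (T - c)%C). apply Rmult_le_compat; lra.
      - right. field. lra. }
    lra. }
  assert (U : forall T, disc c e' T -> Cmod (u T - u c)%C < Rmin d 1).
  { intros T HT. specialize (C1 (T - c)%C). rewrite Cplus_sub_cancel in C1. apply C1. unfold disc in HT. lra. }
  assert (V : forall T, disc c e' T -> Cmod (v T - v c)%C < Rmin d 1).
  { intros T HT. specialize (C2 (T - c)%C). rewrite Cplus_sub_cancel in C2. apply C2. unfold disc in HT. lra. }
  pose proof (Rmin_l d 1). pose proof (Rmin_r d 1).
  assert (Bn : forall n T, disc c e' T -> Cmod (u T - v T)%C <= 2 * (/ 2) ^ n).
  { induction n as [|n IH]; intros T HT.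
    - simpl pow. pose proof (Cmod_sub_triangle (u T) (u c) (v T)) as H1.
      rewrite E in H1 at 2. rewrite (Cmod_sub_sym (v c)) in H1.
      specialize (U T HT). specialize (V T HT). lra.
    - assert (B : Cmod ((u T - v T) - (u c - v c))%C <= L * (2 * (/ 2) ^ n) * Cmod (T - c)%C).
      { apply (cder_mean_value (fun T => u T - v T)%C). intros x Hx.
        assert (Hp : disc c e' (c + x * (T - c))%C).
        { eapply Rle_lt_trans; [apply (convex_ball_segment c c T (Cmod (T - c)%C)); auto|].
          - replace (c - c)%C with (RtoC 0) by ring. rewrite Cmod_0. apply Cmod_ge_0.
          - lra.
          - exact HT. }
        set (p := (c + x * (T - c))%C) in *.
        assert (Hpe : disc c e p) by (unfold disc in *; lra).
        exists (slope (lam * p) (u p) - slope (lam * p) (v p))%C. split.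
        - apply cder_minus; [apply (Hu p Hpe) | apply (Hv p Hpe)].
        - specialize (Z p Hp). specialize (U p Hp). specialize (V p Hp).
          pose proof (Re_le_add (u c) (u p)). pose proof (Re_le_add (v c) (v p)).
          rewrite <- E in *.
          eapply Rle_trans; [apply (slope_lip d); lra|]. fold L.
          replace (lam * p - lam * p)%C with (RtoC 0) by ring.
          rewrite Cmod_0, Rplus_0_l. apply Rmult_le_compat_l; [lra|]. apply IH, Hp. }
      rewrite E in B. replace (u T - v T - (v c - v c))%C with (u T - v T)%C in B by ring.
      eapply Rle_trans; [exact B|]. change ((/ 2) ^ S n) with (/ 2 * (/ 2) ^ n).
      assert (0 < (/ 2) ^ n) by (apply pow_lt; lra). unfold disc in HT.
      assert (Le : L * e' <= / 2).
      { apply Rle_trans with (L * / (2 * L)); [nra|]. right. field. lra. }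
      pose proof (Cmod_ge_0 (T - c)%C).
      assert (L * Cmod (T - c)%C <= / 2) by nra. nra. }
  intros T HT. assert (Cz : Cmod (u T - v T)%C = 0).
  { apply Rle_antisym; [|apply Cmod_ge_0]. apply (le_geometric_limit _ _ 2). intros n.
    rewrite Rplus_0_l. apply Bn, HT. }
  apply Cmod_eq_0 in Cz. replace (u T) with (u T - v T + v T)%C by ring. rewrite Cz. ring.
Qed.

(** * Lifting time paths to leaves *)

(** Connectedness of an interval. The local step carries [G] from [x1] to [x2] whatever their
    position relative to [x], so at the supremum of the good points it starts from a good point just
    before and passes beyond. *)
Lemma real_induction (G : R -> Prop) (a b : R) : a <= b -> G a ->
  (forall x, a <= x <= b -> exists d, 0 < d /\ forall x1 x2, a <= x1 -> x1 <= x2 -> x2 <= b ->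
     Rabs (x1 - x) < d -> Rabs (x2 - x) < d -> G x1 -> G x2) -> G b.
Proof.
  intros Hab Ga H.
  destruct (completeness (fun x => a <= x <= b /\ G x)) as [m [Hm1 Hm2]].
  - exists b. intros x Hx. apply Hx.
  - exists a. split; [lra | exact Ga].
  - assert (Hma : a <= m) by (apply Hm1; split; [lra | exact Ga]).
    assert (Hmb : m <= b) by (apply Hm2; intros x Hx; apply Hx).
    destruct (H m (conj Hma Hmb)) as [d [Hd Hs]].
    assert (Hx1 : exists x1, (a <= x1 <= b /\ G x1) /\ m - d < x1).
    { apply NNPP. intros Hn. assert (m <= m - d); [|lra].
      apply Hm2. intros x Hx. apply Rnot_lt_le. intros Hlt. apply Hn. exists x. split; [exact Hx | lra]. }
    destruct Hx1 as [x1 [[Hx1 G1] Hlt]].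
    assert (x1 <= m) by (apply Hm1; split; assumption).
    assert (G2 : G (Rmin b (m + d / 2))).
    { assert (Hle : m <= Rmin b (m + d / 2)) by (apply Rmin_glb; lra).
      assert (Rmin b (m + d / 2) <= m + d / 2) by apply Rmin_r.
      assert (Rmin b (m + d / 2) <= b) by apply Rmin_l.
      apply (Hs x1); try lra; [apply Rabs_def1; lra | apply Rabs_def1; lra | exact G1]. }
    assert (Hle : Rmin b (m + d / 2) <= m).
    { apply Hm1. split; [|exact G2]. split; [apply Rmin_glb; lra | apply Rmin_l]. }
    revert G2 Hle. unfold Rmin. destruct (Rle_dec b (m + d / 2)); intros G2 Hle; [exact G2 | lra].
Qed.

Definition itv (a b x : R) : Prop := a <= x <= b.

Definition cont_on (I : R -> Prop) (c : R -> C) : Prop :=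
  forall x, I x -> forall eta, 0 < eta -> exists d, 0 < d /\
    forall y, I y -> Rabs (y - x) < d -> Cmod (c y - c x)%C < eta.

(* w is locally a solution read along c: (lam * c, w) is a path in a leaf. *)
Definition lift_at (I : R -> Prop) (c w : R -> C) (x : R) : Prop :=
  exists (u : C -> C) (e : R), 0 < e /\ solution u (disc (c x) e) /\
    forall eta, 0 < eta -> exists d, 0 < d /\
      forall y, I y -> Rabs (y - x) < d -> Cmod (c y - c x)%C < eta /\ w y = u (c y).

Definition lift (I : R -> Prop) (c w : R -> C) : Prop := forall x, I x -> lift_at I c w x.

Lemma Rabs_minus_self (x d : R) : 0 < d -> Rabs (x - x) < d.
Proof. intros H. rewrite Rminus_diag, Rabs_R0. exact H. Qed.

Lemma lift_cont I c w : lift I c w -> cont_on I c.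
Proof.
  intros H x Hx eta Heta. destruct (H x Hx) as (u & e & He & _ & Hd).
  destruct (Hd eta Heta) as [d [Hd0 Hd']]. exists d. split; [exact Hd0|].
  intros y Hy Hyx. apply Hd'; assumption.
Qed.

Lemma lift_sub (I J : R -> Prop) c w : (forall x, J x -> I x) -> lift I c w -> lift J c w.
Proof.
  intros HJ H x Hx. destruct (H x (HJ x Hx)) as (u & e & He & Hu & Hd).
  exists u, e. split; [exact He|]. split; [exact Hu|]. intros eta Heta.
  destruct (Hd eta Heta) as [d [Hd0 Hd']]. exists d. split; [exact Hd0|]. intros y Hy. apply Hd', HJ, Hy.
Qed.

Lemma lift_ext I (c c' w w' : R -> C) :
  (forall x, I x -> c x = c' x) -> (forall x, I x -> w x = w' x) -> lift I c w -> lift I c' w'.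
Proof.
  intros Ec Ew H x Hx. destruct (H x Hx) as (u & e & He & Hu & Hd).
  exists u, e. split; [exact He|]. rewrite <- (Ec x Hx). split; [exact Hu|]. intros eta Heta.
  destruct (Hd eta Heta) as [d [Hd0 Hd']]. exists d. split; [exact Hd0|]. intros y Hy Hyx.
  rewrite <- (Ec y Hy), <- (Ew y Hy). apply Hd'; assumption.
Qed.

Lemma lift_comp (I J : R -> Prop) (c w : R -> C) (f : R -> R) :
  (forall x, J x -> I (f x)) ->
  (forall x, J x -> forall eta, 0 < eta -> exists d, 0 < d /\
     forall y, J y -> Rabs (y - x) < d -> Rabs (f y - f x) < eta) ->
  lift I c w -> lift J (fun x => c (f x)) (fun x => w (f x)).
Proof.
  intros HJ Hf H x Hx. destruct (H (f x) (HJ x Hx)) as (u & e & He & Hu & Hd).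
  exists u, e. split; [exact He|]. split; [exact Hu|]. intros eta Heta.
  destruct (Hd eta Heta) as [d [Hd0 Hd']]. destruct (Hf x Hx d Hd0) as [d2 [Hd2 Hd2']].
  exists d2. split; [exact Hd2|]. intros y Hy Hyx. apply Hd'; auto.
Qed.

Lemma disc_sub (c p : C) (e e' : R) : Cmod (p - c)%C + e' <= e -> forall T, disc p e' T -> disc c e T.
Proof.
  intros H T HT. unfold disc in *. pose proof (Cmod_sub_triangle T p c). lra.
Qed.

Lemma lift_solution (I : R -> Prop) (c : R -> C) (u : C -> C) (c0 : C) (e : R) :
  solution u (disc c0 e) -> cont_on I c -> (forall x, I x -> disc c0 e (c x)) -> lift I c (fun x => u (c x)).
Proof.
  intros Hu Hc Hin x Hx. specialize (Hin x Hx). unfold disc in Hin.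
  exists u, (e - Cmod (c x - c0)%C). split; [lra|]. split.
  - eapply solution_sub; [|exact Hu]. apply disc_sub. lra.
  - intros eta Heta. destruct (Hc x Hx eta Heta) as [d [Hd Hd']]. exists d. split; [exact Hd|].
    intros y Hy Hyx. split; [apply Hd'; assumption | reflexivity].
Qed.

Lemma solution_unique (u v : C -> C) (c : C) (e1 e2 : R) : 0 < e1 -> 0 < e2 ->
  solution u (disc c e1) -> solution v (disc c e2) -> u c = v c ->
  exists e', 0 < e' /\ forall T, disc c e' T -> u T = v T.
Proof.
  intros H1 H2 Hu Hv E. assert (Hm : 0 < Rmin e1 e2) by (apply Rmin_glb_lt; lra).
  destruct (solution_unique_small u v c (Rmin e1 e2) Hm) as (e' & He' & _ & H'); auto.
  - eapply solution_sub; [|exact Hu]. intros T HT. eapply Rlt_le_trans; [exact HT | apply Rmin_l].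
  - eapply solution_sub; [|exact Hv]. intros T HT. eapply Rlt_le_trans; [exact HT | apply Rmin_r].
  - exists e'. auto.
Qed.

(** Agreement of two lifts is an open condition by uniqueness of solutions, and disagreement is open
    by continuity. *)
Lemma lift_eq_local I c w1 w2 x : lift I c w1 -> lift I c w2 -> I x ->
  exists d, 0 < d /\ forall y, I y -> Rabs (y - x) < d -> (w1 y = w2 y <-> w1 x = w2 x).
Proof.
  intros L1 L2 Hx. destruct (L1 x Hx) as (u1 & e1 & He1 & Hu1 & K1).
  destruct (L2 x Hx) as (u2 & e2 & He2 & Hu2 & K2).
  assert (X1 : w1 x = u1 (c x)).
  { destruct (K1 1 Rlt_0_1) as [d [Hd K]]. apply K; [exact Hx | apply Rabs_minus_self, Hd]. }
  assert (X2 : w2 x = u2 (c x)).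
  { destruct (K2 1 Rlt_0_1) as [d [Hd K]]. apply K; [exact Hx | apply Rabs_minus_self, Hd]. }
  destruct (classic (w1 x = w2 x)) as [E|E].
  - destruct (solution_unique u1 u2 (c x) e1 e2) as (e & He & Hu); auto; [congruence|].
    destruct (K1 e He) as [d1 [Hd1 K1']]. destruct (K2 e He) as [d2 [Hd2 K2']].
    exists (Rmin d1 d2). split; [apply Rmin_glb_lt; lra|]. intros y Hy Hyx.
    destruct (K1' y Hy) as [A1 A2]; [eapply Rlt_le_trans; [exact Hyx | apply Rmin_l]|].
    destruct (K2' y Hy) as [B1 B2]; [eapply Rlt_le_trans; [exact Hyx | apply Rmin_r]|].
    split; [intros _; exact E | intros _]. rewrite A2, B2. apply Hu, A1.
  - assert (Hn : 0 < Cmod (u1 (c x) - u2 (c x))%C).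
    { apply Cmod_gt_0. intros Z. apply E. rewrite X1, X2.
      replace (u1 (c x)) with (u1 (c x) - u2 (c x) + u2 (c x))%C by ring. rewrite Z. ring. }
    set (n := Cmod (u1 (c x) - u2 (c x))%C) in *.
    destruct (cder_ccont _ _ _ (proj2 (proj2 (Hu1 _ (disc_center _ _ He1)))) (n / 2)) as [r1 [Hr1 C1]]; [lra|].
    destruct (cder_ccont _ _ _ (proj2 (proj2 (Hu2 _ (disc_center _ _ He2)))) (n / 2)) as [r2 [Hr2 C2]]; [lra|].
    destruct (K1 r1 Hr1) as [d1 [Hd1 K1']]. destruct (K2 r2 Hr2) as [d2 [Hd2 K2']].
    exists (Rmin d1 d2). split; [apply Rmin_glb_lt; lra|]. intros y Hy Hyx.
    split; [intros Ey; exfalso | tauto].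
    destruct (K1' y Hy) as [A1 A2]; [eapply Rlt_le_trans; [exact Hyx | apply Rmin_l]|].
    destruct (K2' y Hy) as [B1 B2]; [eapply Rlt_le_trans; [exact Hyx | apply Rmin_r]|].
    specialize (C1 _ A1). specialize (C2 _ B1). rewrite Cplus_sub_cancel in C1, C2.
    pose proof (Cmod_sub_triangle (u1 (c x)) (u1 (c y)) (u2 (c x))) as T.
    fold n in T. rewrite (Cmod_sub_sym (u1 (c x)) (u1 (c y))) in T.
    assert (T' : Cmod (u1 (c y) - u2 (c x))%C = Cmod (u2 (c y) - u2 (c x))%C).
    { rewrite <- A2, Ey, B2. reflexivity. }
    lra.
Qed.

Lemma lift_unique (a b : R) (c w1 w2 : R -> C) : a <= b ->
  lift (itv a b) c w1 -> lift (itv a b) c w2 -> (w1 a = w2 a <-> w1 b = w2 b).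
Proof.
  intros Hab L1 L2.
  apply (real_induction (fun x => w1 a = w2 a <-> w1 x = w2 x) a b Hab); [tauto|].
  intros x Hx. destruct (lift_eq_local _ _ _ _ x L1 L2 Hx) as [d [Hd H]].
  exists d. split; [exact Hd|]. intros x1 x2 H1 H2 H3 D1 D2.
  assert (E1 := H x1 (conj H1 (Rle_trans _ _ _ H2 H3)) D1).
  assert (E2 := H x2 (conj (Rle_trans _ _ _ H1 H2) H3) D2). tauto.
Qed.

Lemma lift_glue (a b e : R) (c w1 w2 : R -> C) : a <= b -> b <= e ->
  lift (itv a b) c w1 -> lift (itv b e) c w2 -> w1 b = w2 b ->
  lift (itv a e) c (fun x => if Rle_dec x b then w1 x else w2 x).
Proof.
  intros Hab Hbe L1 L2 E x Hx. destruct (Rtotal_order x b) as [Hlt|[Heq|Hgt]].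
  - destruct (L1 x) as (u & e' & He & Hu & K); [unfold itv in *; lra|].
    exists u, e'. split; [exact He|]. split; [exact Hu|]. intros eta Heta.
    destruct (K eta Heta) as [d [Hd K']]. exists (Rmin d (b - x)).
    split; [apply Rmin_glb_lt; lra|]. intros y Hy Hyx.
    assert (D1 := Rlt_le_trans _ _ _ Hyx (Rmin_l _ _)). assert (D2 := Rlt_le_trans _ _ _ Hyx (Rmin_r _ _)).
    apply Rabs_def2 in D2. destruct (Rle_dec y b); [|lra]. apply K'; [unfold itv in *; lra | exact D1].
  (* At the junction the two local solutions take the same value, hence coincide nearby, and the
     left one reads both halves. *)
  - subst x. destruct (L1 b) as (u & e1 & He1 & Hu & K1); [unfold itv in *; lra|].
    destruct (L2 b) as (v & e2 & He2 & Hv & K2); [unfold itv in *; lra|].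
    assert (X1 : w1 b = u (c b)).
    { destruct (K1 1 Rlt_0_1) as [d [Hd K]]. apply K; [unfold itv; lra | apply Rabs_minus_self, Hd]. }
    assert (X2 : w2 b = v (c b)).
    { destruct (K2 1 Rlt_0_1) as [d [Hd K]]. apply K; [unfold itv; lra | apply Rabs_minus_self, Hd]. }
    destruct (solution_unique u v (c b) e1 e2) as (e0 & He0 & Huv); auto; [congruence|].
    exists u, e1. split; [exact He1|]. split; [exact Hu|]. intros eta Heta.
    destruct (K1 eta Heta) as [d1 [Hd1 K1']].
    destruct (K2 (Rmin eta e0)) as [d2 [Hd2 K2']]; [apply Rmin_glb_lt; lra|].
    exists (Rmin d1 d2). split; [apply Rmin_glb_lt; lra|]. intros y Hy Hyx.
    assert (D1 := Rlt_le_trans _ _ _ Hyx (Rmin_l _ _)). assert (D2 := Rlt_le_trans _ _ _ Hyx (Rmin_r _ _)).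
    destruct (Rle_dec y b) as [Hyb|Hyb].
    + apply K1'; [unfold itv in *; lra | exact D1].
    + destruct (K2' y) as [A1 A2]; [unfold itv in *; lra | exact D2|].
      split; [eapply Rlt_le_trans; [exact A1 | apply Rmin_l]|].
      rewrite A2. symmetry. apply Huv. eapply Rlt_le_trans; [exact A1 | apply Rmin_r].
  - destruct (L2 x) as (u & e' & He & Hu & K); [unfold itv in *; lra|].
    exists u, e'. split; [exact He|]. split; [exact Hu|]. intros eta Heta.
    destruct (K eta Heta) as [d [Hd K']]. exists (Rmin d (x - b)).
    split; [apply Rmin_glb_lt; lra|]. intros y Hy Hyx.
    assert (D1 := Rlt_le_trans _ _ _ Hyx (Rmin_l _ _)). assert (D2 := Rlt_le_trans _ _ _ Hyx (Rmin_r _ _)).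
    apply Rabs_def2 in D2. destruct (Rle_dec y b); [lra|]. apply K'; [unfold itv in *; lra | exact D1].
Qed.

Lemma affine_cont (I : R -> Prop) (c0 d : C) : cont_on I (fun x => c0 + RtoC x * d)%C.
Proof.
  intros x _ eta Heta. pose proof (Cmod_ge_0 d) as Hd.
  exists (eta / (Cmod d + 1)). split; [apply Rdiv_lt_0_compat; lra|]. intros y _ Hy.
  replace (c0 + y * d - (c0 + x * d))%C with (RtoC (y - x) * d)%C by (rewrite RtoC_minus; ring).
  rewrite Cmod_mult, Cmod_R.
  apply (Rmult_lt_compat_r (Cmod d + 1)) in Hy; [|lra].
  unfold Rdiv in Hy. rewrite Rmult_assoc, Rinv_l in Hy by lra.
  pose proof (Rabs_pos (y - x)). nra.
Qed.

Lemma Re_real_mult (x : R) (z : C) : Re (RtoC x * z)%C = x * Re z.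
Proof. destruct z. simpl. ring. Qed.

(** The sign condition on [k * v] preserves [Re w <= ln r - d] along the lift, so [solution_exists]
    applies with the same step [s] at every point reached. *)
Lemma lift_linear (d : R) (c0 v w0 : C) : 0 < d ->
  (forall x, 0 <= x <= 1 -> Re (lam * (c0 + RtoC x * v))%C <= ln rho - d) ->
  Re w0 <= ln r - d ->
  (forall k : C, Cmod (k - 1)%C <= M -> Re (k * v)%C <= 0) ->
  exists w, w 0 = w0 /\ lift (itv 0 1) (fun x => c0 + RtoC x * v)%C w.
Proof.
  intros Hd Hz Hw Hk. set (c := fun x : R => (c0 + RtoC x * v)%C) in *.
  destruct (solution_exists d Hd) as [s [Hs Hpic]]. pose proof (Cmod_ge_0 v) as Hv.
  assert (Hc : forall x y, (c y - c x)%C = (RtoC (y - x) * v)%C).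
  { intros x y. unfold c. rewrite RtoC_minus. ring. }
  cut (exists w, w 0 = w0 /\ lift (itv 0 1) c w /\ Re (w 1) <= ln r - d).
  { intros [w (H1 & H2 & _)]. exists w. auto. }
  apply (real_induction (fun x => exists w, w 0 = w0 /\ lift (itv 0 x) c w /\ Re (w x) <= ln r - d) 0 1);
    [lra | |].
  - destruct (Hpic (c 0) w0) as (u & Hu0 & Hu); [apply Hz; lra | exact Hw |].
    exists (fun x => u (c x)). split; [exact Hu0|]. split; [|rewrite Hu0; exact Hw].
    apply (lift_solution _ c u (c 0) s Hu); [apply affine_cont|].
    intros x [Hx1 Hx2]. replace x with 0 by lra. apply disc_center, Hs.
  (* Two parameters this close to [x] have times less than [s] apart, so the disc of radius [s]
     around the first contains the segment to the second. *)
  - intros x Hx. exists (s / (2 * (Cmod v + 1))). split; [apply Rdiv_lt_0_compat; lra|].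
    intros x1 x2 H1 H2 H3 D1 D2 (w & W0 & W1 & W2).
    assert (Hx12 : 0 <= x2 - x1 < s / (Cmod v + 1)).
    { apply Rabs_def2 in D1, D2.
      assert (s / (Cmod v + 1) = s / (2 * (Cmod v + 1)) + s / (2 * (Cmod v + 1))) by (field; lra). lra. }
    assert (Hin : forall y, x1 <= y <= x2 -> disc (c x1) s (c y)).
    { intros y Hy. unfold disc. rewrite Hc, Cmod_mult, Cmod_R, Rabs_right by lra.
      destruct Hx12 as [_ Hlt]. apply (Rmult_lt_compat_r (Cmod v + 1)) in Hlt; [|lra].
      unfold Rdiv in Hlt. rewrite Rmult_assoc, Rinv_l in Hlt by lra. nra. }
    destruct (Hpic (c x1) (w x1)) as (u & Hu0 & Hu); [apply Hz; lra | exact W2 |].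
    exists (fun y => if Rle_dec y x1 then w y else u (c y)). split; [|split].
    + destruct (Rle_dec 0 x1); [exact W0 | lra].
    + apply (lift_glue 0 x1 x2 c w (fun y => u (c y))); auto.
      apply (lift_solution _ c u (c x1) s Hu); [apply affine_cont | exact Hin].
    + destruct (Rle_dec x2 x1) as [Hle|Hle].
      { replace x2 with x1 by lra. exact W2. }
      eapply Rle_trans; [|exact W2]. rewrite <- Hu0.
      (* The change of [Re w] is [x2 - x1] times [Re (l * v)] for a single slope [l] in the disc
         around 1. *)
      destruct (cder_MVT_Re u (c x1) (c x2) 1 (fun l => Cmod (l - 1)%C <= M)) as [l [Hl El]].
      * intros t Ht. assert (Hp : (c x1 + t * (c x2 - c x1))%C = c (x1 + t * (x2 - x1))%R).
        { rewrite Hc. unfold c. rewrite RtoC_plus, RtoC_mult. ring. }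
        rewrite Hp. assert (Hy : x1 <= x1 + t * (x2 - x1) <= x2) by nra.
        destruct (Hu _ (Hin _ Hy)) as (U1 & U2 & U3).
        eexists. split; [exact U3|]. apply slope_near_1; assumption.
      * rewrite Hc in El. specialize (Hk l Hl).
        replace (1 * (l * (RtoC (x2 - x1) * v)))%C with (RtoC (x2 - x1) * (l * v))%C in El by ring.
        rewrite !Re_real_mult in El.
        change (Re (u (c x2) - u (c x1))%C) with (Re (u (c x2)) - Re (u (c x1))) in El.
        nra.
Qed.

(** * Lifts of two-parameter families of times *)

Definition cont2 (c : R -> R -> C) : Prop :=
  forall s t, itv 0 1 s -> itv 0 1 t -> forall eta, 0 < eta -> exists d, 0 < d /\
    forall s' t', itv 0 1 s' -> itv 0 1 t' -> Rabs (s' - s) < d -> Rabs (t' - t) < d ->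
      Cmod (c s' t' - c s t)%C < eta.

(** One solution has to serve a full neighbourhood in both parameters; separate lifts of the slices
    do not by themselves give a continuous map into the leaf. *)
Definition lift2 (c w : R -> R -> C) : Prop :=
  forall s t, itv 0 1 s -> itv 0 1 t -> exists (u : C -> C) (e : R),
    0 < e /\ solution u (disc (c s t) e) /\ forall eta, 0 < eta -> exists d, 0 < d /\
    forall s' t', itv 0 1 s' -> itv 0 1 t' -> Rabs (s' - s) < d -> Rabs (t' - t) < d ->
      Cmod (c s' t' - c s t)%C < eta /\ w s' t' = u (c s' t').

Lemma cont2_slice1 c t : itv 0 1 t -> cont2 c -> cont_on (itv 0 1) (fun s => c s t).
Proof.
  intros Ht H s Hs eta Heta. destruct (H s t Hs Ht eta Heta) as [d [Hd H']].
  exists d. split; [exact Hd|]. intros y Hy Hys. apply H'; auto. apply Rabs_minus_self, Hd.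
Qed.

Lemma cont2_slice2 c s : itv 0 1 s -> cont2 c -> cont_on (itv 0 1) (c s).
Proof.
  intros Hs H t Ht eta Heta. destruct (H s t Hs Ht eta Heta) as [d [Hd H']].
  exists d. split; [exact Hd|]. intros y Hy Hyt. apply H'; auto. apply Rabs_minus_self, Hd.
Qed.

Lemma lift2_slice2 c w s : itv 0 1 s -> lift2 c w -> lift (itv 0 1) (c s) (w s).
Proof.
  intros Hs H t Ht. destruct (H s t Hs Ht) as (u & e & He & Hu & K).
  exists u, e. split; [exact He|]. split; [exact Hu|]. intros eta Heta.
  destruct (K eta Heta) as [d [Hd K']]. exists d. split; [exact Hd|].
  intros y Hy Hyt. apply K'; auto. apply Rabs_minus_self, Hd.
Qed.

Lemma lift2_slice1 c w t : itv 0 1 t -> lift2 c w -> lift (itv 0 1) (fun s => c s t) (fun s => w s t).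
Proof.
  intros Ht H s Hs. destruct (H s t Hs Ht) as (u & e & He & Hu & K).
  exists u, e. split; [exact He|]. split; [exact Hu|]. intros eta Heta.
  destruct (K eta Heta) as [d [Hd K']]. exists d. split; [exact Hd|].
  intros y Hy Hyt. apply K'; auto. apply Rabs_minus_self, Hd.
Qed.

Lemma lift_eq_between (I : R -> Prop) (c w1 w2 : R -> C) (x y : R) :
  (forall z, Rmin x y <= z <= Rmax x y -> I z) ->
  lift I c w1 -> lift I c w2 -> w1 x = w2 x -> w1 y = w2 y.
Proof.
  intros hor_int L1 L2 E. destruct (Rle_dec x y) as [H|H].
  - rewrite Rmin_left, Rmax_right in hor_int by lra.
    apply (lift_unique x y c w1 w2); auto; eapply lift_sub; eauto.
  - rewrite Rmin_right, Rmax_left in hor_int by lra.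
    apply (lift_unique y x c w1 w2); auto; try lra; eapply lift_sub; eauto.
Qed.

(* Homotopy lifting: pathwise lifts in s depend continuously on t as soon as the
   initial ones do. *)
Lemma lift2_of_lifts (c w : R -> R -> C) : cont2 c ->
  (forall t, itv 0 1 t -> lift (itv 0 1) (fun s => c s t) (fun s => w s t)) ->
  lift (itv 0 1) (c 0) (w 0) -> lift2 c w.
Proof.
  intros Hc HL H0.
  (* Near [s0] one solution [u] reads the lift over [t0]. If the lift is also good in [t] on a
     single slice [s1] near [s0], then [u] reads that slice near [t0], and uniqueness in the
     direction of [s] spreads this to all slices near [s0]. *)
  assert (Core : forall t0 s0, itv 0 1 t0 -> itv 0 1 s0 -> exists d u e, 0 < d /\ 0 < e /\
    solution u (disc (c s0 t0) e) /\
    forall s1, itv 0 1 s1 -> Rabs (s1 - s0) < d -> lift_at (itv 0 1) (c s1) (w s1) t0 ->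
    exists d3, 0 < d3 /\ forall s t, itv 0 1 s -> itv 0 1 t -> Rabs (s - s0) < d -> Rabs (t - t0) < d3 ->
      disc (c s0 t0) e (c s t) /\ w s t = u (c s t)).
  { intros t0 s0 Ht0 Hs0. destruct (HL t0 Ht0 s0 Hs0) as (u & e & He & Hu & K).
    destruct (K 1 Rlt_0_1) as [d1 [Hd1 K1]].
    destruct (Hc s0 t0 Hs0 Ht0 e He) as [d2 [Hd2 K2]].
    exists (Rmin d1 d2), u, e. split; [apply Rmin_glb_lt; lra|]. split; [exact He|]. split; [exact Hu|].
    intros s1 Hs1 Hd (u1 & e1 & He1 & Hu1 & K3).
    assert (D1 := Rlt_le_trans _ _ _ Hd (Rmin_l _ _)). assert (D2 := Rlt_le_trans _ _ _ Hd (Rmin_r _ _)).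
    assert (Hin : Cmod (c s1 t0 - c s0 t0)%C < e) by (apply K2; auto; apply Rabs_minus_self, Hd2).
    assert (X1 : w s1 t0 = u (c s1 t0)) by (apply K1; auto).
    assert (X2 : w s1 t0 = u1 (c s1 t0)).
    { destruct (K3 1 Rlt_0_1) as [d [Hd0 K']]. apply K'; [exact Ht0 | apply Rabs_minus_self, Hd0]. }
    destruct (solution_unique u u1 (c s1 t0) (e - Cmod (c s1 t0 - c s0 t0)%C) e1) as (e' & He' & Huv); auto.
    { lra. } { eapply solution_sub; [|exact Hu]. apply disc_sub. lra. } { congruence. }
    destruct (K3 e' He') as [d3 [Hd3 K3']].
    exists (Rmin d2 d3). split; [apply Rmin_glb_lt; lra|]. intros s t Hs Ht Hss Htt.
    assert (S1 := Rlt_le_trans _ _ _ Hss (Rmin_l _ _)). assert (S2 := Rlt_le_trans _ _ _ Hss (Rmin_r _ _)).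
    assert (T1 := Rlt_le_trans _ _ _ Htt (Rmin_l _ _)). assert (T2 := Rlt_le_trans _ _ _ Htt (Rmin_r _ _)).
    split; [apply K2; auto|].
    set (J := fun x => itv 0 1 x /\ Rabs (x - s0) < d2).
    apply (lift_eq_between J (fun s => c s t) (fun s => w s t) (fun s => u (c s t)) s1 s).
    - intros z Hz. split.
      + unfold itv in *. split.
        * apply Rle_trans with (Rmin s1 s); [apply Rmin_glb|]; lra.
        * apply Rle_trans with (Rmax s1 s); [lra|]. apply Rmax_lub; lra.
      + apply (between_Rabs (s1 - s0) (s - s0)); auto.
        revert Hz. unfold Rmin, Rmax. do 2 destruct Rle_dec; lra.
    - eapply lift_sub; [|apply HL, Ht]. intros x Hx; apply Hx.
    - apply (lift_solution J _ u (c s0 t0) e Hu).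
      + intros x Hx eta Heta. destruct (cont2_slice1 c t Ht Hc x (proj1 Hx) eta Heta) as [d [Hd0 H']].
        exists d. split; [exact Hd0|]. intros y Hy. apply H', Hy.
      + intros x [Hx1 Hx2]. apply K2; auto.
    - destruct (K3' t Ht T2) as [A1 A2]. rewrite A2. symmetry. apply Huv, A1. }
  (* The hypothesis on the slice [s = 0] starts the induction; [Core] hands goodness at [t0] from
     one slice to its neighbours. *)
  assert (Good : forall t0 s0, itv 0 1 t0 -> itv 0 1 s0 -> lift_at (itv 0 1) (c s0) (w s0) t0).
  { intros t0 s0 Ht0 Hs0.
    apply (real_induction (fun s => lift_at (itv 0 1) (c s) (w s) t0) 0 s0);
      [apply Hs0 | apply H0, Ht0 |].
    intros x Hx. assert (Hx' : itv 0 1 x) by (unfold itv in *; lra).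
    destruct (Core t0 x Ht0 Hx') as (d & u & e & Hd & He & Hu & K).
    exists d. split; [exact Hd|]. intros x1 x2 H1 H2 H3 D1 D2 G1.
    destruct (K x1) as [d3 [Hd3 K']]; auto; [unfold itv in *; lra|].
    assert (Hx2 : itv 0 1 x2) by (unfold itv in *; lra).
    destruct (K' x2 t0 Hx2 Ht0 D2 (Rabs_minus_self t0 d3 Hd3)) as [Hin _]. unfold disc in Hin.
    exists u, (e - Cmod (c x2 t0 - c x t0)%C). split; [lra|]. split.
    - eapply solution_sub; [|exact Hu]. apply disc_sub. lra.
    - intros eta Heta. destruct (cont2_slice2 c x2 Hx2 Hc t0 Ht0 eta Heta) as [d4 [Hd4 K4]].
      exists (Rmin d3 d4). split; [apply Rmin_glb_lt; lra|]. intros y Hy Hyt. split.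
      + apply K4; auto. eapply Rlt_le_trans; [exact Hyt | apply Rmin_r].
      + apply K'; auto. eapply Rlt_le_trans; [exact Hyt | apply Rmin_l]. }
  intros s t Hs Ht. destruct (Core t s Ht Hs) as (d & u & e & Hd & He & Hu & K).
  destruct (K s Hs (Rabs_minus_self s d Hd) (Good t s Ht Hs)) as [d3 [Hd3 K']].
  exists u, e. split; [exact He|]. split; [exact Hu|]. intros eta Heta.
  destruct (Hc s t Hs Ht eta Heta) as [d4 [Hd4 K4]].
  exists (Rmin d4 (Rmin d d3)). split; [repeat apply Rmin_glb_lt; lra|].
  intros s' t' Hs' Ht' Hss Htt.
  pose proof (Rmin_l d4 (Rmin d d3)). pose proof (Rmin_r d4 (Rmin d d3)).
  pose proof (Rmin_l d d3). pose proof (Rmin_r d d3).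
  split; [apply K4 | apply K']; auto; lra.
Qed.

(** * Leaf topology *)

Hypothesis lam_nz : lam <> RtoC 0.

Lemma solution_integral_curve u c e :
  solution u (disc c e) -> integral_curve lam F rho r (fun T => (lam * T, u T)%C) c e.
Proof.
  intros Hu T HT. destruct (Hu T HT) as (H1 & H2 & H3).
  split; [split; assumption|]. split; apply cder_is_derive; simpl.
  - apply (cder_ext (fun T => lam * T + 0)%C); [intros; ring | apply cder_affine].
  - exact H3.
Qed.

(** [fst (phi S) - lam * S] has derivative 0 on a disc. Hence every integral curve is a solution up
    to a translation of time. *)
Lemma integral_curve_fst phi c e T T' : integral_curve lam F rho r phi c e ->
  disc c e T -> disc c e T' -> fst (phi T') = (fst (phi T) + lam * (T' - T))%C.
Proof.
  intros H HT HT'.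
  assert (B : Cmod ((fst (phi T') - (lam * T' + 0)) - (fst (phi T) - (lam * T + 0)))%C <= 0 * Cmod (T' - T)%C).
  { apply (cder_mean_value (fun S => fst (phi S) - (lam * S + 0))%C). intros x Hx.
    assert (Hp : disc c e (T + x * (T' - T))%C).
    { unfold disc in *. eapply Rle_lt_trans.
      - apply (convex_ball_segment c T T' (Rmax (Cmod (T - c)%C) (Cmod (T' - c)%C)));
          [apply Rmax_l | apply Rmax_r | exact Hx].
      - apply Rmax_lub_lt; assumption. }
    destruct (H _ Hp) as (_ & H1 & _). apply cder_is_derive in H1. simpl in H1.
    exists (lam - lam)%C. split; [apply cder_minus; [exact H1 | apply cder_affine]|].
    replace (lam - lam)%C with (RtoC 0) by ring. rewrite Cmod_0. lra. }
  rewrite Rmult_0_l in B. pose proof (Cmod_ge_0 ((fst (phi T') - (lam * T' + 0)) - (fst (phi T) - (lam * T + 0)))%C) as B0.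
  assert (Z := Cmod_eq_0 _ (Rle_antisym _ _ B B0)).
  replace (fst (phi T')) with ((fst (phi T') - (lam * T' + 0)) - (fst (phi T) - (lam * T + 0))
    + (fst (phi T) + lam * (T' - T)))%C by ring.
  rewrite Z. ring.
Qed.

(** An integral curve through a point of the plaque becomes, after a shift of time, a solution with
    the same value there, so it remains on the plaque for a while. Plaques are the open sets by
    which continuity in the leaf topology is exploited. *)
Lemma plaque_open u c e : solution u (disc c e) ->
  leaf_open lam F rho r (fun q => exists T, disc c e T /\ q = (lam * T, u T)%C).
Proof.
  intros Hu phi c0 eps Hphi T HT [S [HS E]].
  set (v := fun S' : C => snd (phi (S' - (S - T))%C)).
  assert (Hv : solution v (disc S (eps - Cmod (T - c0)%C))).
  { intros S' HS'. unfold disc in HS'.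
    assert (HT' : disc c0 eps (S' - (S - T))%C).
    { unfold disc. pose proof (Cmod_sub_triangle (S' - (S - T))%C T c0) as K.
      replace (S' - (S - T) - T)%C with (S' - S)%C in K by ring. lra. }
    assert (E1 : fst (phi (S' - (S - T))%C) = (lam * S')%C).
    { rewrite (integral_curve_fst phi c0 eps T _ Hphi HT HT'), E. simpl. ring. }
    destruct (Hphi _ HT') as ([U1 U2] & _ & U3). rewrite E1 in U1. apply cder_is_derive in U3.
    unfold pullback_field in U3. simpl in U3. rewrite E1 in U3.
    repeat split; [exact U1 | exact U2 |]. apply (cder_shift (fun S => snd (phi S))). exact U3. }
  assert (Euv : v S = u S).
  { unfold v. replace (S - (S - T))%C with T by ring. rewrite E. reflexivity. }
  unfold disc in HS.
  destruct (solution_unique v u S (eps - Cmod (T - c0)%C) (e - Cmod (S - c)%C)) as (e' & He' & Huv);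
    auto; try lra.
  { eapply solution_sub; [|exact Hu]. apply disc_sub. lra. }
  exists (Rmin e' (e - Cmod (S - c)%C)). split; [apply Rmin_glb_lt; lra|].
  intros T' H1 H2.
  assert (D1 := Rlt_le_trans _ _ _ H1 (Rmin_l _ _)). assert (D2 := Rlt_le_trans _ _ _ H1 (Rmin_r _ _)).
  exists (S + (T' - T))%C. split.
  - apply (disc_sub c S e (e - Cmod (S - c)%C)); [lra|]. unfold disc.
    replace (S + (T' - T) - S)%C with (T' - T)%C by ring. exact D2.
  - rewrite <- Huv.
    2: { unfold disc. replace (S + (T' - T) - S)%C with (T' - T)%C by ring. exact D1. }
    unfold v. replace (S + (T' - T) - (S - T))%C with T' by ring.
    apply injective_projections; [|reflexivity]. simpl.
    rewrite (integral_curve_fst phi c0 eps T T' Hphi HT H2), E. simpl. ring.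
Qed.

(** Membership in a plaque over a disc of radius [Rmin eta s] yields at once that times are close
    and that [w] is read from [u]. *)
Lemma leaf_cont1_lift g : leaf_cont1 lam F rho r g ->
  (forall t, 0 <= t <= 1 -> Utilde rho r (g t)) ->
  lift (itv 0 1) (fun t => fst (g t) / lam)%C (fun t => snd (g t)).
Proof.
  intros Hg HU t Ht. destruct (HU t Ht) as [U1 U2].
  set (d := Rmin (ln rho - Re (fst (g t))) (ln r - Re (snd (g t)))).
  assert (Hd : 0 < d) by (apply Rmin_glb_lt; lra).
  destruct (solution_exists d Hd) as [s [Hs Hpic]].
  assert (El : (lam * (fst (g t) / lam))%C = fst (g t)) by (field; exact lam_nz).
  destruct (Hpic (fst (g t) / lam)%C (snd (g t))) as (u & Hu0 & Hu).
  { rewrite El. pose proof (Rmin_l (ln rho - Re (fst (g t))) (ln r - Re (snd (g t)))). fold d in H. lra. }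
  { pose proof (Rmin_r (ln rho - Re (fst (g t))) (ln r - Re (snd (g t)))). fold d in H. lra. }
  exists u, s. split; [exact Hs|]. split; [exact Hu|]. intros eta Heta.
  assert (He : 0 < Rmin eta s) by (apply Rmin_glb_lt; lra).
  assert (Hu' : solution u (disc (fst (g t) / lam)%C (Rmin eta s))).
  { eapply solution_sub; [|exact Hu]. intros T HT. eapply Rlt_le_trans; [exact HT | apply Rmin_r]. }
  destruct (Hg t Ht _ (plaque_open _ _ _ Hu')) as [d' [Hd' K]].
  { exists (fst (g t) / lam)%C. split; [apply disc_center, He|].
    apply injective_projections; simpl; symmetry; assumption. }
  exists d'. split; [exact Hd'|]. intros y Hy Hyt. destruct (K y Hy Hyt) as [T [HT ET]].
  rewrite ET. simpl. replace (lam * T / lam)%C with T by (field; exact lam_nz).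
  split; [|reflexivity]. eapply Rlt_le_trans; [exact HT | apply Rmin_l].
Qed.

Definition to_leaf (c w : R -> R -> C) (s t : R) : C2 := (lam * c s t, w s t)%C.

Lemma lift2_leaf_cont2 c w : lift2 c w -> leaf_cont2 lam F rho r (to_leaf c w).
Proof.
  intros H s t Hs Ht O HO Hin. destruct (H s t Hs Ht) as (u & e & He & Hu & K).
  assert (E : to_leaf c w s t = (lam * c s t, u (c s t))%C).
  { destruct (K 1 Rlt_0_1) as [d [Hd K']]. unfold to_leaf. f_equal.
    apply K'; auto; apply Rabs_minus_self, Hd. }
  rewrite E in Hin.
  destruct (HO _ _ _ (solution_integral_curve u _ e Hu) (c s t) (disc_center _ _ He) Hin) as [d [Hd HO']].
  destruct (K (Rmin d e)) as [d' [Hd' K']]; [apply Rmin_glb_lt; lra|].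
  exists d'. split; [exact Hd'|]. intros s' t' Hs' Ht' Hss Htt.
  destruct (K' s' t' Hs' Ht' Hss Htt) as [A1 A2]. unfold to_leaf. rewrite A2.
  apply HO'.
  - eapply Rlt_le_trans; [exact A1 | apply Rmin_l].
  - eapply Rlt_le_trans; [exact A1 | apply Rmin_r].
Qed.

Lemma lift_same_leaf p c w a b : a <= b -> lift (itv a b) c w ->
  same_leaf lam F rho r p (lam * c a, w a)%C -> same_leaf lam F rho r p (lam * c b, w b)%C.
Proof.
  intros Hab HL H0.
  apply (real_induction (fun x => same_leaf lam F rho r p (lam * c x, w x)%C) a b Hab H0).
  intros x Hx. destruct (HL x Hx) as (u & e & He & Hu & K). destruct (K e He) as [d [Hd K']].
  exists d. split; [exact Hd|]. intros x1 x2 H1 H2 H3 D1 D2 Hl.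
  destruct (K' x1 (conj H1 (Rle_trans _ _ _ H2 H3)) D1) as [A1 A2].
  destruct (K' x2 (conj (Rle_trans _ _ _ H1 H2) H3) D2) as [B1 B2].
  rewrite B2. rewrite A2 in Hl.
  exact (same_leaf_step lam F rho r p _ _ (c x) e (c x1) (c x2) Hl He
    (solution_integral_curve u _ e Hu) A1 B1 eq_refl).
Qed.

Lemma same_leaf_Utilde p q : same_leaf lam F rho r p q -> Utilde rho r q.
Proof.
  intros [H | q' phi c e T1 T2 _ _ Hphi _ HT2 _]; [exact H|]. apply (Hphi T2 HT2).
Qed.

(** Compactness of the path. A single [m] serves as margin and as inverse bound on times, so the
    condition survives shrinking [m] and finitely many local values are merged by a minimum. *)
Lemma lift_slack c w : lift (itv 0 1) c w -> exists m, 0 < m /\ forall t, itv 0 1 t ->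
  Re (lam * c t)%C <= ln rho - m /\ Re (w t) <= ln r - m /\ Cmod (c t) <= / m.
Proof.
  intros HL. pose proof (Cmod_ge_0 lam) as Hl.
  set (P := fun m t => Re (lam * c t)%C <= ln rho - m /\ Re (w t) <= ln r - m /\ Cmod (c t) <= / m).
  assert (Mono : forall m m' t, 0 < m' -> m' <= m -> P m t -> P m' t).
  { intros m m' t H1 H2 (K1 & K2 & K3). repeat split; try lra.
    eapply Rle_trans; [exact K3|]. apply Rinv_le_contravar; assumption. }
  assert (Loc : forall x, itv 0 1 x -> exists m d, 0 < m /\ 0 < d /\
    forall y, itv 0 1 y -> Rabs (y - x) < d -> P m y).
  { intros x Hx. destruct (HL x Hx) as (u & e & He & Hu & K).
    destruct (Hu _ (disc_center _ _ He)) as (U1 & U2 & U3).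
    set (m1 := Rmin (ln rho - Re (lam * c x)%C) (ln r - Re (u (c x))) / 2).
    assert (Hm1 : 0 < m1) by (apply Rdiv_lt_0_compat; [apply Rmin_glb_lt; lra | lra]).
    assert (G1 : Re (lam * c x)%C <= ln rho - 2 * m1).
    { unfold m1. pose proof (Rmin_l (ln rho - Re (lam * c x)%C) (ln r - Re (u (c x)))). lra. }
    assert (G2 : Re (u (c x)) <= ln r - 2 * m1).
    { unfold m1. pose proof (Rmin_r (ln rho - Re (lam * c x)%C) (ln r - Re (u (c x)))). lra. }
    clearbody m1.
    destruct (cder_ccont _ _ _ U3 m1 Hm1) as [q [Hq Cq]].
    set (eta := Rmin 1 (Rmin q (m1 / (Cmod lam + 1)))).
    assert (Heta : 0 < eta) by (repeat apply Rmin_glb_lt; try lra; apply Rdiv_lt_0_compat; lra).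
    destruct (K eta Heta) as [d [Hd K']].
    exists (Rmin m1 (/ (Cmod (c x) + 1))), d.
    pose proof (Cmod_ge_0 (c x)) as Hcx.
    assert (Hi : 0 < / (Cmod (c x) + 1)) by (apply Rinv_0_lt_compat; lra).
    split; [apply Rmin_glb_lt; lra|]. split; [exact Hd|].
    intros y Hy Hyx. destruct (K' y Hy Hyx) as [A1 A2].
    assert (B1 : Cmod (c y - c x)%C < 1) by (eapply Rlt_le_trans; [exact A1 | apply Rmin_l]).
    assert (B2 : Cmod (c y - c x)%C < q).
    { eapply Rlt_le_trans; [exact A1 | eapply Rle_trans; [apply Rmin_r | apply Rmin_l]]. }
    assert (B3 : Cmod (c y - c x)%C < m1 / (Cmod lam + 1)).
    { eapply Rlt_le_trans; [exact A1 | eapply Rle_trans; [apply Rmin_r | apply Rmin_r]]. }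
    pose proof (Rmin_l m1 (/ (Cmod (c x) + 1))). pose proof (Rmin_r m1 (/ (Cmod (c x) + 1))).
    repeat split.
    - pose proof (Re_le_add (lam * c x)%C (lam * c y)%C) as T.
      replace (lam * c y - lam * c x)%C with (lam * (c y - c x))%C in T by ring.
      rewrite Cmod_mult in T.
      apply (Rmult_lt_compat_r (Cmod lam + 1)) in B3; [|lra].
      unfold Rdiv in B3. rewrite Rmult_assoc, Rinv_l in B3 by lra.
      pose proof (Cmod_ge_0 (c y - c x)%C). nra.
    - rewrite A2. specialize (Cq _ B2). rewrite Cplus_sub_cancel in Cq.
      pose proof (Re_le_add (u (c x)) (u (c y))). lra.
    - apply Rle_trans with (Cmod (c x) + 1).
      + pose proof (Cmod_triangle (c x) (c y - c x)%C) as T. rewrite Cplus_sub_cancel in T. lra.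
      + apply Rle_trans with (/ / (Cmod (c x) + 1)); [rewrite Rinv_inv; lra|].
        apply Rinv_le_contravar; [apply Rmin_glb_lt|]; lra. }
  cut (exists m, 0 < m /\ forall t, itv 0 1 t -> P m t); [auto|].
  assert (R1 : exists m, 0 < m /\ forall t, 0 <= t <= 1 -> P m t).
  { apply (real_induction (fun x => exists m, 0 < m /\ forall t, 0 <= t <= x -> P m t) 0 1); [lra | |].
    - destruct (Loc 0) as (m & d & Hm & Hd & K); [unfold itv; lra|].
      exists m. split; [exact Hm|]. intros t Ht. apply K; [unfold itv; lra|].
      replace t with 0 by lra. apply Rabs_minus_self, Hd.
    - intros x Hx. destruct (Loc x Hx) as (m & d & Hm & Hd & K). exists d. split; [exact Hd|].
      intros x1 x2 H1 H2 H3 D1 D2 (m' & Hm' & K').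
      assert (Hmin : 0 < Rmin m m') by (apply Rmin_glb_lt; lra).
      exists (Rmin m m'). split; [exact Hmin|]. intros t Ht. destruct (Rle_dec t x1).
      + apply (Mono m'); [exact Hmin | apply Rmin_r | apply K'; lra].
      + apply (Mono m); [exact Hmin | apply Rmin_l |]. apply K; [unfold itv; lra|].
        apply Rabs_def2 in D1, D2. apply Rabs_def1; lra. }
  exact R1.
Qed.

(** * Straight-line homotopies of times *)

Lemma linear_homotopy_cont2 (c e : R -> C) : cont_on (itv 0 1) c -> cont_on (itv 0 1) e ->
  cont2 (fun s t => c t + RtoC s * (e t - c t))%C.
Proof.
  intros Hc He s t Hs Ht eta Heta. pose proof (Cmod_ge_0 (e t - c t)%C) as Hn.
  destruct (Hc t Ht (eta / 4)) as [d1 [Hd1 K1]]; [lra|].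
  destruct (He t Ht (eta / 4)) as [d2 [Hd2 K2]]; [lra|].
  set (d3 := eta / (4 * (Cmod (e t - c t)%C + 1))).
  assert (Hd3 : 0 < d3) by (apply Rdiv_lt_0_compat; lra).
  assert (E3 : d3 * (Cmod (e t - c t)%C + 1) = eta / 4) by (unfold d3; field; lra).
  clearbody d3.
  exists (Rmin d1 (Rmin d2 d3)). split; [repeat apply Rmin_glb_lt; lra|].
  intros s' t' Hs' Ht' Hss Htt.
  pose proof (Rmin_l d1 (Rmin d2 d3)). pose proof (Rmin_r d1 (Rmin d2 d3)).
  pose proof (Rmin_l d2 d3). pose proof (Rmin_r d2 d3).
  specialize (K1 t' Ht' ltac:(lra)). specialize (K2 t' Ht' ltac:(lra)).
  replace (c t' + s' * (e t' - c t') - (c t + s * (e t - c t)))%C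
    with (RtoC (1 - s') * (c t' - c t) + (RtoC s' * (e t' - e t) + RtoC (s' - s) * (e t - c t)))%C
    by (rewrite !RtoC_minus; ring).
  eapply Rle_lt_trans; [apply Cmod_triangle|].
  eapply Rle_lt_trans; [apply Rplus_le_compat_l, Cmod_triangle|].
  unfold itv in Hs'. rewrite !Cmod_mult, !Cmod_R, (Rabs_right (1 - s')), (Rabs_right s') by lra.
  pose proof (Cmod_ge_0 (c t' - c t)%C). pose proof (Cmod_ge_0 (e t' - e t)%C).
  pose proof (Rabs_pos (s' - s)).
  assert (Rabs (s' - s) * Cmod (e t - c t)%C <= eta / 4) by nra. nra.
Qed.

(** A homotopy in the leaf is reduced to lifting each straight segment of times on its own. The
    loops stay closed because the lifts over [t = 0] and [t = 1] follow the same segment from the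
    same point; the final lift [w'] is returned so that another homotopy can start from it. *)
Lemma linear_homotopy (p : C2) (c e w : R -> C) :
  lift (itv 0 1) c w -> cont_on (itv 0 1) e ->
  c 0 = c 1 -> w 0 = w 1 -> e 0 = e 1 ->
  (forall t, itv 0 1 t -> same_leaf lam F rho r p (lam * c t, w t)%C) ->
  (forall t, itv 0 1 t -> exists v, v 0 = w t /\ lift (itv 0 1) (fun s => c t + RtoC s * (e t - c t))%C v) ->
  exists (H : R -> R -> C2) (w' : R -> C), leaf_cont2 lam F rho r H /\
    (forall s t, itv 0 1 s -> itv 0 1 t -> same_leaf lam F rho r p (H s t)) /\
    (forall t, itv 0 1 t -> H 0 t = (lam * c t, w t)%C) /\
    (forall t, itv 0 1 t -> H 1 t = (lam * e t, w' t)%C) /\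
    (forall s, itv 0 1 s -> H s 0 = H s 1) /\ lift (itv 0 1) e w'.
Proof.
  intros Hw He Ec Ew Ee Hp Hex.
  set (h := fun s t => (c t + RtoC s * (e t - c t))%C).
  destruct (choice_fun (fun (t : R) (v : R -> C) => itv 0 1 t -> v 0 = w t /\ lift (itv 0 1) (fun s => h s t) v)) as [V HV].
  { intros t. destruct (classic (itv 0 1 t)) as [Ht|Ht].
    - destruct (Hex t Ht) as [v Hv]. exists v. auto.
    - exists (fun _ => RtoC 0). tauto. }
  set (W := fun s t => V t s).
  assert (I0 : itv 0 1 0) by (unfold itv; lra). assert (I1 : itv 0 1 1) by (unfold itv; lra).
  assert (L2 : lift2 h W).
  { apply lift2_of_lifts.
    - apply linear_homotopy_cont2; [eapply lift_cont; exact Hw | exact He].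
    - intros t Ht. apply (HV t Ht).
    - apply (lift_ext _ c _ w _); [| |exact Hw].
      + intros x Hx. unfold h. ring.
      + intros x Hx. symmetry. apply (HV x Hx). }
  exists (to_leaf h W), (W 1). split; [apply lift2_leaf_cont2, L2|].
  split; [|split; [|split; [|split]]].
  - intros s t Hs Ht. unfold to_leaf.
    apply (lift_same_leaf p (fun s => h s t) (fun s => W s t) 0 s (proj1 Hs)).
    + eapply lift_sub; [|apply (lift2_slice1 h W t Ht L2)]. unfold itv in *. intros x Hx. lra.
    + simpl. replace (h 0 t) with (c t) by (unfold h; ring). unfold W. destruct (HV t Ht) as [-> _].
      apply Hp, Ht.
  - intros t Ht. unfold to_leaf. replace (h 0 t) with (c t) by (unfold h; ring).
    unfold W. destruct (HV t Ht) as [-> _]. reflexivity.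
  - intros t Ht. unfold to_leaf. replace (h 1 t) with (e t) by (unfold h; ring). reflexivity.
  - intros s Hs. unfold to_leaf.
    assert (Eh : forall x, h x 0 = h x 1) by (intros x; unfold h; rewrite Ec, Ee; reflexivity).
    rewrite Eh. f_equal.
    apply (lift_eq_between (itv 0 1) (fun s => h s 0) (fun s => W s 0) (fun s => W s 1) 0 s).
    + intros z Hz. unfold itv in *. rewrite Rmin_left, Rmax_right in Hz by lra. lra.
    + apply lift2_slice1; assumption.
    + apply (lift_ext _ (fun s => h s 1) _ (fun s => W s 1) _); [intros; symmetry; apply Eh | reflexivity |].
      apply lift2_slice1; assumption.
    + unfold W. destruct (HV 0 I0) as [-> _]. destruct (HV 1 I1) as [-> _]. exact Ew.
  - apply (lift_ext _ (h 1) _ (W 1) _); [intros x _; unfold h; ring | reflexivity |].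
    apply lift2_slice2; assumption.
Qed.

(** The lift is compared with the constant one through its initial point: fibres of the leaf over
    the time plane are discrete. *)
Lemma lift_const_path (e w : R -> C) (t : R) : (forall t, itv 0 1 t -> e t = e 0) ->
  lift (itv 0 1) e w -> itv 0 1 t -> w t = w 0.
Proof.
  intros He Hw Ht. assert (I0 : itv 0 1 0) by (unfold itv; lra).
  symmetry. apply (lift_eq_between (itv 0 1) e (fun _ => w 0) w 0 t); auto.
  - intros z Hz. unfold itv in *. rewrite Rmin_left, Rmax_right in Hz by lra. lra.
  - apply (lift_ext _ (fun _ => e 0) _ (fun _ => w 0) _).
    + intros x Hx. symmetry. apply He, Hx.
    + reflexivity.
    + apply (lift_comp (itv 0 1) (itv 0 1) e w (fun _ => 0)); auto.
      intros x _ eta Heta. exists 1. split; [lra|]. intros y _ _. apply Rabs_minus_self, Heta.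
Qed.

Lemma line_lift (c0 d : C) (v : R -> R) (w : R -> C) : v 0 = 0 ->
  lift (itv 0 1) (fun t => c0 + RtoC (v t) * d)%C w ->
  forall t, itv 0 1 t -> exists a b o, a <= 0 <= b /\ a <= v t <= b /\
    lift (itv a b) (fun y => c0 + RtoC y * d)%C o /\ o (v t) = w t.
Proof.
  intros Hv0 Hw t Ht. set (l := fun y : R => (c0 + RtoC y * d)%C) in *.
  apply (real_induction (fun t => exists a b o, a <= 0 <= b /\ a <= v t <= b /\
    lift (itv a b) l o /\ o (v t) = w t) 0 t); [apply Ht | |].
  - exists 0, 0, (fun _ => w 0). rewrite Hv0. repeat split; try lra.
    destruct (Hw 0) as (u & e & He & Hu & K); [unfold itv; lra|]. rewrite Hv0 in Hu.
    assert (E : w 0 = u (l 0)).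
    { destruct (K 1 Rlt_0_1) as [q [Hq K']].
      destruct (K' 0) as [_ E]; [unfold itv; lra | apply Rabs_minus_self, Hq |]. rewrite Hv0 in E. exact E. }
    apply (lift_ext _ l _ (fun y => u (l y)) _); [reflexivity | |].
    + intros x Hx. unfold itv in Hx. replace x with 0 by lra. symmetry. exact E.
    + apply (lift_solution _ l u (l 0) e Hu); [apply affine_cont|].
      intros x Hx. unfold itv in Hx. replace x with 0 by lra. apply disc_center, He.
  - intros x Hx. destruct (Hw x) as (u & e & He & Hu & K); [unfold itv in *; lra|].
    destruct (K e He) as [q [Hq K']]. exists q. split; [exact Hq|].
    intros x1 x2 H1 H2 H3 D1 D2 (a & b & o & A0 & A1 & A2 & A3).
    destruct (K' x1) as [P1 P2]; [unfold itv in *; lra | exact D1 |].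
    destruct (K' x2) as [Q1 Q2]; [unfold itv in *; lra | exact D2 |].
    fold (l (v x1)) in P1, P2. fold (l (v x2)) in Q1, Q2. fold (l (v x)) in P1, Q1, Hu.
    assert (Hin : forall y, Rmin (v x1) (v x2) <= y <= Rmax (v x1) (v x2) -> disc (l (v x)) e (l y)).
    { intros y Hy. unfold disc, l in *.
      replace (c0 + y * d - (c0 + v x * d))%C with (RtoC (y - v x) * d)%C by (rewrite RtoC_minus; ring).
      replace (c0 + v x1 * d - (c0 + v x * d))%C with (RtoC (v x1 - v x) * d)%C in P1 by (rewrite RtoC_minus; ring).
      replace (c0 + v x2 * d - (c0 + v x * d))%C with (RtoC (v x2 - v x) * d)%C in Q1 by (rewrite RtoC_minus; ring).
      rewrite Cmod_mult, Cmod_R in *. pose proof (Cmod_ge_0 d).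
      assert (Rabs (y - v x) <= Rmax (Rabs (v x1 - v x)) (Rabs (v x2 - v x))).
      { revert Hy. unfold Rmin, Rmax, Rabs. repeat destruct Rle_dec; repeat destruct Rcase_abs; lra. }
      apply Rle_lt_trans with (Rmax (Rabs (v x1 - v x)) (Rabs (v x2 - v x)) * Cmod d).
      - apply Rmult_le_compat_r; assumption.
      - unfold Rmax. destruct Rle_dec; assumption. }
    assert (Lu : lift (fun y => Rmin (v x1) (v x2) <= y <= Rmax (v x1) (v x2)) l (fun y => u (l y))).
    { apply (lift_solution _ l u (l (v x)) e Hu); [apply affine_cont | exact Hin]. }
    assert (Agree : forall y, Rmin (v x1) (v x2) <= y <= Rmax (v x1) (v x2) -> a <= y <= b -> o y = u (l y)).
    { intros y Hy Hab.
      apply (lift_eq_between (fun z => (Rmin (v x1) (v x2) <= z <= Rmax (v x1) (v x2)) /\ a <= z <= b) l o (fun z => u (l z)) (v x1) y).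
      - intros z Hz. revert Hy Hz. unfold Rmin, Rmax. repeat destruct Rle_dec; lra.
      - eapply lift_sub; [|exact A2]. intros z Hz; apply Hz.
      - eapply lift_sub; [|exact Lu]. intros z Hz; apply Hz.
      - rewrite A3. exact P2. }
    assert (Em : Rmin (v x1) (v x2) <= v x2 <= Rmax (v x1) (v x2)) by (split; [apply Rmin_r | apply Rmax_r]).
    (* Either [v x2] lies in the old interval, or the interval is prolonged by [u] to the left or to
       the right. *)
    destruct (Rle_dec (v x2) b) as [Hb|Hb]; [destruct (Rle_dec a (v x2)) as [Ha|Ha]|].
    + exists a, b, o. repeat split; try lra; auto. rewrite Agree by (auto; lra). symmetry. exact Q2.
    + exists (v x2), b, (fun y => if Rle_dec y a then u (l y) else o y).
      rewrite Rmin_right, Rmax_left in * by lra.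
      repeat split; try lra.
      * apply lift_glue; try lra; auto.
        -- eapply lift_sub; [|exact Lu]. unfold itv. intros z Hz. lra.
        -- symmetry. apply Agree; lra.
      * destruct (Rle_dec (v x2) a); [symmetry; exact Q2 | lra].
    + exists a, (v x2), (fun y => if Rle_dec y b then o y else u (l y)).
      rewrite Rmin_left, Rmax_right in * by lra.
      repeat split; try lra.
      * apply lift_glue; try lra; auto.
        -- eapply lift_sub; [|exact Lu]. unfold itv. intros z Hz. lra.
        -- apply Agree; lra.
      * destruct (Rle_dec (v x2) b); [lra | symmetry; exact Q2].
Qed.

(** * Contracting loops according to the sign of [Re lam] *)

Lemma slope_Re_bounds (k : C) : Cmod (k - 1)%C <= M -> 1 - M <= Re k /\ Cmod k <= 2.
Proof.
  intros H. split.
  - pose proof (re_le_Cmod (k - 1)%C) as B. apply Rabs_le_between in B.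
    change (Re (k - 1)%C) with (Re k - 1) in B. lra.
  - replace k with (k - 1 + 1)%C by ring. eapply Rle_trans; [apply Cmod_triangle|]. rewrite Cmod_1. lra.
Qed.

(** The base point may travel along [H s 0]; only closedness of each loop is demanded. *)
Definition free_contraction (p : C2) (g : R -> C2) (H : R -> R -> C2) : Prop :=
  leaf_cont2 lam F rho r H /\
  (forall s t, itv 0 1 s -> itv 0 1 t -> same_leaf lam F rho r p (H s t)) /\
  (forall t, itv 0 1 t -> H 0 t = g t) /\ (forall s, itv 0 1 s -> H s 0 = H s 1) /\
  (forall t, itv 0 1 t -> H 1 t = H 1 0).

(* 4 / (m (1 - M)) makes S (1 - M) exceed |k| |c 0 - c t|, so the segments to
   c 0 - S do not increase Re w. *)
Lemma contraction_Re_lam_nonneg (p : C2) (c w : R -> C) : 0 <= Re lam ->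
  lift (itv 0 1) c w -> c 0 = c 1 -> w 0 = w 1 ->
  (forall t, itv 0 1 t -> same_leaf lam F rho r p (lam * c t, w t)%C) ->
  exists H, free_contraction p (fun t => (lam * c t, w t)%C) H.
Proof.
  intros Hlam Hw Ec Ew Hp. destruct (lift_slack c w Hw) as [m [Hm Hs]].
  set (S := 4 / (m * (1 - M))).
  assert (HmM : 0 < m * (1 - M)) by (apply Rmult_lt_0_compat; lra).
  assert (HS : 0 < S) by (apply Rdiv_lt_0_compat; lra).
  assert (ES : S * (1 - M) = 4 * / m) by (unfold S; field; lra). clearbody S.
  assert (I0 : itv 0 1 0) by (unfold itv; lra).
  destruct (linear_homotopy p c (fun _ => c 0 - RtoC S)%C w) as (H & w' & H1 & H2 & H3 & H4 & H5 & H6); auto.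
  - intros x _ eta Heta. exists 1. split; [lra|]. intros y _ _.
    replace (c 0 - S - (c 0 - S))%C with (RtoC 0) by ring. rewrite Cmod_0. exact Heta.
  - intros t Ht. destruct (Hs t Ht) as (S1 & S2 & S3). destruct (Hs 0 I0) as (Z1 & Z2 & Z3).
    apply (lift_linear m); [exact Hm | | exact S2 |].
    + intros x Hx. replace (lam * (c t + x * (c 0 - S - c t)))%C
        with (lam * c t + RtoC x * (lam * (c 0 - S) - lam * c t))%C by ring.
      apply Re_convex_le; auto.
      (* Here the sign of [Re lam] enters: going back by [S] does not increase [Re z], so the far
         endpoint has margin [m], and by convexity so does the segment. *)
      assert (E : Re (lam * (c 0 - S))%C = Re (lam * c 0)%C - S * Re lam).
      { destruct lam, (c 0). simpl. ring. }
      rewrite E. nra.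
    + intros k Hk. destruct (slope_Re_bounds k Hk) as [K1 K2].
      assert (E : Re (k * (c 0 - S - c t))%C = Re (k * (c 0 - c t))%C - S * Re k).
      { destruct k, (c 0), (c t). simpl. ring. }
      rewrite E. pose proof (re_le_Cmod (k * (c 0 - c t))%C) as B. apply Rabs_le_between in B.
      rewrite Cmod_mult in B. pose proof (Cmod_minus_le (c 0) (c t)). pose proof (Cmod_ge_0 (c 0 - c t)%C).
      pose proof (Cmod_ge_0 k).
      assert (Cmod k * Cmod (c 0 - c t)%C <= 2 * (2 * / m)) by (apply Rmult_le_compat; lra).
      assert (S * (1 - M) <= S * Re k) by (apply Rmult_le_compat_l; lra). lra.
  - exists H. repeat split; auto. intros t Ht. rewrite (H4 t Ht), (H4 0 I0). f_equal.
    apply (lift_const_path (fun _ => c 0 - RtoC S)%C); auto.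
Qed.

Lemma contraction_Re_lam_neg (p : C2) (c w : R -> C) : Re lam < 0 ->
  lift (itv 0 1) c w -> c 0 = c 1 -> w 0 = w 1 ->
  (forall t, itv 0 1 t -> same_leaf lam F rho r p (lam * c t, w t)%C) ->
  exists H1 H2, leaf_cont2 lam F rho r H1 /\
    (forall s t, itv 0 1 s -> itv 0 1 t -> same_leaf lam F rho r p (H1 s t)) /\
    (forall t, itv 0 1 t -> H1 0 t = (lam * c t, w t)%C) /\
    (forall s, itv 0 1 s -> H1 s 0 = H1 s 1) /\
    free_contraction p (H1 1) H2.
Proof.
  intros Hlam Hw Ec Ew Hp. destruct (lift_slack c w Hw) as [m [Hm Hs]].
  assert (I0 : itv 0 1 0) by (unfold itv; lra). assert (I1 : itv 0 1 1) by (unfold itv; lra).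
  (* [q t] is the time needed in direction -1 to raise [Re z] to [ln rho - m] at the rate
     [- Re lam]. It is nonnegative because the loop has margin [m]. *)
  set (q := fun t => (ln rho - m - Re (lam * c t)%C) / (- Re lam)).
  assert (Hq : forall t, q t * (- Re lam) = ln rho - m - Re (lam * c t)%C) by (intros t; unfold q; field; lra).
  assert (Hq0 : forall t, itv 0 1 t -> 0 <= q t).
  { intros t Ht. destruct (Hs t Ht) as (S1 & _). unfold q.
    apply Rmult_le_pos; [lra|]. left. apply Rinv_0_lt_compat. lra. }
  set (e := fun t => (c t - RtoC (q t))%C).
  assert (HeRe : forall t, Re (lam * e t)%C = ln rho - m).
  { intros t. transitivity (Re (lam * c t)%C + q t * (- Re lam)); [|rewrite Hq; ring].
    unfold e. destruct lam, (c t). simpl. ring. }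
  assert (Hcont : cont_on (itv 0 1) e).
  { intros x Hx eta Heta. pose proof (Cmod_ge_0 lam) as Hl.
    (* [q] is a Lipschitz function of the time [c t] with constant [Cmod lam / (- Re lam)], and the
       1 accounts for [c] itself. *)
    set (n := 1 + Cmod lam / (- Re lam)).
    assert (Hn : 1 <= n).
    { unfold n. assert (0 <= Cmod lam / (- Re lam)); [|lra].
      apply Rmult_le_pos; [lra|]. left. apply Rinv_0_lt_compat. lra. }
    destruct (lift_cont _ _ _ Hw x Hx (eta / n)) as [d [Hd K]]; [apply Rdiv_lt_0_compat; lra|].
    exists d. split; [exact Hd|]. intros y Hy Hyx. specialize (K y Hy Hyx).
    unfold e. replace (c y - q y - (c x - q x))%C with ((c y - c x) - RtoC (q y - q x))%C by (rewrite RtoC_minus; ring).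
    eapply Rle_lt_trans; [apply Cmod_minus_le|]. rewrite Cmod_R.
    assert (Eq : q y - q x = - Re (lam * (c y - c x))%C / (- Re lam)).
    { unfold q. replace (lam * (c y - c x))%C with (lam * c y - lam * c x)%C by ring.
      change (Re (lam * c y - lam * c x)%C) with (Re (lam * c y)%C - Re (lam * c x)%C). field. lra. }
    rewrite Eq. unfold Rdiv at 1. rewrite Rabs_mult, Rabs_Ropp, (Rabs_right (/ - Re lam)).
    2: { apply Rle_ge. left. apply Rinv_0_lt_compat. lra. }
    pose proof (re_le_Cmod (lam * (c y - c x))%C) as B. rewrite Cmod_mult in B.
    assert (0 < / - Re lam) by (apply Rinv_0_lt_compat; lra).
    apply Rle_lt_trans with (n * Cmod (c y - c x)%C).
    - unfold n, Rdiv. nra.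
    - apply (Rmult_lt_compat_r n) in K; [|lra]. unfold Rdiv in K.
      rewrite Rmult_assoc, Rinv_l in K by lra. lra. }
  assert (Ee : e 0 = e 1) by (unfold e, q; rewrite Ec; reflexivity).
  destruct (linear_homotopy p c e w) as (H & w' & H1 & H2 & H3 & H4 & H5 & H6); auto.
  { intros t Ht. destruct (Hs t Ht) as (S1 & S2 & S3).
    apply (lift_linear m); [exact Hm | | exact S2 |].
    - intros x Hx. replace (lam * (c t + x * (e t - c t)))%C
        with (lam * c t + RtoC x * (lam * e t - lam * c t))%C by ring.
      apply Re_convex_le; auto. rewrite HeRe. lra.
    - intros k Hk. destruct (slope_Re_bounds k Hk) as [K1 _].
      replace (k * (e t - c t))%C with (RtoC (- q t) * k)%C by (unfold e; rewrite RtoC_opp; ring).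
      rewrite Re_real_mult. specialize (Hq0 t Ht). nra. }
  (* Along [d] the coordinate [z = lam * T] moves vertically, so the level line of [Re z] is
     [e 0 + RtoC y * d], with [y] the height of [z] above its starting value. *)
  set (d := (Ci / lam)%C). set (v := fun t => Im (lam * (e t - e 0))%C).
  assert (Eline : forall t, e t = (e 0 + RtoC (v t) * d)%C).
  { intros t. assert (E : (lam * (e t - e 0))%C = (Ci * RtoC (v t))%C).
    { apply injective_projections; [|unfold v, Im; simpl; ring].
      transitivity (Re (lam * e t)%C - Re (lam * e 0)%C); [unfold Re; simpl; ring|].
      rewrite !HeRe. simpl. ring. }
    unfold d. transitivity (e 0 + (lam * (e t - e 0)) / lam)%C; [field; exact lam_nz|].
    rewrite E. field. exact lam_nz. }
  assert (Hv0 : v 0 = 0).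
  { unfold v. replace (lam * (e 0 - e 0))%C with (RtoC 0) by ring. reflexivity. }
  assert (Ew' : w' 0 = w' 1).
  { specialize (H5 1 I1). rewrite (H4 0 I0), (H4 1 I1) in H5. apply (f_equal snd) in H5. exact H5. }
  destruct (linear_homotopy p e (fun _ => e 0) w') as (H' & w'' & J1 & J2 & J3 & J4 & J5 & J6); auto.
  { intros x _ eta Heta. exists 1. split; [lra|]. intros y _ _.
    replace (e 0 - e 0)%C with (RtoC 0) by ring. rewrite Cmod_0. exact Heta. }
  { intros t Ht. rewrite <- H4 by exact Ht. apply H2; assumption. }
  (* The lift of the segment from [e t] back to [e 0] is [o] read at [(1 - s) * v t], which stays
     between [v t] and 0. *)
  { intros t Ht. destruct (line_lift (e 0) d v w' Hv0) with (t := t) as (a & b & o & A0 & A1 & A2 & A3); auto.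
    { apply (lift_ext _ e _ w' _); auto. }
    exists (fun s => o ((1 - s) * v t)). split; [rewrite <- A3; f_equal; ring|].
    apply (lift_ext _ (fun s => e 0 + RtoC ((1 - s) * v t) * d)%C _ (fun s => o ((1 - s) * v t)) _).
    - intros s Hs'. rewrite (Eline t), RtoC_mult, RtoC_minus. ring.
    - reflexivity.
    - apply (lift_comp (itv a b) (itv 0 1) (fun y => e 0 + RtoC y * d)%C o (fun s => (1 - s) * v t)); auto.
      + intros s Hs'. unfold itv in *. nra.
      + intros s Hs' eta Heta. pose proof (Rabs_pos (v t)).
        exists (eta / (Rabs (v t) + 1)). split; [apply Rdiv_lt_0_compat; lra|].
        intros y Hy Hys. replace ((1 - y) * v t - (1 - s) * v t) with (- ((y - s) * v t)) by ring.
        rewrite Rabs_Ropp, Rabs_mult.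
        apply (Rmult_lt_compat_r (Rabs (v t) + 1)) in Hys; [|lra]. unfold Rdiv in Hys.
        rewrite Rmult_assoc, Rinv_l in Hys by lra. pose proof (Rabs_pos (y - s)). nra. }
  exists H, H'. repeat split; auto.
  - intros t Ht. rewrite (J3 t Ht), (H4 t Ht). reflexivity.
  - intros t Ht. rewrite (J4 t Ht), (J4 0 I0). f_equal.
    apply (lift_const_path (fun _ => e 0)); auto.
Qed.

(** * From free to based contractions *)

Definition lip2 (f : R -> R -> R) (k : R) : Prop :=
  forall s t s' t', Rabs (f s' t' - f s t) <= k * (Rabs (s' - s) + Rabs (t' - t)).

Lemma leaf_cont2_comp (H : R -> R -> C2) (f g : R -> R -> R) (k : R) : 0 < k ->
  leaf_cont2 lam F rho r H -> lip2 f k -> lip2 g k ->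
  (forall s t, itv 0 1 s -> itv 0 1 t -> itv 0 1 (f s t) /\ itv 0 1 (g s t)) ->
  leaf_cont2 lam F rho r (fun s t => H (f s t) (g s t)).
Proof.
  intros Hk HH Hf Hg Hin s t Hs Ht O HO Hst. destruct (Hin s t Hs Ht) as [I1 I2].
  destruct (HH _ _ I1 I2 O HO Hst) as [d [Hd K]].
  exists (d / (2 * k)). split; [apply Rdiv_lt_0_compat; lra|]. intros s' t' Hs' Ht' Hss Htt.
  destruct (Hin s' t' Hs' Ht') as [J1 J2].
  assert (B : k * (Rabs (s' - s) + Rabs (t' - t)) < d).
  { apply Rlt_le_trans with (k * (d / (2 * k) + d / (2 * k))); [|right; field; lra].
    apply Rmult_lt_compat_l; lra. }
  apply K; auto; eapply Rle_lt_trans; [apply Hf | exact B | apply Hg | exact B].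
Qed.

Lemma leaf_cont2_glue (H1 H2 : R -> R -> C2) :
  leaf_cont2 lam F rho r H1 -> leaf_cont2 lam F rho r H2 ->
  (forall t, itv 0 1 t -> H1 1 t = H2 0 t) ->
  leaf_cont2 lam F rho r (fun s t => if Rle_dec s (1 / 2) then H1 (2 * s) t else H2 (2 * s - 1) t).
Proof.
  intros K1 K2 E s t Hs Ht O HO Hst.
  assert (Left : s <= 1 / 2 -> O (H1 (2 * s) t) -> exists d, 0 < d /\
    forall s' t', itv 0 1 s' -> itv 0 1 t' -> Rabs (s' - s) < d -> Rabs (t' - t) < d ->
      s' <= 1 / 2 -> O (H1 (2 * s') t')).
  { intros Hle Ho. destruct (K1 (2 * s) t ltac:(lra) Ht O HO Ho) as [d [Hd K]].
    exists (d / 2). split; [lra|]. intros s' t' Hs' Ht' A B C. unfold itv in *.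
    apply K; try lra. apply Rabs_def2 in A. apply Rabs_def1; lra. }
  assert (Right : 1 / 2 <= s -> O (H2 (2 * s - 1) t) -> exists d, 0 < d /\
    forall s' t', itv 0 1 s' -> itv 0 1 t' -> Rabs (s' - s) < d -> Rabs (t' - t) < d ->
      1 / 2 <= s' -> O (H2 (2 * s' - 1) t')).
  { intros Hle Ho. destruct (K2 (2 * s - 1) t ltac:(lra) Ht O HO Ho) as [d [Hd K]].
    exists (d / 2). split; [lra|]. intros s' t' Hs' Ht' A B C. unfold itv in *.
    apply K; try lra. apply Rabs_def2 in A. apply Rabs_def1; lra. }
  destruct (Rtotal_order s (1 / 2)) as [Hlt|[Heq|Hgt]].
  - destruct (Rle_dec s (1 / 2)); [|lra]. destruct Left as [d [Hd K]]; [lra | exact Hst |].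
    exists (Rmin d (1 / 2 - s)). split; [apply Rmin_glb_lt; lra|]. intros s' t' Hs' Ht' A B.
    assert (A1 := Rlt_le_trans _ _ _ A (Rmin_l _ _)). assert (A2 := Rlt_le_trans _ _ _ A (Rmin_r _ _)).
    assert (B1 := Rlt_le_trans _ _ _ B (Rmin_l _ _)). apply Rabs_def2 in A2.
    destruct (Rle_dec s' (1 / 2)); [|lra]. apply K; auto.
  - subst s. destruct (Rle_dec (1 / 2) (1 / 2)); [|lra].
    destruct Left as [d1 [Hd1 L]]; [lra | exact Hst |].
    replace (2 * (1 / 2)) with 1 in Hst by field. rewrite (E t Ht) in Hst.
    destruct Right as [d2 [Hd2 Rt]]; [lra | replace (2 * (1 / 2) - 1) with 0 by field; exact Hst |].
    exists (Rmin d1 d2). split; [apply Rmin_glb_lt; lra|]. intros s' t' Hs' Ht' A B.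
    assert (A1 := Rlt_le_trans _ _ _ A (Rmin_l _ _)). assert (A2 := Rlt_le_trans _ _ _ A (Rmin_r _ _)).
    assert (B1 := Rlt_le_trans _ _ _ B (Rmin_l _ _)). assert (B2 := Rlt_le_trans _ _ _ B (Rmin_r _ _)).
    destruct (Rle_dec s' (1 / 2)); [apply L | apply Rt]; auto; lra.
  - destruct (Rle_dec s (1 / 2)); [lra|]. destruct Right as [d [Hd K]]; [lra | exact Hst |].
    exists (Rmin d (s - 1 / 2)). split; [apply Rmin_glb_lt; lra|]. intros s' t' Hs' Ht' A B.
    assert (A1 := Rlt_le_trans _ _ _ A (Rmin_l _ _)). assert (A2 := Rlt_le_trans _ _ _ A (Rmin_r _ _)).
    assert (B1 := Rlt_le_trans _ _ _ B (Rmin_l _ _)). apply Rabs_def2 in A2.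
    destruct (Rle_dec s' (1 / 2)); [lra|]. apply K; auto; lra.
Qed.

Lemma Rmin_lip (a b a' b' k : R) : Rabs (a' - a) <= k -> Rabs (b' - b) <= k ->
  Rabs (Rmin a' b' - Rmin a b) <= k.
Proof.
  intros H1 H2. apply Rabs_le_between in H1, H2. apply Rabs_le.
  unfold Rmin. do 2 destruct Rle_dec; lra.
Qed.

Lemma Rmax_lip (a b a' b' k : R) : Rabs (a' - a) <= k -> Rabs (b' - b) <= k ->
  Rabs (Rmax a' b' - Rmax a b) <= k.
Proof.
  intros H1 H2. apply Rabs_le_between in H1, H2. apply Rabs_le.
  unfold Rmax. do 2 destruct Rle_dec; lra.
Qed.

(* t |-> (tent t, ramp t) runs along the sides [0,1]x{0}, {1}x[0,1] and [0,1]x{1} of the unit square. *)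
Definition tent (t : R) : R := Rmin 1 (Rmin (3 * t) (3 - 3 * t)).
Definition ramp (t : R) : R := Rmax 0 (Rmin 1 (3 * t - 1)).

Ltac piecewise_lip :=
  intros s t s' t'; unfold tent, ramp;
  repeat first [apply Rmin_lip | apply Rmax_lip];
  match goal with
  | |- Rabs (?x - ?y) <= _ =>
      pose proof (Rabs_pos (s' - s)); pose proof (Rabs_pos (t' - t));
      unfold Rabs in *; repeat destruct Rcase_abs; lra
  end.

Ltac piecewise := unfold tent, ramp, Rmin, Rmax; repeat destruct Rle_dec; lra.

(* The square is first deformed so that its left side is moved onto the other
   three; the loop read there runs forth and back along s |-> H s 0. *)
Lemma based_contraction (p : C2) (g : R -> C2) (H : R -> R -> C2) :
  free_contraction p g H ->
  exists H' : R -> R -> C2, leaf_cont2 lam F rho r H' /\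
    (forall s t, itv 0 1 s -> itv 0 1 t -> same_leaf lam F rho r p (H' s t)) /\
    (forall t, itv 0 1 t -> H' 0 t = g t /\ H' 1 t = g 0) /\
    (forall s, itv 0 1 s -> H' s 0 = g 0 /\ H' s 1 = g 0).
Proof.
  intros (Hc & Hp & H0 & Hloop & H1).
  assert (I0 : itv 0 1 0) by (unfold itv; lra). assert (I1 : itv 0 1 1) by (unfold itv; lra).
  (* The point [(f1 s t, f2 s t)] is [(tent t, ramp t)] clamped coordinatewise to distance [s] from
     [(0, t)]: it starts on the left side, has arrived at [s = 1], and stays fixed for [t = 0] and
     [t = 1]. *)
  set (f1 := fun s t => Rmin s (tent t)).
  set (f2 := fun s t => Rmax (t - s) (Rmin (t + s) (ramp t))).
  (* The excursion along the path of the base point is cut off at height [1 - s], which retracts it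
     to [H 0 0]. *)
  set (f3 := fun s t => Rmin (1 - s) (tent t)).
  (* 3 is the steepest slope of [tent] and [ramp]. *)
  assert (L1 : lip2 f1 3) by (unfold lip2, f1; piecewise_lip).
  assert (L2 : lip2 f2 3) by (unfold lip2, f2; piecewise_lip).
  assert (L3 : lip2 f3 3) by (unfold lip2, f3; piecewise_lip).
  assert (L4 : lip2 (fun _ _ => 0) 3) by (unfold lip2; piecewise_lip).
  assert (R1 : forall s t, itv 0 1 s -> itv 0 1 t -> itv 0 1 (f1 s t) /\ itv 0 1 (f2 s t)).
  { unfold itv, f1, f2. intros s t Hs Ht. repeat split; piecewise. }
  assert (R3 : forall s t, itv 0 1 s -> itv 0 1 t -> itv 0 1 (f3 s t) /\ itv 0 1 0).
  { unfold itv, f3. intros s t Hs Ht. repeat split; piecewise. }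
  assert (E00 : H 0 0 = g 0) by (apply H0; exact I0).
  assert (E01 : H 0 1 = g 0) by (rewrite <- (Hloop 0 I0); exact E00).
  exists (fun s t => if Rle_dec s (1 / 2) then H (f1 (2 * s) t) (f2 (2 * s) t) else H (f3 (2 * s - 1) t) 0).
  split; [|split; [|split]].
  - apply (leaf_cont2_glue (fun s t => H (f1 s t) (f2 s t)) (fun s t => H (f3 s t) 0)).
    + apply (leaf_cont2_comp H f1 f2 3); auto; lra.
    + apply (leaf_cont2_comp H f3 (fun _ _ => 0) 3); auto; lra.
    + intros t Ht. unfold itv in Ht.
      replace (f1 1 t) with (tent t) by (unfold f1; piecewise).
      replace (f2 1 t) with (ramp t) by (unfold f2; piecewise).
      replace (f3 0 t) with (tent t) by (unfold f3; piecewise).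
      assert (It : itv 0 1 (tent t)) by (unfold itv; split; piecewise).
      assert (Ir : itv 0 1 (ramp t)) by (unfold itv; split; piecewise).
      (* The three thirds are the way out along [H s 0], a rest on the constant slice [s = 1], and
         the way back along [H s 1], which equals [H s 0]. *)
      destruct (Rle_dec t (1 / 3)); [|destruct (Rle_dec t (2 / 3))].
      * replace (ramp t) with 0 by piecewise. reflexivity.
      * replace (tent t) with 1 by piecewise. apply H1, Ir.
      * replace (ramp t) with 1 by piecewise. symmetry. apply Hloop, It.
  - intros s t Hs Ht. destruct (Rle_dec s (1 / 2)); apply Hp; try apply R1; try (apply (R3 _ t)); auto;
      unfold itv in *; lra.
  - intros t Ht. unfold itv in Ht. split.
    + destruct (Rle_dec 0 (1 / 2)); [|lra]. rewrite <- (H0 t Ht). f_equal; [unfold f1 | unfold f2]; piecewise.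
    + destruct (Rle_dec 1 (1 / 2)); [lra|]. rewrite <- E00. f_equal. unfold f3. piecewise.
  - intros s Hs. unfold itv in Hs. split; destruct (Rle_dec s (1 / 2)).
    + rewrite <- E00. f_equal; [unfold f1 | unfold f2]; piecewise.
    + rewrite <- E00. f_equal. unfold f3. piecewise.
    + rewrite <- E01. f_equal; [unfold f1 | unfold f2]; piecewise.
    + rewrite <- E00. f_equal. unfold f3. piecewise.
Qed.

Lemma free_contraction_trans (p : C2) (g : R -> C2) (H1 H2 : R -> R -> C2) :
  leaf_cont2 lam F rho r H1 ->
  (forall s t, itv 0 1 s -> itv 0 1 t -> same_leaf lam F rho r p (H1 s t)) ->
  (forall t, itv 0 1 t -> H1 0 t = g t) -> (forall s, itv 0 1 s -> H1 s 0 = H1 s 1) ->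
  free_contraction p (H1 1) H2 ->
  exists H, free_contraction p g H.
Proof.
  intros K1 K2 K3 K4 (J1 & J2 & J3 & J4 & J5).
  exists (fun s t => if Rle_dec s (1 / 2) then H1 (2 * s) t else H2 (2 * s - 1) t).
  split; [|split; [|split; [|split]]].
  - apply leaf_cont2_glue; auto. intros t Ht. symmetry. apply J3, Ht.
  - intros s t Hs Ht. unfold itv in Hs. destruct (Rle_dec s (1 / 2)); [apply K2 | apply J2]; auto; unfold itv; lra.
  - intros t Ht. destruct (Rle_dec 0 (1 / 2)); [|lra]. rewrite Rmult_0_r. apply K3, Ht.
  - intros s Hs. unfold itv in Hs. destruct (Rle_dec s (1 / 2)); [apply K4 | apply J4]; unfold itv; lra.
  - intros t Ht. destruct (Rle_dec 1 (1 / 2)); [lra|]. replace (2 * 1 - 1) with 1 by ring. apply J5, Ht.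
Qed.

(** Viewed as homotopies constant in the second parameter, paths are concatenated by
    [leaf_cont2_glue]. *)
Lemma leaf_cont1_cont2 (g : R -> C2) :
  leaf_cont1 lam F rho r g <-> leaf_cont2 lam F rho r (fun s _ => g s).
Proof.
  split.
  - intros H s t Hs Ht O HO Hg. destruct (H s Hs O HO Hg) as [d [Hd K]].
    exists d. split; [exact Hd|]. intros s' t' Hs' _ A _. apply K; assumption.
  - intros H s Hs O HO Hg. assert (I0 : 0 <= 0 <= 1) by lra.
    destruct (H s 0 Hs I0 O HO Hg) as [d [Hd K]].
    exists d. split; [exact Hd|]. intros s' Hs' A. apply (K s' 0); auto. apply Rabs_minus_self, Hd.
Qed.

(** Each link of a chain is an integral curve on a disc; by convexity the segment from [T1] to [T2]
    gives the piece of path to append. *)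
Lemma leaf_path_connected (p q : C2) : same_leaf lam F rho r p q ->
  exists g, leaf_cont1 lam F rho r g /\
    (forall t, 0 <= t <= 1 -> same_leaf lam F rho r p (g t)) /\ g 0 = p /\ g 1 = q.
Proof.
  intros Hq. induction Hq as [Hp | q phi c e T1 T2 Hq IH He Hphi HT1 HT2 Eq].
  - exists (fun _ => p). split; [|split; [|split; reflexivity]].
    + intros t Ht O _ HO. exists 1. split; [lra|]. auto.
    + intros _ _. apply same_leaf_refl, Hp.
  - destruct IH as (g & G1 & G2 & G3 & G4).
    set (l := fun x : R => (T1 + RtoC x * (T2 - T1))%C).
    assert (Hl : forall x, 0 <= x <= 1 -> Cmod (l x - c)%C < e).
    { intros x Hx. eapply Rle_lt_trans.
      - apply (convex_ball_segment c T1 T2 (Rmax (Cmod (T1 - c)%C) (Cmod (T2 - c)%C)));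
          [apply Rmax_l | apply Rmax_r | exact Hx].
      - apply Rmax_lub_lt; assumption. }
    assert (L0 : l 0 = T1) by (unfold l; ring). assert (L1 : l 1 = T2) by (unfold l; ring).
    exists (fun s => if Rle_dec s (1 / 2) then g (2 * s) else phi (l (2 * s - 1))).
    split; [|split; [|split]].
    + apply leaf_cont1_cont2.
      apply (leaf_cont2_glue (fun s _ => g s) (fun s _ => phi (l s))).
      * apply leaf_cont1_cont2, G1.
      * apply leaf_cont1_cont2. intros x Hx O HO Hin.
        destruct (HO phi c e Hphi (l x) (Hl x Hx) Hin) as [d [Hd K]].
        destruct (affine_cont (itv 0 1) T1 (T2 - T1)%C x Hx d Hd) as [d' [Hd' K']].
        exists d'. split; [exact Hd'|]. intros y Hy Hyx. apply K; [|apply Hl, Hy]. apply K'; assumption.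
      * intros t _. rewrite L0, G4. symmetry. exact Eq.
    + intros t Ht. destruct (Rle_dec t (1 / 2)); [apply G2; lra|].
      apply (same_leaf_step lam F rho r p q phi c e T1); auto. apply Hl. lra.
    + destruct (Rle_dec 0 (1 / 2)); [|lra]. rewrite Rmult_0_r. exact G3.
    + destruct (Rle_dec 1 (1 / 2)); [lra|]. replace (2 * 1 - 1) with 1 by ring. rewrite L1. reflexivity.
Qed.

Lemma leaf_is_simply_connected (p : C2) : leaf_simply_connected lam F rho r p.
Proof.
  split; [apply leaf_path_connected|]. intros g Hg Hin Hloop.
  assert (HL := leaf_cont1_lift g Hg (fun t Ht => same_leaf_Utilde p _ (Hin t Ht))).
  set (c := fun t => (fst (g t) / lam)%C) in *. set (w := fun t => snd (g t)) in *.
  assert (Eg : forall t, (lam * c t, w t)%C = g t).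
  { intros t. unfold c, w. apply injective_projections; [|reflexivity]. simpl. field. exact lam_nz. }
  assert (Ec : c 0 = c 1) by (unfold c; rewrite Hloop; reflexivity).
  assert (Ew : w 0 = w 1) by (unfold w; rewrite Hloop; reflexivity).
  assert (Hp : forall t, itv 0 1 t -> same_leaf lam F rho r p (lam * c t, w t)%C).
  { intros t Ht. rewrite Eg. apply Hin, Ht. }
  assert (HF : exists H, free_contraction p (fun t => (lam * c t, w t)%C) H).
  { destruct (Rle_dec 0 (Re lam)) as [Hlam|Hlam].
    - apply contraction_Re_lam_nonneg; auto.
    - destruct (contraction_Re_lam_neg p c w) as (H1 & H2 & K1 & K2 & K3 & K4 & K5); auto; [lra|].
      apply (free_contraction_trans p _ H1 H2); auto. }
  destruct HF as [H HF]. destruct (based_contraction p _ H HF) as (H' & K1 & K2 & K3 & K4).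
  exists H'. split; [exact K1|]. split; [exact K2|]. split.
  - intros t Ht. destruct (K3 t Ht) as [-> ->]. rewrite !Eg. auto.
  - intros s Hs. destruct (K4 s Hs) as [-> ->]. rewrite !Eg. auto.
Qed.

End ODE.

Theorem theorem1 (lam : C) (a : nat) (F : C -> C -> C) (rho r : R) :
  lam <> RtoC 0 ->
  (1 <= a)%nat ->
  0 < rho -> 0 < r ->
  in_xa_germs a F ->
  holo2_on (polydisc rho r) F ->
  (exists M : R, M < 1 /\ forall p : C2, polydisc rho r p -> Cmod (F (fst p) (snd p)) <= M) ->
  (forall p : C2, Utilde rho r p -> pullback_field lam F p <> (RtoC 0, RtoC 0)) /\
  (forall p : C2, Utilde rho r p -> leaf_simply_connected lam F rho r p).
Proof.
  intros Hlam _ Hrho Hr _ HF (M & HM & HB). split.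
  (* The first component of the field is the constant [lam]. *)
  - intros p _ E. apply Hlam. exact (f_equal fst E).
  - intros p _. apply (leaf_is_simply_connected lam F rho r M); assumption.
Qed.
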